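(* Let $$g(x)=\frac{|x|^\alpha}{\alpha}-\frac{|x|^\beta}{\beta},\qquad x\in\mathbb{R}^N,$$ with either $\beta=2$, $N\ge 2$ and $\alpha\in(2,4)$, or $\beta=2$, $N=1$ and $\alpha\in(3,4)$. Then, for every $m>0$, the minimizer $f_m$ (unique up to translations) of $$\min\Bigl\{\mathcal{E}(h) : h\in L^1(\mathbb{R}^N),\ 0\le h\le 1,\ \|h\|_1=m\Bigr\}$$ is, up to translation and up to Lebesgue-null sets, the characteristic function of a radial set $E_m$, which is either an annulus or a disk (ball). In particular, for all sufficiently small $m>0$ the set $E_m$ is an annulus, and as $m\searrow 0$ it converges in the Hausdorff distance to a sphere $\{|x|=r\}$ for some $r>0$.
   Context: For a density $h\in L^1(\mathbb{R}^N;[0,1])$, $\mathcal{E}(h)=\int_{\mathbb{R}^N}\int_{\mathbb{R}^N} g(x-y)h(x)h(y)\,dx\,dy$. An annulus is a set of the form $\{x\in\mathbb{R}^N: a<|x|<b\}$ with $0\le a<b$, and a disk is a ball $\{x\in\mathbb{R}^N:|x|<b\}$ with $b>0$ (up to null sets). For $N=1$ the sphere $\{|x|=r\}$ is the pair of points $\{\pm r\}$. *)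

(* Defs.v *)
From HB Require Import structures.
From mathcomp Require Import all_boot all_order all_algebra.
From mathcomp Require Import all_classical all_reals all_analysis.

Set Implicit Arguments.
Unset Strict Implicit.
Unset Printing Implicit Defensive.

Import Order.TTheory GRing.Theory Num.Theory.
Import numFieldNormedType.Exports.

Local Open Scope classical_set_scope.
Local Open Scope ring_scope.

(* R^N, with the product Borel sigma-algebra on tuples. *)
Notation vec R N := (N.-tuple (measurableTypeR R)).

Section euclidean_space.
Context {R : realType} {N : nat}.
Implicit Types (x y a : vec R N) (A B E : set (vec R N)).

Definition vsub x y : vec R N := [tuple (tnth x i : R) - tnth y i | i < N].

Definition enorm x : R := Num.sqrt (\sum_(i < N) (tnth x i : R) ^+ 2).

Definition translate {U : Type} (a : vec R N) (h : vec R N -> U) :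
  vec R N -> U := fun x => h (vsub x a).

(* a = 0 is allowed, giving a punctured ball: a set distinct from, but a.e.
   equal to, a disk. *)
Definition is_annulus E : Prop :=
  exists a b : R, [/\ 0 <= a, a < b & E = [set x | a < enorm x < b]].

Definition is_disk E : Prop :=
  exists b : R, 0 < b /\ E = [set x | enorm x < b].

Definition sphere (r : R) : set (vec R N) := [set x | enorm x = r].

Definition dist_to_set x A : \bar R :=
  ereal_inf [set (enorm (vsub x y))%:E | y in A].

(* Extended-valued, so that no finiteness convention is needed for
   unbounded sets. *)
Definition hausdorff_dist A B : \bar R :=
  Order.max (ereal_sup [set dist_to_set x B | x in A])
            (ereal_sup [set dist_to_set y A | y in B]).

End euclidean_space.

Definition cons_pair {T : Type} (n : nat) (p : T * n.-tuple T) : n.+1.-tuple T :=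
  [tuple of p.1 :: p.2].

Fixpoint lebesgueN (R : realType) (n : nat) : set (vec R n) -> \bar R :=
  match n with
  | 0 => \d_([tuple] : vec R 0)
  | n'.+1 =>
      pushforward ((@lebesgue_measure R) \x @lebesgueN R n')%E
        (@cons_pair (measurableTypeR R) n')
  end.

Section lebesgueN_measure.
Context {R : realType}.

Lemma measurable_cons_pair n :
  measurable_fun [set: measurableTypeR R * vec R n] (@cons_pair (measurableTypeR R) n).
Proof. exact: measurable_cons. Qed.

Section successor.
Variables (n : nat) (mu : {sigma_finite_measure set (vec R n) -> \bar R}).

Let leb : {sigma_finite_measure set (measurableTypeR R) -> \bar R} := @lebesgue_measure R.

Let nu : set (vec R n.+1) -> \bar R :=
  pushforward (leb \x mu)%E (@cons_pair (measurableTypeR R) n).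

Let nu0 : nu set0 = 0%E.
Proof. by rewrite /nu /pushforward preimage_set0 measure0. Qed.

Let nu_ge0 A : (0 <= nu A)%E.
Proof. by rewrite /nu /pushforward measure_ge0. Qed.

Let nu_sigma_additive : semi_sigma_additive nu.
Proof.
exact: (@measure_semi_sigma_additive _ _ _
  (measure_function_pushforward__canonical__measure_function_Measure
    (leb \x mu)%E (@measurable_cons_pair n))).
Qed.

HB.instance Definition _ := isMeasure.Build _ _ _ nu
  nu0 nu_ge0 nu_sigma_additive.

Let nu_sigma_finite : sigma_finite setT nu.
Proof.
have /sigma_finiteP[F [TF ndF Foo]] := sigma_finiteT leb.
have /sigma_finiteP[G [TG ndG Goo]] := sigma_finiteT mu.
pose uncons (x : vec R n.+1) : measurableTypeR R * vec R n :=
  (thead x, [tuple of behead x]).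
have munc : measurable_fun setT uncons.
  apply: measurable_fun_pair; first exact: measurable_tnth.
  exact: measurable_behead.
have consK : cancel (@cons_pair (measurableTypeR R) n) uncons.
  by move=> [a t]; rewrite /uncons theadE; congr pair; apply: val_inj.
have boxE k : @cons_pair (measurableTypeR R) n @^-1`
    (uncons @^-1` (F k `*` G k)) = F k `*` G k.
  by apply/funext => p; exact: (congr1 (F k `*` G k) (consK p)).
exists (fun k => uncons @^-1` (F k `*` G k)).
  rewrite -preimage_bigcup; apply/seteqP; split=> // x _.
  have [k _ Fk] : (\bigcup_k F k) (uncons x).1 by rewrite -TF.
  have [l _ Gl] : (\bigcup_k G k) (uncons x).2 by rewrite -TG.
  exists (maxn k l) => //; split => /=.
    by move: Fk; exact/subsetPset/ndF/leq_maxl.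
  by move: Gl; exact/subsetPset/ndG/leq_maxr.
move=> k; have [mF Fk] := Foo k; have [mG Gk] := Goo k; split.
  by rewrite -[X in measurable X]setTI; apply: munc => //; exact: measurableX.
rewrite /nu /pushforward boxE product_measure1E //.
by rewrite lte_mul_pinfty // ge0_fin_numE.
Qed.

HB.instance Definition _ := Measure_isSigmaFinite.Build _ _ _ nu
  nu_sigma_finite.

Definition lebesgueN_succ :
  {sigma_finite_measure set (vec R n.+1) -> \bar R} := nu.

End successor.

Lemma lebesgueN_sigma_finite_measure n :
  exists mu : {sigma_finite_measure set (vec R n) -> \bar R},
    @lebesgueN R n = mu :> (set (vec R n) -> \bar R).
Proof.
elim: n => [|n [mu IH]] /=.
  by exists (\d_([tuple] : vec R 0)).
by rewrite IH; exists (lebesgueN_succ mu).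
Qed.

Let lebesgueN0 n : @lebesgueN R n set0 = 0%E.
Proof. by have [mu ->] := lebesgueN_sigma_finite_measure n. Qed.

Let lebesgueN_ge0 n A : (0 <= @lebesgueN R n A)%E.
Proof. by have [mu ->] := lebesgueN_sigma_finite_measure n. Qed.

Let lebesgueN_sigma_additive n : semi_sigma_additive (@lebesgueN R n).
Proof.
have [mu ->] := lebesgueN_sigma_finite_measure n.
exact: measure_semi_sigma_additive.
Qed.

HB.instance Definition _ n := isMeasure.Build _ _ _ (@lebesgueN R n)
  (@lebesgueN0 n) (@lebesgueN_ge0 n) (@lebesgueN_sigma_additive n).

Let lebesgueN_sigma_finite n : sigma_finite setT (@lebesgueN R n).
Proof.
have [mu ->] := lebesgueN_sigma_finite_measure n; exact: sigma_finiteT.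
Qed.

HB.instance Definition _ n := Measure_isSigmaFinite.Build _ _ _
  (@lebesgueN R n) (@lebesgueN_sigma_finite n).

Lemma measurable_box n (A : 'I_n -> set (measurableTypeR R)) :
  (forall i, measurable (A i)) ->
  measurable [set x : vec R n | forall i, A i (tnth x i)].
Proof.
move=> mA; rewrite (_ : [set x | _] =
    \big[setI/setT]_(i < n) ((fun x : vec R n => tnth x i) @^-1` A i)).
  apply: bigsetI_measurable => i _.
  by rewrite -[X in measurable X]setTI; apply: measurable_tnth.
rewrite -bigcap_seq; apply/seteqP; split=> x /=.
  by move=> Ax i _; exact: Ax.
by move=> Ax i; apply: Ax; rewrite /= mem_index_enum.
Qed.

Lemma lebesgueN_box n (A : 'I_n -> set (measurableTypeR R)) :
  (forall i, measurable (A i)) ->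
  lebesgueN [set x : vec R n | forall i, A i (tnth x i)] =
  (\prod_(i < n) lebesgue_measure (A i))%E.
Proof.
elim: n A => [|n IH] A mA.
  by rewrite /= big_ord0 diracE mem_set // => -[].
have mA' i : measurable (A (lift ord0 i)) by [].
rewrite big_ord_recl -(IH (fun i => A (lift ord0 i))) //.
rewrite -product_measure1E; [|exact: mA|].
  2: by apply: (measurable_box (A := fun i => A (lift ord0 i))).
rewrite /= /pushforward; congr (product_measure1 _ _ _).
apply/seteqP; split => -[a t] /=.
  move=> Ax; split; first exact: (Ax ord0).
  by move=> i; have := Ax (lift ord0 i); rewrite tnthS.
move=> [Aa At] i; case: (unliftP ord0 i) => [k|] ->; last exact: Aa.
by rewrite tnthS; exact: At.
Qed.

End lebesgueN_measure.

Section energy.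
Context {R : realType} {N : nat}.
Implicit Types (h : vec R N -> R).

Definition kernel_g (alpha beta : R) (x : vec R N) : R :=
  enorm x `^ alpha / alpha - enorm x `^ beta / beta.

(* The integral is \bar R-valued as the kernel is unbounded above; when
   0 < beta < alpha the kernel is bounded below, so on admissible densities only
   the value +oo can occur besides real ones. *)
Definition energy (alpha beta : R) h : \bar R :=
  (\int[@lebesgueN R N]_x \int[@lebesgueN R N]_y
    (kernel_g alpha beta (vsub x y) * h x * h y)%:E)%E.

(* Elements of L^1 are represented by Borel functions, identified a.e.; every
   Lebesgue measurable function has such a representative. *)
Definition admissible (m : R) h : Prop :=
  [/\ h \in Lfun (@lebesgueN R N) 1,
      {ae @lebesgueN R N, forall x, 0 <= h x <= 1}
    & ('N[@lebesgueN R N]_1[EFin \o h] = m%:E)%E].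

Definition is_minimizer (alpha beta m : R) h : Prop :=
  admissible m h /\
  forall k, admissible m k -> (energy alpha beta h <= energy alpha beta k)%E.

Definition ae_translate h1 h2 : Prop :=
  exists a : vec R N, h1 = translate a h2 %[ae @lebesgueN R N].

Definition minimizer_shape (alpha beta m : R) (E : set (vec R N)) : Prop :=
  (is_annulus E \/ is_disk E) /\
  forall f, is_minimizer alpha beta m f -> ae_translate f \1_E.

End energy.

(* Main.v *)
Require Import Defs.
From mathcomp Require Import all_boot all_order all_algebra.
From mathcomp Require Import all_classical all_reals all_analysis.
From mathcomp Require Import measurable_realfun.
From mathcomp Require Import ring lra.
Import Order.TTheory GRing.Theory Num.Theory.
Import numFieldNormedType.Exports.
Local Open Scope classical_set_scope.
Local Open Scope ring_scope.
Set Implicit Arguments.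
Unset Strict Implicit.
Unset Printing Implicit Defensive.

(** Write [p = alpha / 2], so that [1 < p < 2] and [4 < N + 2 p].  Two facts about
    the power [s `^ p] of the squared distance carry the proof.

    Convexity of the energy.  If [h] has mass [m] and center of mass at the
    origin, the quadratic part of its energy is explicit and the energy equals
    [I(h,h) / (2 p) - m * (integral of |x|^2 h)], where [I(h,k)] is the double
    integral of [|x - y|^(2p) h(x) k(y)] ([energy_centered]).  On centered
    densities of the same mass, [2 I(k,f) <= I(k,k) + I(f,f)]
    ([power_form_psd]): up to a positive constant [s^p] is the mixture, over
    [t > 0], of [exp(-t s) - 1 + t s]; the difference [k - f] does not see the
    last two terms, and the Gaussian kernel is a convolution square.  Hence, for
    every real [lambda],
    [E(k) - E(f) >= 1/p * integral of (Phi - lambda) (k - f)],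
    where [Phi(x)] is the potential [|.|^(2p) * f] minus [m p |x|^2].  If [f] is
    the characteristic function of [A], with [Phi < lambda] in [A] and
    [Phi > lambda] outside its closure, then [0 <= k <= 1] makes the integrand
    nonnegative, and equality forces [k = f] almost everywhere
    ([centered_comparison], [ann_minimal]).  So existence, uniqueness and shape
    all follow once such an annulus or ball [A] is found.

    Quasiconvexity of potentials.  The bilaplacian of [|x|^(2p)] is
    [2p (2p-2) (N+2p-2) (N+2p-4) |x|^(2p-4)], which is positive because
    [4 < N + 2p].  Two applications of the maximum principle show that a radial
    function with positive bilaplacian is strictly quasiconvex in [|x|], and
    subtracting [c |x|^2] does not change the bilaplacian
    ([gpot_quasiconvex]).  For an annulus [a < |x| < b] it is therefore enough
    that [Phi] takes the same value on both boundary spheres, and for a ball that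
    [Phi] on the boundary is at least [Phi] at the center.  The difference of the
    boundary values is continuous in [a] along the annuli of mass [m], and
    positive for a large [a]; either it is nonnegative at [a = 0], or it vanishes
    for some [a] ([equilibrium_annulus]).

    Small mass.  The energy of a thin annulus, divided by [m^2], is
    [A a^(2p) / (2p) - a^2] up to an error controlled by [b - a], where [A] is
    the mean of [|e - y/|y| |^(2p)] for a unit vector [e]
    ([energy_ann_lower], [energy_ann_upper]).  As [m] tends to [0] the thickness
    [b - a] tends to [0] uniformly in [a], and minimality forces [a] to approach
    the unique minimum point [r > 0] of this function
    ([minimal_annuli_concentrate]).  In particular [a > 0], so the set is not a
    disk, and its Hausdorff distance to [|x| = r] is at most
    [max(|a - r|, |b - r|)] ([hausdorff_ann_sphere]). *)

(** * Vectors of R^N *)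

Section vectors.
Context {R : realType} {N : nat}.
Implicit Types (x y z a : vec R N).

(** Coordinates are reals but tuple entries live in [measurableTypeR R]; [co]
    and [mkv] hide the cast, so that ring arithmetic applies coordinatewise. *)
Definition co x (i : 'I_N) : R := tnth x i.
Definition mkv (f : 'I_N -> R) : vec R N := [tuple (f i : measurableTypeR R) | i < N].

Lemma coE f i : co (mkv f) i = f i.
Proof. by rewrite /co /mkv tnth_mktuple. Qed.

Lemma vecP x y : (forall i, co x i = co y i) -> x = y.
Proof. by move=> h; apply: eq_from_tnth => i; exact: h. Qed.

Definition vadd x y := mkv (fun i => co x i + co y i).
Definition vscale (c : R) x := mkv (fun i => c * co x i).
Definition dot x y : R := \sum_(i < N) co x i * co y i.
Definition sq x : R := dot x x.
Definition vzero : vec R N := mkv (fun _ => 0).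
Definition ebase (i : 'I_N) : vec R N := mkv (fun j => (j == i)%:R).

Lemma co_sub x y i : co (vsub x y) i = co x i - co y i.
Proof. by rewrite /vsub [LHS]coE. Qed.
Lemma co_add x y i : co (vadd x y) i = co x i + co y i.
Proof. exact: coE. Qed.
Lemma co_scale c x i : co (vscale c x) i = c * co x i.
Proof. exact: coE. Qed.
Lemma co_zero i : co vzero i = 0. Proof. exact: coE. Qed.
Lemma co_base i j : co (ebase i) j = (j == i)%:R. Proof. exact: coE. Qed.
Definition cosE := (co_sub, co_add, co_scale, co_zero, co_base).

Lemma dotC x y : dot x y = dot y x.
Proof. by apply: eq_bigr => i _; rewrite mulrC. Qed.
Lemma dotDl x y z : dot (vadd x y) z = dot x z + dot y z.
Proof. by rewrite -big_split; apply: eq_bigr => i _; rewrite cosE mulrDl. Qed.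
Lemma dotBl x y z : dot (vsub x y) z = dot x z - dot y z.
Proof. by rewrite -sumrB; apply: eq_bigr => i _; rewrite cosE mulrBl. Qed.
Lemma dotZl c x z : dot (vscale c x) z = c * dot x z.
Proof. by rewrite mulr_sumr; apply: eq_bigr => i _; rewrite cosE mulrA. Qed.
Lemma dotDr x y z : dot z (vadd x y) = dot z x + dot z y.
Proof. by rewrite dotC dotDl !(dotC z). Qed.
Lemma dotBr x y z : dot z (vsub x y) = dot z x - dot z y.
Proof. by rewrite dotC dotBl !(dotC z). Qed.
Lemma dotZr c x z : dot z (vscale c x) = c * dot z x.
Proof. by rewrite dotC dotZl (dotC z). Qed.
Lemma dot_base x i : dot x (ebase i) = co x i.
Proof.
rewrite /dot (bigD1 i) //= cosE eqxx mulr1 big1 ?addr0// => j /negbTE ji.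
by rewrite cosE ji mulr0.
Qed.
Definition dotE := (dotDl, dotBl, dotZl, dotDr, dotBr, dotZr).

Lemma sqE x : sq x = \sum_(i < N) co x i ^+ 2.
Proof. by apply: eq_bigr => i _; rewrite expr2. Qed.
Lemma sq_ge0 x : 0 <= sq x.
Proof. by rewrite sqE; apply: sumr_ge0 => i _; rewrite sqr_ge0. Qed.
Lemma sq_eq0 x : sq x = 0 -> x = vzero.
Proof.
rewrite sqE => /psumr_eq0P h; apply: vecP => i; rewrite co_zero.
by apply/eqP; rewrite -sqrf_eq0; apply/eqP; apply: h => // j _; rewrite sqr_ge0.
Qed.
Lemma sq_base i : sq (ebase i) = 1.
Proof. by rewrite /sq dot_base cosE eqxx. Qed.
Lemma sqZ c x : sq (vscale c x) = c ^+ 2 * sq x.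
Proof. by rewrite /sq !dotE; ring. Qed.
Lemma sqD x y : sq (vadd x y) = sq x + 2 * dot x y + sq y.
Proof. by rewrite /sq !dotE (dotC y x); ring. Qed.
Lemma sqB x y : sq (vsub x y) = sq x - 2 * dot x y + sq y.
Proof. by rewrite /sq !dotE (dotC y x); ring. Qed.
Lemma sq_subC x y : sq (vsub x y) = sq (vsub y x).
Proof. by rewrite !sqB (dotC y x); ring. Qed.
Lemma co_sq_le x i : co x i ^+ 2 <= sq x.
Proof.
by rewrite sqE (bigD1 i) //= lerDl; apply: sumr_ge0 => j _; rewrite sqr_ge0.
Qed.

Lemma enormE x : enorm x = Num.sqrt (sq x).
Proof. by rewrite /enorm sqE. Qed.
Lemma enorm_ge0 x : 0 <= enorm x.
Proof. by rewrite enormE sqrtr_ge0. Qed.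
Lemma enorm_sq x : enorm x ^+ 2 = sq x.
Proof. by rewrite enormE sqr_sqrtr ?sq_ge0. Qed.

Lemma cauchy_schwarz x y : dot x y ^+ 2 <= sq x * sq y.
Proof.
have [y0|y0] := eqVneq (sq y) 0.
  rewrite (sq_eq0 y0) /sq /dot.
  rewrite big1 ?expr0n/= ?mulr0; last by move=> i _; rewrite cosE mulr0.
  by rewrite [X in _ * X]big1 ?mulr0 // => i _; rewrite cosE mulr0.
have y1 : 0 < sq y by rewrite lt0r y0 sq_ge0.
have := sq_ge0 (vsub (vscale (sq y) x) (vscale (dot x y) y)).
rewrite sqB !sqZ !dotE.
rewrite (_ : _ + _ = sq y * (sq x * sq y - dot x y ^+ 2)); last by ring.
by rewrite pmulr_rge0// subr_ge0.
Qed.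

Lemma dot_le x y : `|dot x y| <= enorm x * enorm y.
Proof.
rewrite -(@ler_pXn2r _ 2)// ?nnegrE ?mulr_ge0 ?enorm_ge0//.
by rewrite exprMn !enorm_sq -normrX ger0_norm ?sqr_ge0 ?cauchy_schwarz.
Qed.

Lemma enorm_add x y : enorm (vadd x y) <= enorm x + enorm y.
Proof.
rewrite -(@ler_pXn2r _ 2)// ?nnegrE ?addr_ge0 ?enorm_ge0//.
rewrite enorm_sq sqD sqrrD !enorm_sq.
have := ler_norm (dot x y); have := dot_le x y; lra.
Qed.

Lemma enorm_scale c x : enorm (vscale c x) = `|c| * enorm x.
Proof. by rewrite !enormE sqZ sqrtrM ?sqr_ge0// sqrtr_sqr. Qed.

Lemma enorm_subC x y : enorm (vsub x y) = enorm (vsub y x).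
Proof. by rewrite !enormE sq_subC. Qed.

Lemma enorm_sub x y : enorm (vsub x y) <= enorm x + enorm y.
Proof.
have -> : vsub x y = vadd x (vscale (-1) y) by apply: vecP => i; rewrite !cosE; ring.
by rewrite (le_trans (enorm_add _ _))// enorm_scale normrN1 mul1r.
Qed.

Lemma enorm_dist x y : `|enorm x - enorm y| <= enorm (vsub x y).
Proof.
have h a b : enorm a - enorm b <= enorm (vsub a b).
  have -> : a = vadd (vsub a b) b by apply: vecP => i; rewrite !cosE; ring.
  rewrite lerBlDr (le_trans (enorm_add _ _))//.
  by have -> : vsub (vadd (vsub a b) b) b = vsub a b by apply: vecP => i; rewrite !cosE; ring.
by rewrite ler_norml h lerNl opprB enorm_subC h.
Qed.

End vectors.

(** Splits a Gaussian in [n.+1] variables into a product. *)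
Lemma sq_cons {R : realType} n (t : R) (x : vec R n) :
  sq (cons_pair (t : measurableTypeR R, x)) = t ^+ 2 + sq x.
Proof.
rewrite !sqE big_ord_recl; congr (_ + _).
by apply: eq_bigr => i _; rewrite /co tnthS.
Qed.

Section measurability.
Context {R : realType} {N : nat} d (T : measurableType d).
Implicit Types (f g : T -> vec R N).

Lemma mfun_co f i : measurable_fun setT f -> measurable_fun setT (fun t => co (f t) i).
Proof. by move/measurable_fun_tnthP => /(_ i). Qed.

Lemma mfun_mkv (f : T -> 'I_N -> R) :
  (forall i, measurable_fun setT (fun t => f t i)) ->
  measurable_fun setT (fun t => mkv (f t)).
Proof.
move=> h; apply/measurable_fun_tnthP => i.
have -> : (fun x : vec R N => tnth x i) \o (fun t => mkv (f t)) = (fun t => f t i).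
  by apply/funext => t; rewrite /= -[LHS]/(co _ i) coE.
exact: h.
Qed.

Lemma mfun_vsub f g : measurable_fun setT f -> measurable_fun setT g ->
  measurable_fun setT (fun t => vsub (f t) (g t)).
Proof.
move=> mf mg; apply: (@mfun_mkv (fun t i => co (f t) i - co (g t) i)) => i.
by apply: measurable_funB; apply: mfun_co.
Qed.
Lemma mfun_vadd f g : measurable_fun setT f -> measurable_fun setT g ->
  measurable_fun setT (fun t => vadd (f t) (g t)).
Proof.
move=> mf mg; apply: (@mfun_mkv (fun t i => co (f t) i + co (g t) i)) => i.
by apply: measurable_funD; apply: mfun_co.
Qed.
Lemma mfun_vscale (c : T -> R) f : measurable_fun setT c -> measurable_fun setT f ->
  measurable_fun setT (fun t => vscale (c t) (f t)).
Proof.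
move=> mc mf; apply: (@mfun_mkv (fun t i => c t * co (f t) i)) => i.
by apply: measurable_funM => //; apply: mfun_co.
Qed.
Lemma mfun_dot f g : measurable_fun setT f -> measurable_fun setT g ->
  measurable_fun setT (fun t => dot (f t) (g t)).
Proof.
move=> mf mg; apply: measurable_sum => i.
by apply: measurable_funM => //; apply: mfun_co.
Qed.
Lemma mfun_sq f : measurable_fun setT f -> measurable_fun setT (fun t => sq (f t)).
Proof. by move=> mf; apply: mfun_dot. Qed.
Lemma mfun_enorm f : measurable_fun setT f -> measurable_fun setT (fun t => enorm (f t)).
Proof.
move=> mf.
have -> : (fun t => enorm (f t)) = (fun t => sq (f t) `^ 2^-1).
  by apply/funext => t; rewrite enormE powR12_sqrt ?sq_ge0.
by apply: (@measurableT_comp _ _ _ _ _ _ (fun s => s `^ 2^-1)) (mfun_sq mf); exact: measurable_powR.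
Qed.
End measurability.

(** * Translation invariance of Lebesgue measure *)

Section preserving.
Context d (T : measurableType d) (R : realType) (mu : {measure set T -> \bar R}).

Definition preserves (phi : T -> T) :=
  measurable_fun setT phi /\ forall A, measurable A -> mu (phi @^-1` A) = mu A.

Lemma preserves_integral phi (f : T -> \bar R) : preserves phi ->
  measurable_fun setT f -> (forall x, 0 <= f x)%E ->
  (\int[mu]_x f (phi x) = \int[mu]_x f x)%E.
Proof.
move=> [mphi hphi] mf f0.
rewrite -[LHS](@ge0_integral_pushforward _ _ _ _ R phi mphi mu setT f measurableT mf); last by move=> y _; exact: f0.
apply: (@eq_measure_integral _ _ _ setT mu (measure_function_pushforward__canonical__measure_function_Measure mu mphi)).
by move=> A mA _; exact: hphi.
Qed.

Lemma preserves_ae phi (P : T -> Prop) : preserves phi ->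
  {ae mu, forall x, P x} -> {ae mu, forall x, P (phi x)}.
Proof.
move=> [mphi hphi] [A [mA A0 PA]]; exists (phi @^-1` A); split.
- by rewrite -[X in measurable X]setTI; exact: mphi.
- by rewrite hphi.
- by move=> x /= h; apply: PA.
Qed.
End preserving.

Section shift1.
Context {R : realType}.
Local Notation leb := (@lebesgue_measure R).

Lemma shift_preserves1 (a : R) :
  preserves leb (fun x : measurableTypeR R => (x : R) + a).
Proof.
have ma : measurable_fun [set: measurableTypeR R]
    (fun x : measurableTypeR R => (x : R) + a : measurableTypeR R).
  by apply: measurable_funD.
split=> // A mA.
apply: esym; apply: (@lebesgue_measure_unique R (measure_function_pushforward__canonical__measure_function_Measure leb ma)) => // _ [[u v]] _ <-.
rewrite /= /pushforward.
have -> : (fun x : measurableTypeR R => (x : R) + a) @^-1` [set` Interval (BSide false u) (BSide false v)] =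
   [set` Interval (BSide false (u - a)) (BSide false (v - a))].
  by apply/seteqP; split => x /=; rewrite !in_itv /= ltrBlDr lerBrDr.
rewrite !lebesgue_measure_itv /= !lte_fin ltrD2r -!EFinD.
by case: ifP => // _; congr (_%:E); ring.
Qed.

End shift1.

Section shiftN.
Context {R : realType}.

Lemma measurable_shift n (a : vec R n) : measurable_fun setT (fun x : vec R n => vadd x a).
Proof. exact: mfun_vadd. Qed.

Lemma vadd_cons n (t : R) (x : vec R n) (a : vec R n.+1) :
  vadd (cons_pair (t : measurableTypeR R, x)) a =
  cons_pair ((t + co a ord0) : measurableTypeR R,
     vadd x (mkv (fun i => co a (lift ord0 i)))).
Proof.
apply: vecP => i; rewrite cosE; case: (unliftP ord0 i) => [k|] ->; last by rewrite /co !tnth0.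
by rewrite /co !tnthS -!/(co _ _) cosE coE.
Qed.

(** Lebesgue measure is defined by induction as a product; Tonelli reduces a
    shift to one shift of the first coordinate and one shift of the others. *)
Lemma shift_preserves n (a : vec R n) : preserves (@lebesgueN R n) (fun x => vadd x a).
Proof.
elim: n a => [|n IH] a; split; do ?exact: measurable_shift.
  move=> A mA; congr (lebesgueN _); apply/seteqP; split => x /=;
  by rewrite (_ : vadd x a = x) //; apply: vecP => -[].
move=> A mA; rewrite /= /pushforward /product_measure1 /=.
have mC : measurable (@cons_pair (measurableTypeR R) n @^-1` A).
  by rewrite -[X in measurable X]setTI; apply: measurable_cons_pair.
pose a' := mkv (fun i => co a (lift ord0 i)).
pose G (t : measurableTypeR R) := lebesgueN (xsection (@cons_pair (measurableTypeR R) n @^-1` A) t).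
pose sh (t : measurableTypeR R) : measurableTypeR R := (t : R) + co a ord0.
transitivity (\int[@lebesgue_measure R]_t G (sh t))%E.
  apply: eq_integral => t _ /=.
  have mX : measurable (xsection (@cons_pair (measurableTypeR R) n @^-1` A) (sh t)).
    exact: measurable_xsection.
  rewrite /G -(proj2 (IH a') _ mX).
  congr lebesgueN; rewrite !xsectionE; apply/seteqP; split => x /=;
  by rewrite vadd_cons.
apply: (preserves_integral (shift_preserves1 (co a ord0)) (f := G)).
  exact: measurable_fun_xsection.
by move=> t; apply: measure_ge0.
Qed.
End shiftN.

Section uniqueness.
Context {R : realType} {N : nat}.
Local Notation mu := (@lebesgueN R N).
Implicit Types (A B : set (vec R N)).
Local Open Scope ereal_scope.

Lemma integral_indic_preimage (phi : vec R N -> vec R N) A :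
  measurable_fun setT phi -> measurable A ->
  \int[mu]_x (\1_A (phi x))%:E = mu (phi @^-1` A).
Proof.
move=> mphi mA.
rewrite -[X in _ = mu X]setIT -integral_indic//.
by rewrite -[X in measurable X]setTI; exact: mphi.
Qed.

(** Uniqueness of translation invariant measures, in the form needed for
    measures [mu (T @^-1` _)]: if this measure is translation invariant, it is
    proportional to [mu], and the choice of [B] computes the constant. *)
Lemma shift_invariant_unique (T : vec R N -> vec R N) A B :
  measurable_fun setT T ->
  (forall a A, measurable A ->
     mu ((fun x => vadd (T x) a) @^-1` A) = mu (T @^-1` A)) ->
  measurable A -> measurable B ->
  mu (T @^-1` A) * mu B = mu A * mu ((fun x => vscale (-1) (T x)) @^-1` B).
Proof.
move=> mT invT mA mB.
have mind (D : set (vec R N)) (phi : vec R N * vec R N -> vec R N) : measurable D ->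
    measurable_fun setT phi -> measurable_fun setT (fun z => \1_D (phi z) : R).
  move=> mD mphi; apply: (@measurableT_comp _ _ _ _ _ _ (\1_D : vec R N -> R)) => //.
have mind1 (D : set (vec R N)) (phi : vec R N -> vec R N) : measurable D ->
    measurable_fun setT phi -> measurable_fun setT (fun z => (\1_D (phi z) : R)%:E).
  move=> mD mphi; apply/measurable_EFinP.
  by apply: (@measurableT_comp _ _ _ _ _ _ (\1_D : vec R N -> R)) => //.
have mind2 (D : set (vec R N)) (phi : vec R N -> vec R N) : measurable D ->
    measurable_fun setT phi -> measurable_fun setT (fun z => (\1_D (phi z) : R)).
  by move=> mD mphi; apply: (@measurableT_comp _ _ _ _ _ _ (\1_D : vec R N -> R)).
have mTf : measurable_fun setT (fun z : vec R N * vec R N => T z.1).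
  by apply: measurableT_comp.
have mTs : measurable_fun setT (fun z : vec R N * vec R N => T z.2).
  by apply: measurableT_comp.
(* both sides compute the integral of 1_A (T x + y) 1_B y over all pairs;
   substituting y - T x for y turns the integrand into 1_A y 1_B (y - T x) *)
transitivity (\int[mu]_y \int[mu]_x ((\1_A (vadd (T x) y) * \1_B y)%:E : \bar R)).
  transitivity (\int[mu]_y (mu (T @^-1` A) * (\1_B y)%:E)).
    rewrite ge0_integralZl//; last exact/measurable_EFinP.
    by rewrite integral_indic// setIT.
  apply: eq_integral => y _.
  under eq_integral do rewrite mulrC EFinM.
  rewrite ge0_integralZl_EFin//; last by apply: mind1 => //; apply: mfun_vadd.
  rewrite integral_indic_preimage; [|exact: mfun_vadd|exact: mA].
  by rewrite (invT _ _ mA) muleC.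
rewrite -(@fubini_tonelli _ _ _ _ _ mu mu (fun z => (\1_A (vadd (T z.1) z.2) * \1_B z.2)%:E)); last 2 first.
- apply/measurable_EFinP/measurable_funM; apply: mind => //; exact: mfun_vadd.
- by move=> z; rewrite lee_fin mulr_ge0.
transitivity (\int[mu]_x \int[mu]_y ((\1_A y * \1_B (vsub y (T x)))%:E : \bar R)).
  apply: eq_integral => x _ /=.
  have := @preserves_integral _ _ _ mu _ (fun y => (\1_A (vadd (T x) y) * \1_B y)%:E)
     (shift_preserves (vscale (-1) (T x))).
  move=> <-; last 2 first.
  - apply/measurable_EFinP/measurable_funM; last exact: mind2.
    by apply: mind2 => //; exact: mfun_vadd.
  - by move=> z; rewrite lee_fin mulr_ge0.
  apply: eq_integral => y _; congr (\1_A _ * \1_B _)%:E;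
   by apply: vecP => i; rewrite !cosE; ring.
rewrite (@fubini_tonelli _ _ _ _ _ mu mu (fun z => (\1_A z.2 * \1_B (vsub z.2 (T z.1)))%:E)); last 2 first.
- by apply/measurable_EFinP/measurable_funM; apply: mind => //; apply: mfun_vsub.
- by move=> z; rewrite lee_fin mulr_ge0.
transitivity (\int[mu]_y (mu ((fun x => vscale (-1) (T x)) @^-1` B) * (\1_A y)%:E)); last first.
  rewrite ge0_integralZl//; last exact/measurable_EFinP.
  by rewrite integral_indic// setIT muleC.
apply: eq_integral => y _.
under eq_integral do rewrite /= EFinM.
have mneg : measurable_fun setT (fun x : vec R N => vscale (-1) x) by apply: mfun_vscale.
rewrite ge0_integralZl_EFin//; last by apply: mind1 => //; apply: mfun_vsub.
rewrite integral_indic_preimage; [|exact: mfun_vsub|exact: mB].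
rewrite [RHS]muleC; congr (_ * _).
rewrite -[RHS](invT (vscale (-1) y) ((fun x => vscale (-1) x) @^-1` B)); last first.
  by rewrite -[X in measurable X]setTI; exact: mneg.
congr (mu _); apply/seteqP; split => x /=.
  by congr (B _); apply: vecP => i; rewrite !cosE; ring.
by congr (B _); apply: vecP => i; rewrite !cosE; ring.
Qed.

End uniqueness.

(** * Isometries, dilations, balls and annuli *)

Section isometries.
Context {R : realType} {N : nat}.
Local Notation mu := (@lebesgueN R N).
Implicit Types (A B : set (vec R N)) (x y : vec R N).

Definition ball0 (r : R) : set (vec R N) := [set x | enorm x < r].

Lemma measurable_preim_enorm (I : set R) : measurable I ->
  measurable [set x : vec R N | I (enorm x)].
Proof.
move=> mI; rewrite -[X in measurable X]setTI.
by apply: (@mfun_enorm R N _ _ id).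
Qed.

Lemma measurable_ball0 r : measurable (ball0 r).
Proof.
have := @measurable_preim_enorm `]-oo, r[ (measurable_itv _).
by congr measurable; apply/seteqP; split=> x /=; rewrite in_itv.
Qed.

Lemma measurable_cube (a b : R) :
  measurable [set x : vec R N | forall i, (`[a, b]%classic : set R) (co x i)].
Proof. by apply: (@measurable_box R N (fun _ => `[a, b]%classic)) => i; exact: measurable_itv. Qed.

Lemma box_lebesgueN (a b : R) : a <= b ->
  mu [set x | forall i, (`[a, b]%classic : set R) (co x i)] = ((b - a) ^+ N)%:E.
Proof.
move=> ab; rewrite (@lebesgueN_box R N (fun _ => `[a, b]%classic)) => [|i]; last exact: measurable_itv.
rewrite (eq_bigr (fun _ => (b - a)%:E)); last first.
  move=> i _; rewrite lebesgue_measure_itv /= lte_fin -EFinB.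
  by move: ab; rewrite le_eqVlt => /orP[/eqP->|->//]; rewrite ltxx subrr.
by rewrite prodEFin prodr_const card_ord.
Qed.

Lemma ball0_fin r : (mu (ball0 r) < +oo)%E.
Proof.
have [r0|r0] := leP r 0.
  rewrite (_ : ball0 r = set0) ?measure0//; apply/seteqP; split => // x /=.
  by move=> h; have := enorm_ge0 x; rewrite leNgt (lt_le_trans h r0).
apply: (@le_lt_trans _ _ (mu [set x | forall i, (`[- r, r]%classic : set R) (co x i)])).
  apply: le_measure; rewrite ?inE.
  - exact: measurable_ball0.
  - exact: measurable_cube.
  - move=> x /= xr i; rewrite in_itv /= -ler_norml.
    rewrite -(@ler_pXn2r _ 2)// ?nnegrE ?(ltW r0)//.
    rewrite -normrX ger0_norm ?sqr_ge0// (le_trans (co_sq_le x i))//.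
    by rewrite -enorm_sq ler_pXn2r ?nnegrE ?enorm_ge0 ?(ltW r0) ?(ltW xr).
by rewrite box_lebesgueN ?ltry//; lra.
Qed.

Lemma ball0_gt0 r : 0 < r -> (0 < mu (ball0 r))%E.
Proof.
move=> r0; pose c := r / (N%:R + 1).
have N0 : 0 <= (N%:R : R) by [].
have c0 : 0 < c by rewrite divr_gt0//; lra.
apply: (@lt_le_trans _ _ (mu [set x | forall i, (`[- c, c]%classic : set R) (co x i)])).
  by rewrite box_lebesgueN ?lte_fin ?exprn_gt0//; lra.
apply: le_measure; rewrite ?inE.
- exact: measurable_cube.
- exact: measurable_ball0.
- move=> x /= h; rewrite /ball0 /= -(@ltr_pXn2r _ 2)// ?nnegrE ?enorm_ge0 ?(ltW r0)//.
  rewrite enorm_sq sqE.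
  have le1 : \sum_(i < N) co x i ^+ 2 <= \sum_(i < N) c ^+ 2.
    apply: ler_sum => i _; have := h i; rewrite in_itv /= -ler_norml => hi.
    rewrite -[leLHS]ger0_norm ?sqr_ge0// normrX.
    by rewrite ler_pXn2r ?nnegrE ?(ltW c0).
  apply: (le_lt_trans le1); rewrite sumr_const card_ord -mulr_natl.
  have -> : r = c * (N%:R + 1) by rewrite /c divfK//; lra.
rewrite (_ : (c * _) ^+ 2 = (N%:R + 1) ^+ 2 * c ^+ 2); last by ring.
  by rewrite ltr_pM2r ?exprn_gt0//; nra.
Qed.

(** Linear involutive isometries; reflections and the central symmetry are the
    only ones used, and being one's own inverse spares a second map. *)
Record isometry (T : vec R N -> vec R N) : Prop := Isometry {
  iso_meas : measurable_fun setT T;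
  iso_add : forall x y, T (vadd x y) = vadd (T x) (T y);
  iso_norm : forall x, enorm (T x) = enorm x;
  iso_inv : forall x, T (T x) = x }.

(** The image measure of [mu] is translation invariant by linearity, hence a
    multiple of [mu]; the invariant unit ball shows that the factor is [1]. *)
Lemma isometry_preserves T : isometry T -> preserves mu T.
Proof.
move=> [mT addT normT invT]; split=> // A mA.
have B0 : 0 < fine (mu (ball0 1)).
  by rewrite fine_gt0// ball0_gt0//= ball0_fin.
have BE : mu (ball0 1) = (fine (mu (ball0 1)))%:E.
  by rewrite fineK// ge0_fin_numE ?measure_ge0// ball0_fin.
have h : (forall (a : vec R N) A0, measurable A0 ->
   mu ((fun x => vadd (T x) a) @^-1` A0) = mu (T @^-1` A0)).
  move=> a D mD; rewrite -[RHS](proj2 (shift_preserves (T a))); last first.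
    by rewrite -[X in measurable X]setTI; exact: mT.
  by congr (mu _); apply/seteqP; split => x /=; rewrite addT invT.
have := shift_invariant_unique mT h mA (measurable_ball0 1).
have -> : (fun x => vscale (-1) (T x)) @^-1` (ball0 1) = ball0 1.
  apply/seteqP; split => x; rewrite /ball0 /= enorm_scale normrN1 mul1r normT//.
rewrite BE => /(congr1 (fun z => z * ((fine (mu (ball0 1)))^-1)%:E)%E).
by rewrite -!muleA -!EFinM divff ?gt_eqF// !mule1.
Qed.

Definition reflect_vec (v y : vec R N) : vec R N :=
  vsub y (vscale (2 * dot y v / sq v) v).

Lemma reflect_isometry v : isometry (reflect_vec v).
Proof.
have [v0|v0] := eqVneq (sq v) 0.
  have E : reflect_vec v = id.
    by apply/funext => y; apply: vecP => i; rewrite !cosE v0 invr0 mulr0 mul0r subr0.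
  by rewrite E.
split.
- apply: mfun_vsub => //; apply: mfun_vscale => //.
  apply: measurable_funM => //; apply: measurable_funM => //.
  exact: mfun_dot.
- by move=> x y; apply: vecP => i; rewrite !cosE dotDl; field.
- move=> x; rewrite !enormE; congr Num.sqrt.
  by rewrite sqB sqZ !dotE; field.
- move=> x; apply: vecP => i; rewrite !cosE !dotE -/(sq v); field.
  exact: v0.
Qed.

(** Reflections act transitively on spheres, so potentials of radial sets are
    radial. *)
Lemma reflect_swap x y : enorm x = enorm y -> reflect_vec (vsub x y) x = y.
Proof.
move=> /(congr1 (fun z => z ^+ 2)); rewrite !enorm_sq => h.
have [v0|v0] := eqVneq (sq (vsub x y)) 0.
  have xy i : co x i - co y i = 0 by have := sq_eq0 v0 => /(congr1 (fun z => co z i)); rewrite !cosE.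
  apply: vecP => i; rewrite !cosE v0 invr0 mulr0 mul0r subr0.
  by have := xy i; lra.
rewrite /reflect_vec.
have -> : 2 * dot x (vsub x y) / sq (vsub x y) = 1.
  by rewrite (_ : 2 * _ = sq (vsub x y)) ?divff// sqB dotE -/(sq x) -h; ring.
by apply: vecP => i; rewrite !cosE; ring.
Qed.

Lemma neg_isometry : isometry (fun x => vscale (-1) x).
Proof.
split.
- exact: mfun_vscale.
- by move=> x y; apply: vecP => i; rewrite !cosE; ring.
- by move=> x; rewrite enorm_scale normrN1 mul1r.
- by move=> x; apply: vecP => i; rewrite !cosE; ring.
Qed.

Lemma iso_sub T x y : isometry T -> vsub (T x) (T y) = T (vsub x y).
Proof.
move=> [_ addT _ _].
have h : T x = vadd (T (vsub x y)) (T y).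
  by rewrite -addT; congr T; apply: vecP => i; rewrite !cosE; ring.
by rewrite h; apply: vecP => i; rewrite !cosE; ring.
Qed.

Lemma iso_sq T x : isometry T -> sq (T x) = sq x.
Proof. by move=> [_ _ h _]; rewrite -!enorm_sq h. Qed.

(** The same uniqueness argument, with a cube instead of the ball to compute the
    factor. *)
Lemma scale_lebesgueN (c : R) A : 0 < c -> measurable A ->
  mu ((fun x => vscale c x) @^-1` A) = (((c^-1) ^+ N)%:E * mu A)%E.
Proof.
move=> c0 mA.
have mT : measurable_fun setT (fun x : vec R N => vscale c x) by exact: mfun_vscale.
pose Q := [set x : vec R N | forall i, (`[- 2^-1, 2^-1]%classic : set R) (co x i)].
have mQ : measurable Q by exact: measurable_cube.
have invT a D : measurable D -> mu ((fun x => vadd (vscale c x) a) @^-1` D) =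
    mu ((fun x => vscale c x) @^-1` D).
  move=> mD; rewrite -[RHS](proj2 (shift_preserves (vscale c^-1 a))); last first.
    by rewrite -[X in measurable X]setTI; exact: mT.
  congr (mu _); apply/seteqP; split => x /=; congr (D _); apply: vecP => i; rewrite !cosE; field; lra.
have := shift_invariant_unique mT invT mA mQ.
rewrite /Q box_lebesgueN; last by lra.
rewrite (_ : 2^-1 - - 2^-1 = 1); last by lra.
rewrite expr1n mule1 => ->; rewrite muleC; congr (_ * _)%E.
have E : (fun x : vec R N => vscale (-1) (vscale c x)) @^-1`
   [set x | forall i, (`[- 2^-1, 2^-1]%classic : set R) (co x i)] =
   [set x | forall i, (`[- (2^-1 / c), 2^-1 / c]%classic : set R) (co x i)].
  apply/seteqP; split => x /= h i; have := h i; rewrite !in_itv /= !cosE -!ler_norml.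
    by rewrite !normrM normrN1 mul1r (gtr0_norm c0) ler_pdivlMr// mulrC.
  by rewrite !normrM normrN1 mul1r (gtr0_norm c0) ler_pdivlMr// mulrC.
rewrite [X in mu X]E box_lebesgueN; last first.
  have h : 0 < 2^-1 / c by rewrite divr_gt0// invr_gt0.
  by lra.
by congr ((_ ^+ _)%:E); field; lra.
Qed.

Definition bvol : R := fine (mu (ball0 1)).

Lemma bvol_gt0 : 0 < bvol.
Proof. by rewrite fine_gt0// ball0_gt0//= ball0_fin. Qed.

Lemma ball0_vol r : 0 < r -> mu (ball0 r) = (bvol * r ^+ N)%:E.
Proof.
move=> r0.
have := scale_lebesgueN r0 (measurable_ball0 r).
have -> : (fun x : vec R N => vscale r x) @^-1` (ball0 r) = ball0 1.
  by apply/seteqP; split => x; rewrite /ball0 /= enorm_scale gtr0_norm// gtr_pMr.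
have -> : mu (ball0 1) = bvol%:E by rewrite fineK// ge0_fin_numE ?measure_ge0// ball0_fin.
move=> /(congr1 (fun z => (r ^+ N)%:E * z)%E).
rewrite muleA -!EFinM exprVn divff ?mul1e ?expf_neq0 ?gt_eqF//.
by rewrite mulrC => ->.
Qed.

End isometries.

Section spheres.
Context {R : realType} {N : nat}.
Hypothesis N0 : (0 < N)%N.
Local Notation mu := (@lebesgueN R N).

(** In dimension [0] the formula fails at [r = 0], whence the hypothesis on [N]. *)
Lemma ball0_volN r : 0 <= r -> mu (ball0 r) = (bvol (R:=R) (N:=N) * r ^+ N)%:E.
Proof.
rewrite le_eqVlt => /orP[/eqP<-|]; last exact: ball0_vol.
rewrite expr0n eqn0Ngt N0 mulr0 (_ : ball0 0 = set0) ?measure0//.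
by apply/seteqP; split => // x /=; rewrite /ball0/= ltNge enorm_ge0.
Qed.

Lemma measurable_sphere0 r : measurable [set x : vec R N | enorm x = r].
Proof. exact: (@measurable_preim_enorm R N [set r] (measurable_set1 r)). Qed.

(** The sphere is contained in arbitrarily thin shells, whose volume is the
    difference of two ball volumes. *)
Lemma sphere0_null r : mu [set x | enorm x = r] = 0%E.
Proof.
have [r0|r0] := ltP r 0.
  rewrite (_ : [set _ | _] = set0) ?measure0//; apply/seteqP; split => // x /= h.
  by have := enorm_ge0 x; rewrite h leNgt r0.
apply/eqP; rewrite eq_le measure_ge0 andbT.
(* t K bounds the volume of the shell r <= |x| < r + t for t <= 1 *)
pose K := bvol (R:=R) (N:=N) * (r + 1) ^+ N * 2 ^+ N.
have K0 : 0 < K.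
  by rewrite !mulr_gt0 ?bvol_gt0// exprn_gt0//; lra.
have h (t : R) : 0 < t -> t <= 1 -> (mu [set x | enorm x = r] <= (t * K)%:E)%E.
  move=> t0 t1.
  have sub : (mu (ball0 r) + mu [set x | enorm x = r] <= mu (ball0 (r + t)))%E.
    rewrite -measureU; [|exact: measurable_ball0|exact: measurable_sphere0|]; last first.
      by apply/seteqP; split => // x /= [] /[swap]; rewrite /ball0 /= => ->; rewrite ltxx.
    apply: le_measure; rewrite ?inE.
    - by apply: measurableU; [exact: measurable_ball0|exact: measurable_sphere0].
    - exact: measurable_ball0.
    - by move=> x /= []; rewrite /ball0 /=; lra.
  have rt0 : 0 <= r + t by lra.
  move: sub; rewrite (ball0_volN r0) (ball0_volN rt0).
  have -> : mu [set x | enorm x = r] = (fine (mu [set x | enorm x = r]))%:E.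
    rewrite fineK// ge0_fin_numE ?measure_ge0//.
    apply: le_lt_trans (ball0_fin (r + 1)); apply: le_measure; rewrite ?inE.
    - exact: measurable_sphere0.
    - exact: measurable_ball0.
    - by move=> x /=; rewrite /ball0 /=; lra.
  rewrite -EFinD !lee_fin => sub; rewrite /K.
  have b0 := @bvol_gt0 R N.
  have [n nE] : exists n, N = n.+1 by exists N.-1; rewrite prednK.
  have H : (r + t) ^+ N - r ^+ N <= t * ((r + 1) ^+ N * 2 ^+ N).
    rewrite subrXX (_ : r + t - r = t); last by ring.
    rewrite ler_pM2l//.
    apply: (@le_trans _ _ (\sum_(i < N) (r + 1) ^+ N)).
      apply: ler_sum => i _.
      apply: (@le_trans _ _ ((r + 1) ^+ (N.-1 - i) * (r + 1) ^+ i)).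
        apply: ler_pM; rewrite ?exprn_ge0//; try lra.
          by apply: lerXn2r; rewrite ?nnegrE; lra.
        by apply: lerXn2r; rewrite ?nnegrE; lra.
      rewrite -exprD ler_weXn2l//; first by lra.
      by rewrite subnK ?leq_pred// -ltnS prednK.
    rewrite sumr_const card_ord -[leLHS]mulr_natr; apply: ler_pM => //; first by rewrite exprn_ge0//; lra.
    by rewrite -natrX ler_nat ltnW// ltn_expl.
  apply: (@le_trans _ _ (bvol (R:=R) (N:=N) * ((r + t) ^+ N - r ^+ N))); first lra.
  by rewrite -!mulrA [leRHS]mulrCA ler_pM2l.
apply/lee_addgt0Pr => e e0; rewrite add0e.
pose t := Num.min 1 (e / K).
have t0 : 0 < t by rewrite /t lt_min ltr01 divr_gt0.
apply: (le_trans (h t t0 _)); first by rewrite /t ge_min lexx.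
by rewrite lee_fin -ler_pdivlMr// /t ge_min lexx orbT.
Qed.

Definition ann (a b : R) : set (vec R N) := [set x | a < enorm x < b].

Lemma measurable_ann a b : measurable (ann a b).
Proof.
have := @measurable_preim_enorm R N `]a, b[ (measurable_itv _).
by congr measurable; apply/seteqP; split=> x /=; rewrite in_itv.
Qed.

Lemma ann_fin a b : (mu (ann a b) < +oo)%E.
Proof.
apply: le_lt_trans (ball0_fin b); apply: le_measure; rewrite ?inE.
- exact: measurable_ann.
- exact: measurable_ball0.
- by move=> x /= /andP[].
Qed.

Lemma ann_vol a b : 0 <= a -> a <= b ->
  mu (ann a b) = (bvol (R:=R) (N:=N) * (b ^+ N - a ^+ N))%:E.
Proof.
move=> a0 ab.
have [aeb|anb] := eqVneq a b.
  rewrite aeb subrr mulr0 (_ : ann b b = set0) ?measure0//.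
  apply/seteqP; split => // x /= /andP[h1 h2].
  by have := lt_trans h1 h2; rewrite ltxx.
have altb : a < b by rewrite lt_neqAle anb ab.
have mU : measurable (ann a b `|` [set x | enorm x = a]).
  by apply: measurableU; [exact: measurable_ann|exact: measurable_sphere0].
have : mu (ball0 b) = (mu (ball0 a) + mu (ann a b))%E.
  rewrite (_ : ball0 b = ball0 a `|` (ann a b `|` [set x | enorm x = a])); last first.
    apply/seteqP; split => x; rewrite /ball0 /ann /=.
      by move=> xb; have [?|?|?] := ltgtP (enorm x) a; [left|right; left|right;right].
    by move=> [|[/andP[]//|->//]]; lra.
  rewrite measureU; [|exact: measurable_ball0|exact: mU|]; last first.
    by apply/seteqP; split => // x []; rewrite /ball0 /ann /= => h [/andP[]|]; lra.
  congr (_ + _)%E; rewrite measureU; [|exact: measurable_ann|exact: measurable_sphere0|].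
    by rewrite [X in (_ + X)%E]sphere0_null adde0.
  by apply/seteqP; split => // x /= [] /andP[] + _ => /[swap] ->; rewrite ltxx.
rewrite (ball0_volN a0) (ball0_volN (le_trans a0 ab)).
have -> : mu (ann a b) = (fine (mu (ann a b)))%:E.
  by rewrite fineK// ge0_fin_numE ?measure_ge0// ann_fin.
by rewrite -EFinD => -[] h; congr (_%:E); lra.
Qed.
End spheres.

(** * Taylor expansion of powers *)

Section one_variable.
Context {R : realType}.
Implicit Types (a x y : R).

Lemma mvt_closed (f df : R -> R) (u v : R) : u <= v ->
  (forall x, u <= x <= v -> is_derive x 1 f (df x)) ->
  exists2 c, u <= c <= v & f v - f u = df c * (v - u).
Proof.
move=> uv h.
have [||c] := @MVT_segment R f df u v uv.
- move=> x; rewrite in_itv /= => /andP[ux xv]; apply: h.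
  by rewrite (ltW ux) (ltW xv).
- apply: derivable_within_continuous => x; rewrite in_itv /= => /h dx.
  exact: ex_derive.
- by rewrite in_itv /= => cuv E; exists c.
Qed.

Lemma powR_lip x y p : 1 <= p -> 0 <= x <= y ->
  y `^ p - x `^ p <= p * y `^ (p - 1) * (y - x).
Proof.
move=> p1 /andP[x0 xy].
have p0 : 0 < p by lra.
move: x0; rewrite le_eqVlt => /orP[/eqP x0|x0].
  rewrite -x0 powR0 ?gt_eqF// !subr0.
  have y0 : 0 <= y by lra.
  rewrite -mulrA (mulrC _ y) mulr_powRB1//.
  by rewrite ler_peMl// powR_ge0.
have dp t : x <= t <= y -> is_derive t 1 (fun t => t `^ p) (p * t `^ (p - 1)).
  by move=> /andP[xt _]; apply: is_derive1_powR; lra.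
have [c /andP[xc cy] ->] := mvt_closed xy dp.
rewrite ler_wpM2r ?subr_ge0// ler_wpM2l ?(ltW p0)//.
by apply: ge0_ler_powR => //; rewrite ?nnegrE; lra.
Qed.

(** A power is monotone, increasing or decreasing according to the sign of [a];
    the sum bounds both cases. *)
Lemma powR_bound (u v a x : R) : 0 < u -> u <= x <= v -> x `^ a <= u `^ a + v `^ a.
Proof.
move=> u0 /andP[ux xv].
have [a0|a0] := leP 0 a.
  apply: (@le_trans _ _ (v `^ a)); last by rewrite lerDr powR_ge0.
  by apply: ge0_ler_powR => //; rewrite nnegrE; lra.
apply: (@le_trans _ _ (u `^ a)); last by rewrite lerDl powR_ge0.
have E z : z `^ a = (z `^ (- a))^-1 by rewrite powRN invrK.
have x0 : 0 < x by lra.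
rewrite (E x) (E u) lef_pV2 ?posrE ?powR_gt0//.
by apply: ge0_ler_powR => //; rewrite ?nnegrE; lra.
Qed.

Lemma powR_lip_compact (u v a : R) : 0 < u -> exists2 C, 0 <= C &
  forall x y, u <= x <= v -> u <= y <= v -> `|x `^ a - y `^ a| <= C * `|x - y|.
Proof.
move=> u0; exists (`|a| * (u `^ (a - 1) + v `^ (a - 1))).
  by rewrite mulr_ge0// addr_ge0// powR_ge0.
have main x y : x <= y -> u <= x -> y <= v ->
    `|x `^ a - y `^ a| <= (`|a| * (u `^ (a - 1) + v `^ (a - 1))) * `|x - y|.
  move=> xy ux yv.
  have [c /andP[xc cy] E] := @mvt_closed (fun t => t `^ a) (fun t => a * t `^ (a - 1)) x y xy
     (fun t h => is_derive1_powR a (lt_le_trans (lt_le_trans u0 ux) (proj1 (andP h)))).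
  rewrite distrC E !normrM -!mulrA ler_wpM2l// (distrC x y).
  rewrite ler_wpM2r// ger0_norm ?powR_ge0//.
  by apply: powR_bound => //; lra.
move=> x y /andP[ux xv] /andP[uy yv].
have [xy|/ltW yx] := leP x y; first exact: main.
by rewrite distrC (distrC x); exact: main.
Qed.

(** Integrates an estimate of the derivative, by the mean value theorem. *)
Lemma taylor_step (g dg : R -> R) (C : R) n : g 0 = 0 -> 0 <= C ->
  (forall x, `|x| <= 2^-1 -> is_derive x 1 g (dg x)) ->
  (forall x, `|x| <= 2^-1 -> `|dg x| <= C * `|x| ^+ n) ->
  forall x, `|x| <= 2^-1 -> `|g x| <= C * `|x| ^+ n.+1.
Proof.
move=> g0 C0 dgP dgb x xh.
have key c : `|c| <= `|x| -> `|dg c * x| <= C * `|x| ^+ n.+1.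
  move=> cx; rewrite normrM exprSr mulrA ler_wpM2r//.
  apply: (le_trans (dgb c (le_trans cx xh))); rewrite ler_wpM2l//.
  by apply: lerXn2r.
have [x0|x0] := leP 0 x.
  have d t : 0 <= t <= x -> is_derive t 1 g (dg t).
    by move=> /andP[t0 tx]; apply: dgP; move: xh; rewrite !ger0_norm//; lra.
  have [c /andP[c0 cx]] := mvt_closed x0 d.
  rewrite g0 !subr0 => ->; apply: key; rewrite !ger0_norm//; lra.
have d t : x <= t <= 0 -> is_derive t 1 g (dg t).
  by move=> /andP[t0 tx]; apply: dgP; move: xh; rewrite (ltr0_norm x0) ler0_norm//; lra.
have [c /andP[cx c0]] := mvt_closed (ltW x0) d.
rewrite g0 sub0r => /(congr1 Num.norm); rewrite normrN => ->.
by rewrite sub0r mulrN normrN; apply: key; rewrite (ltr0_norm x0) ler0_norm//; lra.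
Qed.

(** Three applications of [taylor_step], since the derivative of each remainder
    is a remainder of lower order for the exponent [a - 1]. *)
Lemma powR_taylor2 a : exists2 C, 0 <= C & forall x, `|x| <= 2^-1 ->
  `|(1 + x) `^ a - 1 - a * x - a * (a - 1) / 2 * x ^+ 2| <= C * `|x| ^+ 3.
Proof.
pose B (b : R) := `|b| * (2^-1 `^ (b - 1) + (3 / 2) `^ (b - 1)).
have B0 b : 0 <= B b by rewrite /B mulr_ge0// addr_ge0// powR_ge0.
have pos x : `|x| <= 2^-1 -> 0 < 1 + x by rewrite ler_norml => /andP[]; lra.
have dp b x : `|x| <= 2^-1 -> is_derive x 1 (fun t => (1 + t) `^ b) (b * (1 + x) `^ (b - 1)).
  move=> xh.
  have d1 : is_derive x 1 (fun t : R => 1 + t) 1.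
    by apply: is_derive_eq; rewrite add0r mulr1.
  have d2 := is_derive1_powR b (pos x xh).
  rewrite -[X in is_derive _ _ _ X]mulr1.
  exact: (@is_derive1_comp R (fun s => s `^ b) (fun t : R => 1 + t) x _ _ d2 d1).
have r0 b x : `|x| <= 2^-1 -> `|(1 + x) `^ b - 1| <= B b * `|x| ^+ 1.
  apply: (@taylor_step (fun t => (1 + t) `^ b - 1) (fun x => b * (1 + x) `^ (b - 1)) (B b) 0).
  - by rewrite addr0 powR1 subrr.
  - exact: B0.
  - by move=> t th; have := dp b t th => d; apply: is_derive_eq; rewrite subr0.
  - move=> t th; rewrite expr0 mulr1 normrM /B ler_wpM2l// ger0_norm ?powR_ge0//.
    apply: powR_bound; first by lra.
    by move: th; rewrite ler_norml => /andP[]; lra.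
have r1 b x : `|x| <= 2^-1 -> `|(1 + x) `^ b - 1 - b * x| <= (`|b| * B (b - 1)) * `|x| ^+ 2.
  apply: (@taylor_step (fun t => (1 + t) `^ b - 1 - b * t)
     (fun x => b * ((1 + x) `^ (b - 1) - 1)) (`|b| * B (b - 1)) 1).
  - by rewrite addr0 powR1 subrr mulr0 subr0.
  - by rewrite mulr_ge0.
  - move=> t th; have := dp b t th => d; apply: is_derive_eq.
    by rewrite subr0 /GRing.scale /=; ring.
  - by move=> t th; rewrite normrM -mulrA ler_wpM2l// r0.
exists (`|a| * (`|a - 1| * B (a - 1 - 1))); first by rewrite !mulr_ge0.
apply: (@taylor_step (fun t => (1 + t) `^ a - 1 - a * t - a * (a - 1) / 2 * t ^+ 2)
     (fun x => a * ((1 + x) `^ (a - 1) - 1 - (a - 1) * x)) _ 2).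
- by rewrite addr0 powR1 subrr !mulr0 expr0n /= mulr0 !subr0.
- by rewrite !mulr_ge0.
- move=> t th; have := dp a t th => d; apply: is_derive_eq.
  by rewrite subr0 /GRing.scale /=; field.
- by move=> t th; rewrite normrM -[leRHS]mulrA ler_wpM2l//; exact: r1.
Qed.

(** [powR_taylor2] rescaled by [w], uniformly for [w] in a compact subinterval
    of the positive half-line. *)
Lemma powR_taylor2_at a (u v : R) : 0 < u -> exists2 C, 0 <= C &
  forall w h, u <= w <= v -> `|h| <= w / 2 ->
  `|(w + h) `^ a - w `^ a - a * w `^ (a - 1) * h
     - a * (a - 1) / 2 * w `^ (a - 2) * h ^+ 2| <= C * `|h| ^+ 3.
Proof.
move=> u0; have [C C0 HC] := powR_taylor2 a.
exists (C * (u `^ (a - 3) + v `^ (a - 3))).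
  by rewrite mulr_ge0// addr_ge0// powR_ge0.
move=> w h uwv hw.
have w0 : 0 < w by move/andP: uwv => []; lra.
have hwn : `|h / w| <= 2^-1 by rewrite normrM normfV (gtr0_norm w0) ler_pdivrMr// mulrC.
have wn n : w `^ (a - n%:R) = w `^ a / w ^+ n.
  by rewrite powRB ?powR_mulrn ?(ltW w0)//; rewrite (gt_eqF w0) implybT.
have -> : (w + h) `^ a - w `^ a - a * w `^ (a - 1) * h
     - a * (a - 1) / 2 * w `^ (a - 2) * h ^+ 2 =
  w `^ a * ((1 + h / w) `^ a - 1 - a * (h / w) - a * (a - 1) / 2 * (h / w) ^+ 2).
  have -> : (w + h) `^ a = w `^ a * (1 + h / w) `^ a.
    rewrite -powRM ?(ltW w0)//; last by move: hwn; rewrite ler_norml => /andP[]; lra.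
    by congr (_ `^ a); field; lra.
  by rewrite (wn 1%N) (wn 2%N); field; lra.
rewrite normrM ger0_norm ?powR_ge0//.
apply: (@le_trans _ _ (w `^ a * (C * `|h / w| ^+ 3))).
  by rewrite ler_wpM2l ?powR_ge0// HC.
have -> : w `^ a * (C * `|h / w| ^+ 3) = C * (w `^ (a - 3) * `|h| ^+ 3).
  by rewrite (wn 3%N) normrM normfV (gtr0_norm w0); field; lra.
rewrite -mulrA ler_wpM2l// ler_wpM2r ?exprn_ge0//.
exact: powR_bound.
Qed.

End one_variable.

(** * Laplacians as limits of second differences *)

Section second_differences.
Context {R : realType} {N : nat}.
Implicit Types (x y z : vec R N) (U V W : vec R N -> R).

Definition dif2 U x (d : R) : R := \sum_(i < N)
  (U (vadd x (vscale d (ebase i))) + U (vadd x (vscale (- d) (ebase i))) - 2 * U x).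

(** A weak form of the statement that the Laplacian of [U] at [x] is [L]. It
    passes through integrals without differentiating under them, and it is all
    that the maximum principle uses. *)
Definition has_lap U x (L : R) := forall e : R, 0 < e -> exists2 d0 : R, 0 < d0 &
  forall d : R, 0 < d < d0 -> `|dif2 U x d - d ^+ 2 * L| <= e * d ^+ 2.

Lemma has_lapD U V x (L M : R) : has_lap U x L -> has_lap V x M ->
  has_lap (fun y => U y + V y) x (L + M).
Proof.
move=> hU hV e e0; have e2 : 0 < e / 2 by rewrite divr_gt0.
have [d1 d10 h1] := hU _ e2; have [d2 d20 h2] := hV _ e2.
exists (Num.min d1 d2) => [|d /andP[d0]]; first by rewrite lt_min d10.
rewrite lt_min => /andP[dd1 dd2].
have := h1 d; have := h2 d; rewrite d0 dd1 dd2 => /(_ erefl) H2 /(_ erefl) H1.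
have -> : dif2 (fun y => U y + V y) x d - d ^+ 2 * (L + M) =
  (dif2 U x d - d ^+ 2 * L) + (dif2 V x d - d ^+ 2 * M).
  rewrite (_ : dif2 (fun y => U y + V y) x d = dif2 U x d + dif2 V x d); first by ring.
  by rewrite -big_split; apply: eq_bigr => i _; rewrite /=; ring.
by rewrite (le_trans (ler_normD _ _))//; lra.
Qed.

Lemma has_lapZ (c : R) U x L : has_lap U x L -> has_lap (fun y => c * U y) x (c * L).
Proof.
move=> hU e e0.
have c1 : 0 < `|c| + 1 by rewrite ltr_wpDl.
have [d0 d00 h] := hU (e / (`|c| + 1)) (divr_gt0 e0 c1).
exists d0 => // d /h H.
have -> : dif2 (fun y => c * U y) x d - d ^+ 2 * (c * L) = c * (dif2 U x d - d ^+ 2 * L).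
  rewrite (_ : dif2 (fun y => c * U y) x d = c * dif2 U x d); first by ring.
  by rewrite mulr_sumr; apply: eq_bigr => i _; rewrite /=; ring.
rewrite normrM (le_trans (ler_wpM2l (normr_ge0 c) H))//.
rewrite mulrA ler_wpM2r ?sqr_ge0// mulrA ler_pdivrMr//.
rewrite mulrC ler_pM2l//; lra.
Qed.

Lemma has_lap_cst (c : R) x : has_lap (fun=> c) x 0.
Proof.
move=> e e0; exists 1 => // d _.
rewrite /dif2 big1 => [|i _]; last by ring.
by rewrite mulr0 subrr normr0 mulr_ge0 ?sqr_ge0// ltW.
Qed.

Lemma sq_shift x d i : sq (vadd x (vscale d (ebase i))) = sq x + 2 * d * co x i + d ^+ 2.
Proof. by rewrite sqD sqZ sq_base dotE dot_base; ring. Qed.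

Lemma has_lap_sq x : has_lap sq x (2 * N%:R).
Proof.
move=> e e0; exists 1 => // d _.
rewrite /dif2 (eq_bigr (fun _ => d ^+ 2 * 2)) => [|i _]; last by rewrite !sq_shift; ring.
rewrite sumr_const card_ord -[X in X - _]mulr_natr.
rewrite (_ : _ - _ = 0); last by ring.
by rewrite normr0 mulr_ge0 ?sqr_ge0// ltW.
Qed.

Lemma has_lap_sq2 x : has_lap (fun y => sq y ^+ 2) x ((4 * N%:R + 8) * sq x).
Proof.
move=> e e0.
have n0 : 0 <= N%:R :> R by [].
exists (Num.min 1 (e / (2 * N%:R + 1))) => [|d /andP[d0]].
  by rewrite lt_min ltr01 divr_gt0//; lra.
rewrite lt_min => /andP[d1 d2].
have -> : dif2 (fun y => sq y ^+ 2) x d - d ^+ 2 * ((4 * N%:R + 8) * sq x) = 2 * N%:R * d ^+ 4.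
  rewrite /dif2 (eq_bigr (fun i => (4 * sq x * d ^+ 2 + 2 * d ^+ 4) + 8 * d ^+ 2 * co x i ^+ 2)); last first.
    by move=> i _; rewrite !sq_shift; ring.
  rewrite big_split /= -mulr_sumr -sqE sumr_const card_ord -[_ *+ N]mulr_natr; ring.
have d4 : d ^+ 4 <= d * d ^+ 2.
  by rewrite -exprS ler_wiXn2l ?ltW.
rewrite ger0_norm; last by rewrite !mulr_ge0 ?exprn_ge0// ltW.
apply: (@le_trans _ _ ((2 * N%:R + 1) * d * d ^+ 2)).
  have : 0 <= d * d ^+ 2 by rewrite mulr_ge0 ?sqr_ge0// ltW.
  nra.
by rewrite ler_wpM2r ?sqr_ge0// mulrC -ler_pdivlMr ?ltW//; lra.
Qed.

(** The power [|z|^(2a)], regularized at the origin: the exponents of the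
    successive Laplacians may be negative. *)
Definition kpow (a e : R) z : R := (sq z + e) `^ a.

(** The Laplacian of [(|z|^2 + e)^a] with a remainder uniform on balls, so that
    it can be integrated against a measure. *)
Lemma dif2_kpow (a e M : R) : 0 < e -> 0 <= M -> exists K d0 : R, [/\ 0 <= K, 0 < d0 &
  forall z (d : R), enorm z <= M -> 0 < d <= d0 ->
  `|dif2 (kpow a e) z d - d ^+ 2 *
     (2 * a * (N%:R + 2 * a - 2) * kpow (a - 1) e z
       - 4 * a * (a - 1) * e * kpow (a - 2) e z)| <= K * d ^+ 3].
Proof.
move=> e0 M0.
have [C C0 HC] := @powR_taylor2_at R a e (M ^+ 2 + e) e0.
pose B := e `^ (a - 2) + (M ^+ 2 + e) `^ (a - 2).
have B0 : 0 <= B by rewrite addr_ge0// powR_ge0.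
pose L := 1 + 2 * M.
have L0 : 0 < L by rewrite /L; lra.
exists (N%:R * (2 * C * L ^+ 3 + `|a * (a - 1)| * B)), (Num.min 1 (e / (2 * L))).
have L30 : 0 <= L ^+ 3 by exact: exprn_ge0 (ltW L0).
split.
  apply: mulr_ge0 => //; apply: addr_ge0; apply: mulr_ge0 => //.
  by apply: mulr_ge0 => //; lra.
  by rewrite lt_min ltr01 divr_gt0// mulr_gt0.
move=> z d zM /andP[d0]; rewrite le_min => /andP[d1 d2].
pose w := sq z + e.
have sqM : sq z <= M ^+ 2 by rewrite -enorm_sq ler_pXn2r ?nnegrE ?enorm_ge0.
have wb : e <= w <= M ^+ 2 + e by rewrite /w; have := sq_ge0 z; lra.
have w0 : 0 < w by lra.
(* the Laplacian as a sum over the coordinates, with |z|^2 = w - e *)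
have sumE : dif2 (kpow a e) z d - d ^+ 2 *
     (2 * a * (N%:R + 2 * a - 2) * kpow (a - 1) e z
       - 4 * a * (a - 1) * e * kpow (a - 2) e z) =
   \sum_(i < N) (kpow a e (vadd z (vscale d (ebase i))) +
     kpow a e (vadd z (vscale (- d) (ebase i))) - 2 * kpow a e z -
     d ^+ 2 * (2 * a * w `^ (a - 1) + 4 * a * (a - 1) * w `^ (a - 2) * co z i ^+ 2)).
  rewrite sumrB; congr (_ - _); rewrite -mulr_sumr; congr (_ * _).
  rewrite big_split /= sumr_const card_ord -mulr_sumr -sqE -[_ *+ N]mulr_natr.
  rewrite /kpow -/w (_ : sq z = w - e); last by rewrite /w; ring.
  rewrite (_ : w `^ (a - 1) = w * w `^ (a - 2)); first by ring.
  rewrite -{2}(powRr1 (ltW w0)) -powRD; last by rewrite (gt_eqF w0) implybT.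
  by congr (_ `^ _); ring.
rewrite sumE (le_trans (ler_norm_sum _ _ _))//.
rewrite (_ : _ * d ^+ 3 = \sum_(i < N) ((2 * C * L ^+ 3 + `|a * (a - 1)| * B) * d ^+ 3)); last first.
  by rewrite sumr_const card_ord -[_ *+ N]mulr_natr; ring.
apply: ler_sum => i _.
have coM : `|co z i| <= M.
  rewrite -(@ler_pXn2r _ 2)// ?nnegrE//.
  by rewrite -normrX ger0_norm ?sqr_ge0// (le_trans (co_sq_le z i)).
have small (s : R) : `|s| = 1 -> `|d ^+ 2 + 2 * (s * d) * co z i| <= L * d.
  move=> s1; apply: (le_trans (ler_normD _ _)).
  rewrite ger0_norm ?sqr_ge0// !normrM s1 mul1r (gtr0_norm d0) ger0_norm//.
  have : d ^+ 2 <= d by rewrite expr2 ger_pMl.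
  rewrite /L; have := ler_wpM2l (ltW d0) coM; nra.
have smallw (s : R) : `|s| = 1 -> `|d ^+ 2 + 2 * (s * d) * co z i| <= w / 2.
  move=> /small h; apply: (le_trans h).
  move: d2; rewrite ler_pdivlMr ?mulr_gt0// => d2; lra.
(* along the i-th axis w changes by d^2 + 2 d z_i and d^2 - 2 d z_i; the odd
   terms cancel in the sum *)
have K1 := HC w _ wb (smallw 1 (normr1 _)).
have K2 := HC w _ wb (smallw (-1) (normrN1 _)).
rewrite /kpow !sq_shift -/w.
have E1 : sq z + 2 * d * co z i + d ^+ 2 + e = w + (d ^+ 2 + 2 * (1 * d) * co z i).
  by rewrite /w; ring.
have E2 : sq z + 2 * (- d) * co z i + (- d) ^+ 2 + e = w + (d ^+ 2 + 2 * (-1 * d) * co z i).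
  by rewrite /w; ring.
rewrite E1 E2.
set h1 := d ^+ 2 + 2 * (1 * d) * co z i in K1 *.
set h2 := d ^+ 2 + 2 * (-1 * d) * co z i in K2 *.
have cube (h : R) : `|h| <= L * d -> C * `|h| ^+ 3 <= C * L ^+ 3 * d ^+ 3.
  by move=> hL; rewrite -mulrA -exprMn ler_wpM2l// lerXn2r// nnegrE mulr_ge0// ltW.
have c1 := le_trans K1 (cube _ (small 1 (normr1 _))).
have c2 := le_trans K2 (cube _ (small (-1) (normrN1 _))).
have -> : (w + h1) `^ a + (w + h2) `^ a - 2 * w `^ a - d ^+ 2 *
     (2 * a * w `^ (a - 1) + 4 * a * (a - 1) * w `^ (a - 2) * co z i ^+ 2) =
  ((w + h1) `^ a - w `^ a - a * w `^ (a - 1) * h1 - a * (a - 1) / 2 * w `^ (a - 2) * h1 ^+ 2) +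
  ((w + h2) `^ a - w `^ a - a * w `^ (a - 1) * h2 - a * (a - 1) / 2 * w `^ (a - 2) * h2 ^+ 2) +
  a * (a - 1) * w `^ (a - 2) * d ^+ 4 by rewrite /h1 /h2; field.
have c3 : `|a * (a - 1) * w `^ (a - 2) * d ^+ 4| <= `|a * (a - 1)| * B * d ^+ 3.
  rewrite normrM (ger0_norm (exprn_ge0 4 (ltW d0))) normrM.
  apply: ler_pM; rewrite ?mulr_ge0 ?exprn_ge0 ?(ltW d0)//.
    by rewrite ler_wpM2l// ger0_norm ?powR_ge0// powR_bound.
  by rewrite ler_wiXn2l// ltW.
rewrite mulrDl; apply: (le_trans (ler_normD _ _)); apply: lerD => //.
by apply: (le_trans (ler_normD _ _)); lra.
Qed.

End second_differences.

(** * Radial functions with positive bilaplacian *)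

Section maximum_principle.
Context {R : realType} {N : nat} (i0 : 'I_N).
Implicit Types (x y z : vec R N) (U V W : vec R N -> R) (r t : R).

(** A radial function is studied through its values along one fixed axis. *)
Definition ray r : vec R N := vscale r (ebase i0).
Definition radial U := forall x y, enorm x = enorm y -> U x = U y.
Definition prof U r : R := U (ray r).

Lemma enorm_base i : enorm (ebase i : vec R N) = 1.
Proof. by rewrite enormE sq_base sqrtr1. Qed.

Lemma enorm_ray r : enorm (ray r) = `|r|.
Proof. by rewrite enorm_scale enorm_base mulr1. Qed.

Lemma radial_prof U x : radial U -> U x = prof U (enorm x).
Proof. by apply; rewrite enorm_ray ger0_norm ?enorm_ge0. Qed.

(** At a local maximum of the profile every second difference is nonpositive. *)
Lemma no_local_max U x (L eta : R) : radial U -> has_lap U x L -> 0 < L -> 0 < eta ->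
  ~ (forall t, 0 <= t -> `|t - enorm x| <= eta -> prof U t <= prof U (enorm x)).
Proof.
move=> radU lapU L0 eta0 h.
have [d0 d00 hd] := lapU (L / 2) (divr_gt0 L0 (ltr0Sn _ _)).
pose d := Num.min d0 eta / 2.
have m0 : 0 < Num.min d0 eta by rewrite lt_min d00.
have md0 : Num.min d0 eta <= d0 by rewrite ge_min lexx.
have mde : Num.min d0 eta <= eta by rewrite ge_min lexx orbT.
have dpos : 0 < d by rewrite divr_gt0.
have dd0 : d < d0 by rewrite /d; lra.
have de : d <= eta by rewrite /d; lra.
have := hd d; rewrite dpos dd0 => /(_ erefl) H.
have step (s : R) i : `|s| = d -> U (vadd x (vscale s (ebase i))) <= U x.
  move=> sd; rewrite (radial_prof _ radU) [leRHS](radial_prof _ radU).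
  apply: h; first exact: enorm_ge0.
  apply: (le_trans (enorm_dist _ _)).
  have -> : vsub (vadd x (vscale s (ebase i))) x = vscale s (ebase i).
    by apply: vecP => j; rewrite !cosE; ring.
  by rewrite enorm_scale enorm_base mulr1 sd.
have : dif2 U x d <= 0.
  apply: sumr_le0 => i _.
  have := step d i (gtr0_norm dpos).
  have := step (- d) i; rewrite normrN gtr0_norm// => /(_ erefl); lra.
have d2 : 0 < d ^+ 2 by rewrite exprn_gt0.
by move: H; rewrite ler_norml => /andP[]; nra.
Qed.

(** A subharmonic radial function is strictly increasing in [|x|]: by
    [no_local_max] the maximum of the profile between [0] and [r] is attained at
    [r] only. *)
Lemma max_principle U r' r : radial U -> continuous (prof U) ->
  (forall x, enorm x < r -> exists2 L, 0 < L & has_lap U x L) ->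
  0 <= r' < r -> prof U r' < prof U r.
Proof.
move=> radU cU lapU /andP[r'0 r'r].
have r0 : 0 <= r by lra.
have key r1 : 0 <= r1 < r -> (forall t, t \in `[0, r] -> prof U t <= prof U r1) -> False.
  move=> /andP[r10 r1r] h.
  have nr1 : enorm (ray r1) = r1 by rewrite enorm_ray ger0_norm.
  have [L L0 lapL] : exists2 L, 0 < L & has_lap U (ray r1) L by apply: lapU; rewrite nr1.
  have r1r' : 0 < r - r1 by lra.
  apply: (@no_local_max U (ray r1) L (r - r1)) => // t t0.
  rewrite nr1 ler_norml => /andP[_ h1]; apply: h; rewrite in_itv /= t0; lra.
have [c] := EVT_max r0 (continuous_subspaceT cU).
rewrite in_itv /= => /andP[c0 cr] hc.
move: cr; rewrite le_eqVlt => /orP[/eqP cr|cr]; last by case: (key c) => //; rewrite c0.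
rewrite cr in hc.
rewrite lt_neqAle hc ?in_itv /= ?r'0 ?ltW// andbT.
apply/eqP => E; apply: (key r'); first by rewrite r'0.
by move=> t /hc; rewrite E.
Qed.

(** If the profile of [V] had an interior maximum at [c], its Laplacian [W]
    would be nonpositive there; [W] increases with [|x|], so [V] would be
    superharmonic in the ball of radius [c], hence decreasing up to [c], which
    contradicts the maximality of [c]. *)
Lemma bilap_quasiconvex V W (rad : R) r1 r0 r2 : radial V -> radial W ->
  continuous (prof V) -> continuous (prof W) ->
  (forall x, has_lap V x (W x)) ->
  (forall x, enorm x < rad -> exists2 L, 0 < L & has_lap W x L) ->
  0 <= r1 -> r1 < r0 < r2 -> r2 <= rad ->
  prof V r0 <= Num.max (prof V r1) (prof V r2).
Proof.
move=> radV radW cV cW lapV lapW r10 /andP[r1r0 r0r2] r2rad.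
have r12 : r1 <= r2 by lra.
have [c] := EVT_max r12 (continuous_subspaceT cV).
rewrite in_itv /= => /andP[c1 c2] hc.
have Vc : prof V r0 <= prof V c by apply: hc; rewrite in_itv /=; lra.
move: c1; rewrite le_eqVlt => /orP[/eqP c1|c1]; first by rewrite le_max c1 Vc.
move: c2; rewrite le_eqVlt => /orP[/eqP c2|c2]; first by rewrite le_max -c2 Vc orbT.
have c0 : 0 < c by lra.
have nc : enorm (ray c) = c by rewrite enorm_ray ger0_norm// ltW.
have Wc : W (ray c) <= 0.
  rewrite leNgt; apply/negP => W0.
  pose eta := Num.min (c - r1) (r2 - c).
  have eta0 : 0 < eta by rewrite lt_min; apply/andP; split; lra.
  have e1 : eta <= c - r1 by rewrite ge_min lexx.
  have e2 : eta <= r2 - c by rewrite ge_min lexx orbT.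
  apply: (@no_local_max V (ray c) _ eta radV (lapV _) W0 eta0) => t t0.
  by rewrite nc ler_norml => /andP[h1 h2]; apply: hc; rewrite in_itv /=; lra.
have Wneg x : enorm x < c -> W x < 0.
  move=> xc; apply: lt_le_trans Wc.
  rewrite (radial_prof _ radW); apply: max_principle => //.
    by move=> y yc; apply: lapW; lra.
  by rewrite enorm_ge0.
have : prof (fun x => -1 * V x) r1 < prof (fun x => -1 * V x) c.
  apply: max_principle; [|..|by rewrite r10].
  - by move=> x y xy; rewrite (radV _ _ xy).
  - rewrite /prof => t; by apply: cvgM; [exact: cvg_cst|exact: cV].
  - move=> x xc; exists (-1 * W x); last exact: has_lapZ.
    by have := Wneg x xc; lra.
rewrite /prof => h; rewrite le_max; apply/orP; left.
apply: (le_trans Vc); rewrite /prof; lra.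
Qed.

End maximum_principle.

(** * Regularized potentials of a bounded radial set *)

Section bounded_integrals.
Context d (T : measurableType d) (R : realType) (mu : {measure set T -> \bar R}).
Variables (S : set T) (mS : measurable S) (finS : (mu S < +oo)%E).
Implicit Types (F G : T -> R).

(** The integrands below are bounded on the set of integration; this class is
    stable under sums and makes every integral finite. *)
Definition bmeas F := measurable_fun setT F /\ exists C : R, forall y, S y -> `|F y| <= C.

Lemma bmeas_int F : bmeas F -> mu.-integrable S (EFin \o F).
Proof.
move=> [mF [C hC]]; apply: measurable_bounded_integrable => //.
  exact: measurable_funTS.
exists C; split; first exact: num_real.
by move=> M CM y Sy; apply: (le_trans (hC y Sy)); exact: ltW.
Qed.

Lemma bmeasD F G : bmeas F -> bmeas G -> bmeas (fun y => F y + G y).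
Proof.
move=> [mF [C hC]] [mG [D hD]]; split; first exact: measurable_funD.
exists (C + D) => y Sy; apply: (le_trans (ler_normD _ _)).
by apply: lerD; [exact: hC|exact: hD].
Qed.

Lemma bmeasZ (c : R) F : bmeas F -> bmeas (fun y => c * F y).
Proof.
move=> [mF [C hC]]; split; first exact: measurable_funM.
by exists (`|c| * C) => y Sy; rewrite normrM ler_wpM2l// hC.
Qed.

Lemma bmeas_cst (c : R) : bmeas (fun=> c).
Proof. by split => //; exists `|c|. Qed.

Lemma bmeas_sum n (F : 'I_n -> T -> R) : (forall i, bmeas (F i)) ->
  bmeas (fun y => \sum_(i < n) F i y).
Proof.
move=> h; elim: n F h => [|n IH] F h.
  rewrite (_ : (fun _ => _) = fun=> 0); first exact: bmeas_cst.
  by apply/funext => y; rewrite big_ord0.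
rewrite (_ : (fun _ => _) = fun y => F ord0 y + \sum_(i < n) F (lift ord0 i) y).
  by apply: bmeasD => //; apply: IH.
by apply/funext => y; rewrite big_ord_recl.
Qed.

Definition bint F : R := \int[mu]_(y in S) F y.

Lemma bintD F G : bmeas F -> bmeas G -> bint (fun y => F y + G y) = bint F + bint G.
Proof. by move=> bF bG; apply: RintegralD => //; exact: bmeas_int. Qed.

Lemma bintZ (c : R) F : bmeas F -> bint (fun y => c * F y) = c * bint F.
Proof. by move=> bF; apply: RintegralZl => //; exact: bmeas_int. Qed.

Lemma bint_sum n (F : 'I_n -> T -> R) : (forall i, bmeas (F i)) ->
  bint (fun y => \sum_(i < n) F i y) = \sum_(i < n) bint (F i).
Proof.
move=> h; elim: n F h => [|n IH] F h.
  rewrite big_ord0 /bint -[RHS](mul0r (fine (mu S))) -Rintegral_cst//.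
  by apply: eq_Rintegral => y _; rewrite big_ord0.
rewrite big_ord_recl -IH// -bintD//; last exact: bmeas_sum.
by apply: eq_Rintegral => y _; rewrite big_ord_recl.
Qed.

Lemma bint_le F G : bmeas F -> bmeas G -> (forall y, S y -> F y <= G y) ->
  bint F <= bint G.
Proof. by move=> bF bG FG; apply: le_Rintegral => //; exact: bmeas_int. Qed.

Lemma bint_cst (c : R) : bint (fun=> c) = c * fine (mu S).
Proof. exact: Rintegral_cst. Qed.

Lemma eq_bint F G : (forall y, S y -> F y = G y) -> bint F = bint G.
Proof. by move=> FG; apply: eq_Rintegral => y /set_mem /FG. Qed.

Lemma bint_norm F (C : R) : bmeas F -> (forall y, S y -> `|F y| <= C) ->
  `|bint F| <= C * fine (mu S).
Proof.
move=> bF FC; rewrite ler_norml -mulNr -!bint_cst.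
apply/andP; split; apply: bint_le => //; try exact: bmeas_cst.
  by move=> y /FC; rewrite ler_norml => /andP[].
by move=> y /FC; rewrite ler_norml => /andP[].
Qed.

Lemma bint_dist F G (C : R) : bmeas F -> bmeas G ->
  (forall y, S y -> `|F y - G y| <= C) -> `|bint F - bint G| <= C * fine (mu S).
Proof.
move=> bF bG FG.
have -> : bint F - bint G = bint (fun y => F y + -1 * G y).
  by rewrite bintD ?bintZ ?mulN1r//; exact: bmeasZ.
apply: bint_norm; first by apply: bmeasD => //; exact: bmeasZ.
by move=> y Sy; rewrite mulN1r; exact: FG.
Qed.

End bounded_integrals.

Lemma lip_continuous (R : realType) (f : R -> R) :
  (forall r0 : R, 0 < r0 -> exists C : R, forall r r', `|r| <= r0 -> `|r'| <= r0 ->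
     `|f r - f r'| <= C * `|r - r'|) -> continuous f.
Proof.
move=> h x; apply/cvgrPdist_le => e e0.
have x0 : 0 < `|x| + 1 by rewrite ltr_wpDl.
have [C hC] := h _ x0.
have C1 : 0 < `|C| + 1 by rewrite ltr_wpDl.
near=> y.
have y1 : `|x - y| < 1 by near: y; exact: cvgr_dist_lt.
have ye : `|x - y| < e / (`|C| + 1).
  by near: y; apply: cvgr_dist_lt => //; exact: divr_gt0.
apply: (le_trans (hC x y _ _)).
- by rewrite lerDl.
- by have := ler_normB x (x - y); rewrite opprB addrC subrK => ?; lra.
- apply: (@le_trans _ _ ((`|C| + 1) * `|x - y|)).
    by rewrite ler_wpM2r//; have := ler_norm C; lra.
  by rewrite mulrC -ler_pdivlMr// ltW.
Unshelve. all: by end_near. Qed.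

Section potentials.
Context {R : realType} {N : nat} (i0 : 'I_N).
Local Notation mu := (@lebesgueN R N).
Variables (S : set (vec R N)) (b : R).
Hypothesis mS : measurable S.
Hypothesis Sb : forall y, S y -> enorm y < b.
Hypothesis radS : forall x y, enorm x = enorm y -> S x -> S y.
Hypothesis b0 : 0 <= b.
Implicit Types (x y z : vec R N) (a e r : R).

Lemma finS : (mu S < +oo)%E.
Proof.
apply: le_lt_trans (ball0_fin b); apply: le_measure; rewrite ?inE//.
exact: measurable_ball0.
Qed.

(** A reflection exchanging [x] and [x'] preserves [S] and the measure. *)
Lemma int_radial (F : R -> R) x x' : measurable_fun setT F -> (forall s, 0 <= F s) ->
  enorm x = enorm x' ->
  (\int[mu]_(y in S) (F (sq (vsub x y)))%:E = \int[mu]_(y in S) (F (sq (vsub x' y)))%:E)%E.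
Proof.
move=> mF F0 xx'.
pose T : vec R N -> vec R N := reflect_vec (vsub x' x).
have isoT : isometry T by exact: reflect_isometry.
have Tx : T x' = x by apply: reflect_swap.
have mFx z : measurable_fun setT (fun y => (F (sq (vsub z y)))%:E).
  apply/measurable_EFinP; apply: measurableT_comp => //.
  by apply: mfun_sq; apply: mfun_vsub.
rewrite integral_mkcond [RHS]integral_mkcond.
rewrite -(preserves_integral (isometry_preserves isoT)); last 2 first.
- apply/(measurable_restrictT _ mS); exact: measurable_funTS.
- by move=> y; rewrite patchE; case: ifP => // _; rewrite lee_fin.
apply: eq_integral => y _; rewrite !patchE.
have -> : (T y \in S) = (y \in S).
  apply/idP/idP; rewrite !inE; apply: radS; rewrite (iso_norm isoT)//.
case: ifP => // _; congr ((F _)%:E).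
by rewrite -[in LHS]Tx (iso_sub _ _ isoT) (iso_sq _ isoT).
Qed.

Lemma kpow_bmeas a e x : 0 < e -> bmeas S (fun y => kpow a e (vsub x y)).
Proof.
move=> e0; split.
  apply: (@measurableT_comp _ _ _ _ _ _ (fun s : R => s `^ a)); first exact: measurable_powR.
  by apply: measurable_funD => //; apply: mfun_sq; apply: mfun_vsub.
exists (e `^ a + ((enorm x + b) ^+ 2 + e) `^ a) => y /Sb yb.
rewrite ger0_norm ?powR_ge0//; apply: powR_bound => //.
have := sq_ge0 (vsub x y); have := enorm_sub x y; rewrite -enorm_sq => h1 h2.
have : enorm (vsub x y) ^+ 2 <= (enorm x + b) ^+ 2.
  have := enorm_ge0 x; have := enorm_ge0 (vsub x y) => ? ?.
  by apply: lerXn2r; rewrite ?nnegrE; lra.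
lra.
Qed.

Definition pot a e x : R := bint mu S (fun y => kpow a e (vsub x y)).

Lemma pot_radial a e : radial (pot a e).
Proof.
move=> x x' xx'; rewrite /pot /bint /Rintegral; apply: (congr1 fine).
apply: (@int_radial (fun s => (s + e) `^ a)) => // [|s]; last exact: powR_ge0.
apply: (@measurableT_comp _ _ _ _ _ _ (fun s : R => s `^ a)); first exact: measurable_powR.
exact: measurable_funD.
Qed.

Lemma sub_ray_ball r0 r y : `|r| <= r0 -> S y -> sq (vsub (ray i0 r) y) <= (r0 + b) ^+ 2.
Proof.
move=> rr /Sb yb; rewrite -enorm_sq.
have := enorm_sub (ray i0 r) y; rewrite enorm_ray => h.
have := enorm_ge0 (vsub (ray i0 r) y); have := normr_ge0 r => ? ?.
by apply: lerXn2r; rewrite ?nnegrE; lra.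
Qed.

Lemma sub_ray_lip r0 r r' y : `|r| <= r0 -> `|r'| <= r0 -> S y ->
  `|sq (vsub (ray i0 r) y) - sq (vsub (ray i0 r') y)| <= 2 * (r0 + b) * `|r - r'|.
Proof.
move=> rr rr' /Sb yb.
have -> : sq (vsub (ray i0 r) y) - sq (vsub (ray i0 r') y) = (r + r' - 2 * co y i0) * (r - r').
  by rewrite !sqB !sqZ !sq_base !dotZl (dotC _ y) dot_base; ring.
rewrite normrM ler_wpM2r//.
apply: (le_trans (ler_normB _ _)); rewrite normrM (ger0_norm (ltW (ltr0Sn R 1))).
have := ler_normD r r' => h1.
have h2 : `|co y i0| <= b.
  apply: (@le_trans _ _ (enorm y)); last exact: ltW.
  by rewrite -(@ler_pXn2r _ 2)// ?nnegrE ?enorm_ge0// enorm_sq -normrX ger0_norm ?sqr_ge0 ?co_sq_le.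
lra.
Qed.

Lemma pot_cont a e : 0 < e -> continuous (prof i0 (pot a e)).
Proof.
move=> e0; apply: lip_continuous => r0 r00.
have [C C0 hC] := @powR_lip_compact R e ((r0 + b) ^+ 2 + e) a e0.
exists (C * (2 * (r0 + b)) * fine (mu S)) => r r' rr rr'.
rewrite /prof /pot mulrAC.
apply: (bint_dist mS finS); try exact: kpow_bmeas.
move=> y Sy; rewrite /kpow.
have s1 := sub_ray_ball rr Sy; have s2 := sub_ray_ball rr' Sy.
apply: (le_trans (hC _ _ _ _)).
- by have := sq_ge0 (vsub (ray i0 r) y); lra.
- by have := sq_ge0 (vsub (ray i0 r') y); lra.
- rewrite -mulrA ler_wpM2l// (_ : _ + e - _ = sq (vsub (ray i0 r) y) - sq (vsub (ray i0 r') y)).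
    exact: sub_ray_lip.
  by ring.
Qed.

(** Integrates the uniform expansion [dif2_kpow] over [S]. *)
Lemma has_lap_pot a e x : 0 < e -> has_lap (pot a e) x
  (2 * a * (N%:R + 2 * a - 2) * pot (a - 1) e x - 4 * a * (a - 1) * e * pot (a - 2) e x).
Proof.
move=> e0.
have Mx : 0 <= enorm x + b by rewrite addr_ge0 ?enorm_ge0.
have [K [d0 [K0 d00 hK]]] := @dif2_kpow R N a e (enorm x + b) e0 Mx.
have m0 : 0 <= fine (mu S) by rewrite fine_ge0.
have bk (c : R) z := @kpow_bmeas c e z e0.
move=> eps eps0; exists (Num.min d0 (eps / (K * fine (mu S) + 1))).
  by rewrite lt_min d00 divr_gt0// ltr_wpDl// mulr_ge0.
move=> d /andP[dpos]; rewrite lt_min => /andP[dd0 deps].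
have E s y i : vadd (vsub x y) (vscale s (ebase i)) = vsub (vadd x (vscale s (ebase i))) y.
  by apply: vecP => j; rewrite !cosE; ring.
have E' s i : (fun y => kpow a e (vadd (vsub x y) (vscale s (ebase i)))) =
     (fun y => kpow a e (vsub (vadd x (vscale s (ebase i))) y)).
  by apply/funext => y; rewrite E.
have bs s i : bmeas S (fun y => kpow a e (vadd (vsub x y) (vscale s (ebase i)))).
  by rewrite E'.
have bt i : bmeas S (fun y => kpow a e (vadd (vsub x y) (vscale d (ebase i))) +
    kpow a e (vadd (vsub x y) (vscale (- d) (ebase i))) + - 2 * kpow a e (vsub x y)).
  by apply: bmeasD; [exact: bmeasD|exact: bmeasZ].
have difk y : dif2 (kpow a e) (vsub x y) d =
   \sum_(i < N) (kpow a e (vadd (vsub x y) (vscale d (ebase i))) +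
    kpow a e (vadd (vsub x y) (vscale (- d) (ebase i))) + - 2 * kpow a e (vsub x y)).
  by apply: eq_bigr => i _; rewrite mulNr.
have difE : dif2 (pot a e) x d = bint mu S (fun y => dif2 (kpow a e) (vsub x y) d).
  under [in RHS]eq_bint => y _ do rewrite difk.
  rewrite bint_sum//; last exact: finS.
  apply: eq_bigr => i _; have fS := finS.
  rewrite (bintD mS fS (bmeasD (bs d i) (bs (- d) i)) (bmeasZ _ (bk a x))).
  by rewrite (bintD mS fS (bs d i) (bs (- d) i)) (bintZ mS fS _ (bk a x)) mulNr !E'.
set L := 2 * a * _ * _ - _.
have bL : bmeas S (fun y => 2 * a * (N%:R + 2 * a - 2) * kpow (a - 1) e (vsub x y)
       + (- (4 * a * (a - 1) * e)) * kpow (a - 2) e (vsub x y)).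
  by apply: bmeasD; exact: bmeasZ.
have LE : d ^+ 2 * L = bint mu S (fun y => d ^+ 2 *
     (2 * a * (N%:R + 2 * a - 2) * kpow (a - 1) e (vsub x y)
       + (- (4 * a * (a - 1) * e)) * kpow (a - 2) e (vsub x y))).
  have fS := finS.
  rewrite (bintZ mS fS _ bL) (bintD mS fS (bmeasZ _ (bk (a - 1) x)) (bmeasZ _ (bk (a - 2) x))).
  by rewrite (bintZ mS fS _ (bk (a - 1) x)) (bintZ mS fS _ (bk (a - 2) x)) mulNr.
rewrite difE LE.
apply: (@le_trans _ _ (K * d ^+ 3 * fine (mu S))).
  apply: bint_dist => //; first exact: finS.
  - under [X in bmeas _ X]funext do rewrite difk.
    exact: bmeas_sum.
  - exact: bmeasZ.
  - move=> y /Sb yb; rewrite mulNr; apply: hK.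
      by have := enorm_sub x y; lra.
    by rewrite dpos ltW.
rewrite mulrAC (_ : d ^+ 3 = d * d ^+ 2); last by rewrite -exprS.
rewrite mulrA ler_wpM2r ?sqr_ge0//.
move: deps; rewrite ltr_pdivlMr; last by rewrite ltr_wpDl// mulr_ge0.
nra.
Qed.

End potentials.

(** * Quasiconvexity of power potentials *)

Section quasiconvexity.
Context {R : realType} {N : nat} (i0 : 'I_N).
Local Notation mu := (@lebesgueN R N).
Variables (S : set (vec R N)) (b p : R).
Hypothesis mS : measurable S.
Hypothesis Sb : forall y, S y -> enorm y < b.
Hypothesis radS : forall x y, enorm x = enorm y -> S x -> S y.
Hypothesis hb : 0 <= b.
Hypothesis S0 : 0 < fine (mu S).
Hypothesis p12 : 1 < p < 2.
Hypothesis hNp : 4 < N%:R + 2 * p.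
Implicit Types (x y z : vec R N) (e r c : R).

Local Notation fS := (finS mS Sb).

Definition gpot x : R := bint mu S (fun y => sq (vsub x y) `^ p).

(** The Laplacian of the regularized potential [pot S p e]. *)
Definition lap1 e x : R := 2 * p * (N%:R + 2 * p - 2) * pot S (p - 1) e x
  + (- (4 * p * (p - 1) * e)) * pot S (p - 2) e x.

(** A lower bound, uniform in the regularization, for the Laplacian of [lap1] in
    the ball of radius [rad]. *)
Definition lap2_lower (rad : R) : R :=
  4 * p * (p - 1) * (N%:R + 2 * p - 2) * (N%:R + 2 * p - 4) *
   (((rad + b) ^+ 2 + 1) `^ (p - 2) * fine (mu S)).

(** The factor [N + 2p - 4] is positive by hypothesis. *)
Lemma lap2_lower_gt0 rad : 0 < lap2_lower rad.
Proof.
have /andP[p1 p2] := p12; have b0 := hb; have Np := hNp.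
have n0 : 0 <= N%:R :> R by [].
have h : 0 < ((rad + b) ^+ 2 + 1) `^ (p - 2) by rewrite powR_gt0// ltr_wpDl// sqr_ge0.
by rewrite /lap2_lower !mulr_gt0//; lra.
Qed.

Lemma pot_ge0 a e x : 0 <= pot S a e x.
Proof. by apply: Rintegral_ge0 => y _; exact: powR_ge0. Qed.

Lemma has_lap_lap1 (rad : R) e x : 0 < e <= 1 -> enorm x < rad ->
  exists2 L, lap2_lower rad <= L & has_lap (lap1 e) x L.
Proof.
have /andP[p1 p2] := p12; have b0 := hb; have Np := hNp.
move=> /andP[e0 e1] xr.
have n0 : 0 <= N%:R :> R by [].
have H1 := has_lapZ (2 * p * (N%:R + 2 * p - 2)) (has_lap_pot mS Sb hb (p - 1) x e0).
have H2 := has_lapZ (- (4 * p * (p - 1) * e)) (has_lap_pot mS Sb hb (p - 2) x e0).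
have := has_lapD H1 H2; set L := (X in has_lap _ _ X) => HL.
exists L => //; rewrite /L.
rewrite (_ : p - 1 - 1 = p - 2); last by ring.
rewrite (_ : p - 1 - 2 = p - 3); last by ring.
rewrite (_ : p - 2 - 1 = p - 3); last by ring.
rewrite (_ : p - 2 - 2 = p - 4); last by ring.
set q2 := pot S (p - 2) e x; set q3 := pot S (p - 3) e x; set q4 := pot S (p - 4) e x.
(* expanded in powers of e, all three coefficients are nonnegative *)
rewrite [leRHS](_ : _ = 4 * p * (p - 1) * (N%:R + 2 * p - 2) * (N%:R + 2 * p - 4) * q2
  + 16 * p * (p - 1) * (2 - p) * (N%:R + 2 * p - 4) * e * q3
  + 16 * p * (p - 1) * (2 - p) * (3 - p) * e ^+ 2 * q4); last by ring.
have t3 : 0 <= 16 * p * (p - 1) * (2 - p) * (N%:R + 2 * p - 4) * e * q3.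
  by rewrite !mulr_ge0 ?pot_ge0//; lra.
have t4 : 0 <= 16 * p * (p - 1) * (2 - p) * (3 - p) * e ^+ 2 * q4.
  apply: mulr_ge0; last exact: pot_ge0.
  by apply: mulr_ge0; rewrite ?sqr_ge0// !mulr_ge0//; lra.
have t2 : ((rad + b) ^+ 2 + 1) `^ (p - 2) * fine (mu S) <= q2.
  rewrite /q2 /pot -(bint_cst _ mS).
  apply: bint_le => //; [exact: fS|exact: bmeas_cst|by apply: (kpow_bmeas (b := b))|].
  move=> y /Sb yb; rewrite /kpow.
  have -> : p - 2 = - (2 - p) by ring.
  rewrite !powRN lef_pV2 ?posrE ?powR_gt0//; last 2 first.
  - by rewrite ltr_wpDl// sqr_ge0.
  - by rewrite ltr_wpDl// sq_ge0.
  have := enorm_sub x y => h.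
  have h2 : sq (vsub x y) <= (rad + b) ^+ 2.
    rewrite -enorm_sq; have := enorm_ge0 (vsub x y); have := enorm_ge0 x => ? ?.
    by apply: lerXn2r; rewrite ?nnegrE; lra.
  have := sq_ge0 (vsub x y) => ?.
  by apply: ge0_ler_powR; rewrite ?nnegrE; lra.
apply: (@le_trans _ _ (4 * p * (p - 1) * (N%:R + 2 * p - 2) * (N%:R + 2 * p - 4) * q2)); last lra.
by rewrite /lap2_lower ler_wpM2l// !mulr_ge0//; lra.
Qed.

Lemma gpot_bmeas x : bmeas S (fun y => sq (vsub x y) `^ p).
Proof.
have /andP[p1 p2] := p12; have b0 := hb; have Np := hNp.
split.
  apply: (@measurableT_comp _ _ _ _ _ _ (fun s : R => s `^ p)); first exact: measurable_powR.
  by apply: mfun_sq; apply: mfun_vsub.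
exists (((enorm x + b) ^+ 2) `^ p) => y /Sb yb.
rewrite ger0_norm ?powR_ge0//.
have := sq_ge0 (vsub x y); have := enorm_sub x y; rewrite -enorm_sq => h1 h2.
have h3 : enorm (vsub x y) ^+ 2 <= (enorm x + b) ^+ 2.
  have := enorm_ge0 x; have := enorm_ge0 (vsub x y) => ? ?.
  by apply: lerXn2r; rewrite ?nnegrE; lra.
by apply: ge0_ler_powR; rewrite ?nnegrE; lra.
Qed.

Lemma gpot_radial : radial gpot.
Proof.
move=> x x' xx'; rewrite /gpot /bint /Rintegral; apply: (congr1 fine).
apply: (@int_radial _ _ _ mS radS (fun s => s `^ p)) => // s; exact: powR_ge0.
Qed.

Lemma pot_gpot (rad : R) e x : 0 < e <= 1 -> enorm x <= rad ->
  `|pot S p e x - gpot x| <= p * ((rad + b) ^+ 2 + 1) `^ (p - 1) * e * fine (mu S).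
Proof.
have /andP[p1 p2] := p12; have b0 := hb; have Np := hNp.
move=> /andP[e0 e1] xr.
apply: bint_dist => //; [exact: fS|by apply: (kpow_bmeas (b := b))|exact: gpot_bmeas|].
move=> y /Sb yb; rewrite /kpow.
have := sq_ge0 (vsub x y); have := enorm_sub x y; rewrite -enorm_sq => h1 h2.
have h3 : enorm (vsub x y) ^+ 2 <= (rad + b) ^+ 2.
  have := enorm_ge0 x; have := enorm_ge0 (vsub x y) => ? ?.
  by apply: lerXn2r; rewrite ?nnegrE; lra.
set s := enorm _ ^+ 2 in h2 h3 *.
have mono : s `^ p <= (s + e) `^ p by apply: ge0_ler_powR; rewrite ?nnegrE; lra.
rewrite ger0_norm ?subr_ge0//.
apply: (@le_trans _ _ (p * (s + e) `^ (p - 1) * (s + e - s))).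
  by apply: powR_lip; lra.
rewrite (_ : s + e - s = e); last by ring.
rewrite ler_wpM2r ?(ltW e0)// ler_wpM2l//; first by lra.
by apply: ge0_ler_powR; rewrite ?nnegrE; lra.
Qed.

Lemma has_lap_potp e x : 0 < e -> has_lap (pot S p e) x (lap1 e x).
Proof.
move=> e0; rewrite /lap1 mulNr; exact: (has_lap_pot mS Sb hb p x e0).
Qed.

Lemma prof_sq r : prof i0 sq r = r ^+ 2.
Proof. by rewrite /prof sqZ sq_base mulr1. Qed.

Lemma sq_radial : radial (@sq R N).
Proof. by move=> x y xy; rewrite -!enorm_sq xy. Qed.

(** Subtracting a multiple of [(|x|^2 - r0^2)^2] too small to destroy the
    positive bilaplacian upgrades quasiconvexity to strict quasiconvexity with
    an explicit margin at [r1] and [r2]; the margin must survive the limit [e ->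
    0]. *)
Lemma quasiconvex_reg c (eta e r1 r0 r2 : R) : 0 < e <= 1 -> 0 <= eta ->
  eta * ((4 * N%:R + 8) * (2 * N%:R)) < lap2_lower r2 ->
  0 <= r1 -> r1 < r0 < r2 ->
  prof i0 (pot S p e) r0 - c * r0 ^+ 2 <=
  Num.max (prof i0 (pot S p e) r1 - c * r1 ^+ 2 - eta * (r1 ^+ 2 - r0 ^+ 2) ^+ 2)
          (prof i0 (pot S p e) r2 - c * r2 ^+ 2 - eta * (r2 ^+ 2 - r0 ^+ 2) ^+ 2).
Proof.
move=> e01 eta0 etaL r10 r012.
have e0 : 0 < e by case/andP: e01.
have drop A B D (q : R) : A - c * r0 ^+ 2 - eta * (r0 ^+ 2 - r0 ^+ 2) ^+ 2 + q <=
     Num.max (B - c * r1 ^+ 2 - eta * (r1 ^+ 2 - r0 ^+ 2) ^+ 2 + q)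
             (D - c * r2 ^+ 2 - eta * (r2 ^+ 2 - r0 ^+ 2) ^+ 2 + q) ->
   A - c * r0 ^+ 2 <= Num.max (B - c * r1 ^+ 2 - eta * (r1 ^+ 2 - r0 ^+ 2) ^+ 2)
             (D - c * r2 ^+ 2 - eta * (r2 ^+ 2 - r0 ^+ 2) ^+ 2).
  by rewrite !le_max => /orP[] h; apply/orP; [left|right]; lra.
(* along the axis, V is the regularized potential minus c r^2 and eta (r^2 -
   r0^2)^2, up to the constant eta r0^4 *)
pose V x := pot S p e x + ((2 * eta * r0 ^+ 2 - c) * sq x + (- eta) * sq x ^+ 2).
pose W x := lap1 e x + ((2 * eta * r0 ^+ 2 - c) * (2 * N%:R) + (- eta) * ((4 * N%:R + 8) * sq x)).
have radV : radial V.
  by move=> x y xy; rewrite /V (pot_radial mS radS _ _ xy) (sq_radial xy).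
have radW : radial W.
  move=> x y xy; rewrite /W /lap1.
  by rewrite (pot_radial mS radS (p - 1) _ xy) (pot_radial mS radS (p - 2) _ xy) (sq_radial xy).
have cpot a : continuous (prof i0 (pot S a e)) by exact: (pot_cont mS Sb).
have csq : continuous (fun r : R => sq (ray i0 r : vec R N)).
  move=> r; rewrite (_ : (fun r : R => sq (ray i0 r : vec R N)) = fun r => r ^+ 2).
    exact: exprn_continuous.
  by apply/funext => s; rewrite -[LHS]/(prof i0 sq s) prof_sq.
have csq2 : continuous (fun r : R => sq (ray i0 r : vec R N) ^+ 2).
  move=> r; rewrite (_ : (fun r : R => sq (ray i0 r : vec R N) ^+ 2) = fun r => r ^+ 4).
    exact: exprn_continuous.
  by apply/funext => s; rewrite -[sq _]/(prof i0 sq s) prof_sq; ring.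
have cV : continuous (prof i0 V).
  move=> r; apply: cvgD; first exact: cpot.
  apply: cvgD; first by apply: cvgM; [exact: cvg_cst|exact: csq].
  by apply: cvgM; [exact: cvg_cst|exact: csq2].
have cW : continuous (prof i0 W).
  move=> r; apply: cvgD.
    apply: cvgD.
      by apply: cvgM; [exact: cvg_cst|exact: (cpot (p - 1))].
    by apply: cvgM; [exact: cvg_cst|exact: (cpot (p - 2))].
  apply: cvgD; first exact: cvg_cst.
  apply: cvgM; first exact: cvg_cst.
  by apply: cvgM; [exact: cvg_cst|exact: csq].
have lapV x : has_lap V x (W x).
  apply: has_lapD; first exact: has_lap_potp.
  apply: has_lapD; apply: has_lapZ; first exact: has_lap_sq.
  exact: has_lap_sq2.
have lapW x : enorm x < r2 -> exists2 L, 0 < L & has_lap W x L.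
  move=> xr; have [L hL lapL] := has_lap_lap1 e01 xr.
  exists (L + (0 + (- eta) * ((4 * N%:R + 8) * (2 * N%:R)))); first lra.
  apply: has_lapD => //; apply: has_lapD; first exact: has_lap_cst.
  by apply: has_lapZ; apply: has_lapZ; exact: has_lap_sq.
have := bilap_quasiconvex radV radW cV cW lapV lapW r10 r012 (lexx _).
have profV r : prof i0 V r = prof i0 (pot S p e) r - c * r ^+ 2
   - eta * (r ^+ 2 - r0 ^+ 2) ^+ 2 + eta * r0 ^+ 4.
  by rewrite /prof /V -/(prof i0 sq r) prof_sq -/(prof i0 (pot S p e) r); ring.
by rewrite !profV; exact: drop.
Qed.

(** The margin of [quasiconvex_reg] is independent of [e], so a small
    regularization preserves the strict inequality. *)
Lemma gpot_quasiconvex c r1 r0 r2 : 0 <= r1 -> r1 < r0 < r2 ->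
  prof i0 gpot r0 - c * r0 ^+ 2 <
  Num.max (prof i0 gpot r1 - c * r1 ^+ 2) (prof i0 gpot r2 - c * r2 ^+ 2).
Proof.
have /andP[p1 p2] := p12; have b0 := hb; have Np := hNp.
move=> r10 r012; have /andP[r1r0 r0r2] := r012.
have n0 : 0 <= N%:R :> R by [].
(* K is the bilaplacian of |x|^4; del is the margin at r1 and r2, and C e the
   regularization error *)
pose K := (4 * N%:R + 8) * (2 * N%:R) : R.
have K0 : 0 <= K by rewrite /K mulr_ge0//; lra.
pose eta := lap2_lower r2 / (K + 1).
have l0 := lap2_lower_gt0 r2.
have eta0 : 0 < eta by rewrite divr_gt0//; lra.
have etaL : eta * K < lap2_lower r2.
  by rewrite /eta mulrAC ltr_pdivrMr ?ltr_pM2l//; lra.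
have d1 : 0 < (r1 ^+ 2 - r0 ^+ 2) ^+ 2.
  have : r1 ^+ 2 < r0 ^+ 2 by apply: ltrXn2r; rewrite ?nnegrE; lra.
  by move=> h; rewrite exprn_even_gt0//= subr_eq0 lt_eqF.
have d2 : 0 < (r2 ^+ 2 - r0 ^+ 2) ^+ 2.
  have : r0 ^+ 2 < r2 ^+ 2 by apply: ltrXn2r; rewrite ?nnegrE; lra.
  by move=> h; rewrite exprn_even_gt0//= subr_eq0 gt_eqF.
pose del := eta * Num.min ((r1 ^+ 2 - r0 ^+ 2) ^+ 2) ((r2 ^+ 2 - r0 ^+ 2) ^+ 2).
have del0 : 0 < del by rewrite mulr_gt0// lt_min d1.
have de1 : del <= eta * (r1 ^+ 2 - r0 ^+ 2) ^+ 2 by rewrite ler_wpM2l ?(ltW eta0)// ge_min lexx.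
have de2 : del <= eta * (r2 ^+ 2 - r0 ^+ 2) ^+ 2 by rewrite ler_wpM2l ?(ltW eta0)// ge_min lexx orbT.
pose C := p * ((r2 + b) ^+ 2 + 1) `^ (p - 1) * fine (mu S).
have C0 : 0 <= C by rewrite !mulr_ge0 ?powR_ge0 ?(ltW S0)//; lra.
pose e := Num.min 1 (del / (4 * C + 1)).
have e0 : 0 < e by rewrite lt_min ltr01 divr_gt0//; lra.
have e1 : e <= 1 by rewrite ge_min lexx.
have e01 : 0 < e <= 1 by rewrite e0.
have eC : 4 * C * e < del.
  have : e <= del / (4 * C + 1) by rewrite ge_min lexx orbT.
  by rewrite ler_pdivlMr; lra.
have fin A B D A' B' D' : `|A - A'| <= C * e -> `|B - B'| <= C * e -> `|D - D'| <= C * e ->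
    A - c * r0 ^+ 2 <= Num.max (B - c * r1 ^+ 2 - eta * (r1 ^+ 2 - r0 ^+ 2) ^+ 2)
       (D - c * r2 ^+ 2 - eta * (r2 ^+ 2 - r0 ^+ 2) ^+ 2) ->
    A' - c * r0 ^+ 2 < Num.max (B' - c * r1 ^+ 2) (D' - c * r2 ^+ 2).
  move=> h0 h1 h2; rewrite le_max lt_max => /orP[] h; apply/orP; [left|right].
    by move: h0 h1; rewrite !ler_norml => /andP[? ?] /andP[? ?]; lra.
  by move: h0 h2; rewrite !ler_norml => /andP[? ?] /andP[? ?]; lra.
have near r : 0 <= r -> r <= r2 -> `|prof i0 (pot S p e) r - prof i0 gpot r| <= C * e.
  move=> r00 rr2; have xr : enorm (ray i0 r : vec R N) <= r2 by rewrite enorm_ray ger0_norm.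
  by have := pot_gpot e01 xr; rewrite /C mulrAC.
have g0 : 0 <= r0 by lra.
have g2 : 0 <= r2 by lra.
have g02 : r0 <= r2 by lra.
have g12 : r1 <= r2 by lra.
have h0 := near r0 g0 g02; have h1 := near r1 r10 g12; have h2 := near r2 g2 (lexx _).
exact: fin h0 h1 h2 (quasiconvex_reg c e01 (ltW eta0) etaL r10 r012).
Qed.

End quasiconvexity.

(** * Potentials of balls and annuli *)

Section powR_convexity.
Context {R : realType}.
Implicit Types (x y z p : R).

Lemma powR_tangent x z p : 1 <= p -> 0 <= x -> 0 <= z ->
  z `^ p + p * z `^ (p - 1) * (x - z) <= x `^ p.
Proof.
move=> p1 x0 z0; have [xz|zx] := leP x z.
  by have := @powR_lip R x z p p1; rewrite x0 xz => /(_ erefl); lra.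
have p0 : 0 < p by lra.
have [z00|zp] := eqVneq z 0.
  rewrite z00 powR0 ?gt_eqF// add0r subr0.
  have [p11|p11] := eqVneq p 1.
    by rewrite p11 subrr powRr0 powRr1// !mul1r.
  rewrite powR0 ?subr_eq0// mulr0 mul0r; exact: powR_ge0.
have z1 : 0 < z by rewrite lt_neqAle eq_sym zp.
have dp t : z <= t <= x -> is_derive t 1 (fun t => t `^ p) (p * t `^ (p - 1)).
  by move=> /andP[xt _]; apply: is_derive1_powR; lra.
have [c /andP[zc cx] E] := mvt_closed (ltW zx) dp.
suff : p * z `^ (p - 1) * (x - z) <= p * c `^ (p - 1) * (x - z) by lra.
rewrite ler_wpM2r ?subr_ge0 ?(ltW zx)// ler_wpM2l ?(ltW p0)//.
by apply: ge0_ler_powR => //; rewrite ?nnegrE; lra.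
Qed.

Lemma powR_midpoint x y p : 1 <= p -> 0 <= x -> 0 <= y ->
  2 * ((x + y) / 2) `^ p <= x `^ p + y `^ p.
Proof.
move=> p1 x0 y0; have z0 : 0 <= (x + y) / 2 by lra.
have := powR_tangent p1 x0 z0; have := powR_tangent p1 y0 z0.
set q := (_ `^ (p - 1)); nra.
Qed.

(** [x^p = x x^(p-1)] and the last factor is monotone. *)
Lemma powR_superadd x y p : 1 <= p -> 0 <= x -> 0 <= y ->
  x `^ p + y `^ p <= (x + y) `^ p.
Proof.
move=> p1 x0 y0; have p0 : 0 < p by lra.
have xy0 : 0 <= x + y by lra.
rewrite -(mulr_powRB1 x0 p0) -(mulr_powRB1 y0 p0) -(mulr_powRB1 xy0 p0) mulrDl.
apply: lerD; rewrite ler_wpM2l//; apply: ge0_ler_powR; rewrite ?nnegrE; lra.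
Qed.

End powR_convexity.

(** The potential of a ball varies at most like the point of evaluation and the
    [N]-th power of the radius; along a family of annuli of given mass both are
    continuous functions of the inner radius, and the criterion concludes. *)
Lemma lip_continuous2 (R : realType) (f u v : R -> R) : continuous u -> continuous v ->
  (forall K : R, exists2 C : R, 0 <= C & forall x y, `|x| <= K -> `|y| <= K ->
     `|f x - f y| <= C * (`|u x - u y| + `|v x - v y|)) -> continuous f.
Proof.
move=> cu cv h x; apply/cvgrPdist_le => e e0.
have [C C0 hC] := h (`|x| + 1).
have C1 : 0 < 2 * (C + 1) by lra.
near=> y.
have y1 : `|x - y| < 1 by near: y; exact: cvgr_dist_lt.
have ue : `|u x - u y| < e / (2 * (C + 1)).
  by near: y; apply: cvgr_dist_lt; [exact: cu|exact: divr_gt0].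
have ve : `|v x - v y| < e / (2 * (C + 1)).
  by near: y; apply: cvgr_dist_lt; [exact: cv|exact: divr_gt0].
apply: (le_trans (hC x y _ _)).
- by rewrite lerDl.
- by have := ler_normB x (x - y); rewrite opprB addrC subrK => ?; lra.
- apply: (@le_trans _ _ (C * (e / (C + 1)))).
    rewrite ler_wpM2l//.
    have -> : e / (C + 1) = e / (2 * (C + 1)) + e / (2 * (C + 1)) by field; lra.
    by rewrite lerD// ltW.
  rewrite mulrA ler_pdivrMr; lra.
Unshelve. all: by end_near. Qed.

Section balls_and_annuli.
Context {R : realType} {N : nat}.
Local Notation mu := (@lebesgueN R N).
Hypothesis N0 : (0 < N)%N.
Variables (a b : R) (F : vec R N -> R).
Hypotheses (ab : a <= b) (bF : bmeas (ball0 b) F).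

Lemma ball0_sub : ball0 a `<=` (ball0 b : set (vec R N)).
Proof. by move=> y; rewrite /ball0 /= => /lt_le_trans; apply. Qed.

Lemma measurable_shell : measurable (ball0 b `\` ball0 a : set (vec R N)).
Proof. by apply: measurableD; exact: measurable_ball0. Qed.

Lemma bint_ball_shell : bint mu (ball0 b) F = bint mu (ball0 a) F + bint mu (ball0 b `\` ball0 a) F.
Proof.
have intt := bmeas_int (measurable_ball0 b) (@ball0_fin R N b) bF.
rewrite /bint -Rintegral_setU//; last 4 first.
- exact: measurable_ball0.
- exact: measurable_shell.
- by rewrite (setDUK ball0_sub).
- by apply/disj_setPS => y [? []].
by rewrite (setDUK ball0_sub).
Qed.

(** The annulus differs from [ball0 b `\` ball0 a] by a null sphere. *)
Lemma bint_ann : bint mu (ann a b) F = bint mu (ball0 b) F - bint mu (ball0 a) F.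
Proof.
rewrite bint_ball_shell addrAC subrr add0r /bint /Rintegral; apply: (congr1 fine).
have mA := @measurable_ann R N a b; have mD := measurable_shell.
have mF : measurable_fun setT (fun y => (F y)%:E) by apply/measurable_EFinP; case: bF.
rewrite [LHS]integral_mkcond [RHS]integral_mkcond.
apply: ae_eq_integral => //.
- by apply/(measurable_restrictT _ mA); exact: measurable_funTS.
- by apply/(measurable_restrictT _ mD); exact: measurable_funTS.
exists [set y | enorm y = a]; split => //; [exact: measurable_sphere0|exact: sphere0_null|].
move=> y /= /not_implyP [_]; apply: contra_notP => ya.
rewrite !patchE; congr (if _ then _ else _).
apply/idP/idP; rewrite !inE /ball0 /ann /=.
  by move=> /andP[h1 h2]; split => //; apply/negP; rewrite -leNgt ltW.
move=> [h1 /negP]; rewrite -leNgt le_eqVlt => /orP[/eqP h|->//].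
by case: ya.
Qed.

End balls_and_annuli.

Section candidate.
Context {R : realType} {N : nat} (i0 : 'I_N) (p : R).
Local Notation mu := (@lebesgueN R N).
Hypothesis p12 : 1 < p < 2.
Hypothesis hNp : 4 < N%:R + 2 * p.
Implicit Types (a b r t m : R) (x y : vec R N).

Let N0 : (0 < N)%N. Proof. by case: (N) i0 => [[]|]. Qed.
Local Notation w := (@bvol R N).

Definition inner (r : R) (y : vec R N) : R := sq (vsub (ray i0 r) y) `^ p.

Definition ballpot r t : R := bint mu (ball0 t) (inner r).
Definition annpot a b r : R := prof i0 (gpot (ann a b) p) r.

Lemma annpotE a b r : annpot a b r = bint mu (ann a b) (inner r).
Proof. by []. Qed.

Lemma ann_lt a b (y : vec R N) : ann a b y -> enorm y < b.
Proof. by case/andP. Qed.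

Lemma ann_rad a b (x y : vec R N) : enorm x = enorm y -> ann a b x -> ann a b y.
Proof. by rewrite /ann /= => ->. Qed.

Lemma inner_bmeas r t : 0 <= t -> bmeas (ball0 t) (inner r).
Proof. by move=> t0; apply: (@gpot_bmeas R N (ball0 t) t p). Qed.

Lemma inner_le r t (y : vec R N) : enorm y < t -> inner r y <= ((`|r| + t) ^+ 2) `^ p.
Proof.
move=> yt; have /andP[p1 p2] := p12.
have h := enorm_sub (ray i0 r) y; rewrite enorm_ray in h.
apply: ge0_ler_powR; rewrite ?nnegrE ?sq_ge0 ?sqr_ge0//; first lra.
rewrite -enorm_sq; have := enorm_ge0 (vsub (ray i0 r) y); have := normr_ge0 r => ? ?.
by apply: lerXn2r; rewrite ?nnegrE; lra.
Qed.

Lemma ballpot_radius r t t' : 0 <= t -> t <= t' ->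
  0 <= ballpot r t' - ballpot r t <= ((`|r| + t') ^+ 2) `^ p * (w * (t' ^+ N - t ^+ N)).
Proof.
move=> t0 tt'; have t'0 := le_trans t0 tt'.
have sub := @ball0_sub R N t t' tt'.
have mD : measurable (ball0 t' `\` ball0 t : set (vec R N)) by apply: measurableD; exact: measurable_ball0.
have bi := inner_bmeas r t'0.
have fin' := @ball0_fin R N t'.
have E : ballpot r t' = ballpot r t + bint mu (ball0 t' `\` ball0 t) (inner r) := bint_ball_shell tt' bi.
have volD : mu (ball0 t' `\` ball0 t) = (w * (t' ^+ N - t ^+ N))%:E.
  transitivity (mu (ball0 t') - mu (ball0 t))%E.
    rewrite measureD; [|exact: measurable_ball0|exact: measurable_ball0|exact: ball0_fin].
    by rewrite setIidr.
  rewrite (ball0_volN N0 t0) (ball0_volN N0 t'0) -EFinB.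
  by congr (_%:E); ring.
rewrite E addrAC subrr add0r.
have bD : bmeas (ball0 t' `\` ball0 t) (inner r).
  by case: bi => mi [C hC]; split => //; exists C => y [? _]; exact: hC.
have finD : (mu (ball0 t' `\` ball0 t) < +oo)%E by rewrite volD ltry.
apply/andP; split.
  by apply: Rintegral_ge0 => y _; exact: powR_ge0.
have -> : w * (t' ^+ N - t ^+ N) = fine (mu (ball0 t' `\` ball0 t)) by rewrite volD.
rewrite -(bint_cst _ mD); apply: bint_le => //; first exact: bmeas_cst.
by move=> y [/inner_le].
Qed.

Lemma annpot_ball a b r : 0 <= a -> a <= b -> annpot a b r = ballpot r b - ballpot r a.
Proof.
by move=> a0 ab; rewrite annpotE (bint_ann N0 ab (inner_bmeas r (le_trans a0 ab))).
Qed.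

End candidate.

(** * The equilibrium annulus *)

Section existence.
Context {R : realType} {N : nat} (i0 : 'I_N) (p : R).
Local Notation mu := (@lebesgueN R N).
Hypothesis p12 : 1 < p < 2.
Hypothesis hNp : 4 < N%:R + 2 * p.
Implicit Types (a b r t m : R) (x y : vec R N).

Let N0 : (0 < N)%N. Proof. by case: (N) i0 => [[]|]. Qed.
Local Notation w := (@bvol R N).

(** Lipschitz in the point by [sub_ray_lip], and in the volume of the ball by
    [ballpot_radius]. *)
Lemma ballpot_lip (K : R) : 0 <= K -> exists2 C : R, 0 <= C &
  forall r r' t t', `|r| <= K -> `|r'| <= K -> 0 <= t <= K -> 0 <= t' <= K ->
  `|ballpot i0 p r t - ballpot i0 p r' t'| <= C * (`|r - r'| + `|t ^+ N - t' ^+ N|).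
Proof.
move=> K0; have /andP[p1 p2] := p12.
have w0 := @bvol_gt0 R N.
pose L := (K + K) ^+ 2.
have L0 : 0 <= L by rewrite sqr_ge0.
pose C1 := p * L `^ (p - 1) * (2 * (K + K)) * (w * K ^+ N).
pose C2 := L `^ p * w.
have KN : 0 <= K ^+ N by rewrite exprn_ge0.
have C10 : 0 <= C1.
  by rewrite /C1 !mulr_ge0 ?powR_ge0 ?(ltW w0)//; lra.
have C20 : 0 <= C2 by rewrite mulr_ge0 ?powR_ge0 ?(ltW w0).
exists (C1 + C2); first exact: addr_ge0.
have lip1 r r' t : `|r| <= K -> `|r'| <= K -> 0 <= t <= K ->
    `|ballpot i0 p r t - ballpot i0 p r' t| <= C1 * `|r - r'|.
  move=> rK r'K /andP[t0 tK].
  have -> : C1 * `|r - r'| = (p * L `^ (p - 1) * (2 * (K + K) * `|r - r'|)) * (w * K ^+ N).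
    by rewrite /C1; ring.
  have bl (C : R) : 0 <= C -> C * fine (mu (ball0 t)) <= C * (w * K ^+ N).
    move=> C0; rewrite ler_wpM2l// (ball0_volN N0 t0) /= ler_pM2l//.
    by apply: lerXn2r; rewrite ?nnegrE.
  apply: le_trans (bl _ _); last first.
    by rewrite !mulr_ge0 ?powR_ge0//; lra.
  apply: bint_dist; [exact: measurable_ball0|exact: ball0_fin|exact: inner_bmeas|exact: inner_bmeas|].
  move=> y yt; rewrite /inner.
  have yK : (ball0 K : set (vec R N)) y by exact: lt_le_trans yt tK.
  have idS (z : vec R N) : ball0 K z -> enorm z < K by [].
  have s1 := sub_ray_ball i0 idS rK yK.
  have s2 := sub_ray_ball i0 idS r'K yK.
  have s3 := sub_ray_lip i0 idS rK r'K yK.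
  have main (s s' : R) : 0 <= s -> s <= s' -> s' <= L -> `|s `^ p - s' `^ p| <= p * L `^ (p - 1) * `|s - s'|.
    move=> h0 h1 h2.
    have mono : s `^ p <= s' `^ p by apply: ge0_ler_powR; rewrite ?nnegrE; lra.
    rewrite distrC ger0_norm ?subr_ge0// distrC ger0_norm ?subr_ge0//.
    apply: (le_trans (powR_lip (ltW p1) _)); first by rewrite h0.
    rewrite ler_wpM2r ?subr_ge0// ler_wpM2l//; first lra.
    by apply: ge0_ler_powR; rewrite ?nnegrE; lra.
  apply: (@le_trans _ _ (p * L `^ (p - 1) * `|sq (vsub (ray i0 r) y) - sq (vsub (ray i0 r') y)|)).
    have [h|/ltW h] := leP (sq (vsub (ray i0 r) y)) (sq (vsub (ray i0 r') y)).
      by apply: main => //; exact: sq_ge0.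
    by rewrite distrC (distrC (sq _)); apply: main => //; exact: sq_ge0.
  by rewrite ler_wpM2l// mulr_ge0 ?powR_ge0//; lra.
have lip2 r t t' : `|r| <= K -> 0 <= t -> t <= t' -> t' <= K ->
    `|ballpot i0 p r t - ballpot i0 p r t'| <= C2 * `|t ^+ N - t' ^+ N|.
  move=> rK t0 tt' t'K.
  have /andP[h1 h2] := ballpot_radius i0 p12 hNp r t0 tt'.
  have tN : t ^+ N <= t' ^+ N by apply: lerXn2r; rewrite ?nnegrE; lra.
  rewrite distrC ger0_norm// distrC ger0_norm ?subr_ge0//.
  apply: (le_trans h2); rewrite /C2 mulrA ler_wpM2r ?subr_ge0// ler_wpM2r ?(ltW w0)//.
  have rt : 0 <= `|r| + t' by rewrite addr_ge0//; lra.
  apply: ge0_ler_powR; rewrite ?nnegrE ?sqr_ge0//; first lra.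
  by apply: lerXn2r; rewrite ?nnegrE; lra.
move=> r r' t t' rK r'K tK /andP[t'0 t'K]; have /andP[t0 tK'] := tK.
apply: (@le_trans _ _ (C1 * `|r - r'| + C2 * `|t ^+ N - t' ^+ N|)); last first.
  by rewrite [leRHS]mulrDl; apply: lerD; rewrite ler_wpM2l// ?lerDl ?lerDr.
apply: (le_trans (ler_distD (ballpot i0 p r' t) _ _)).
apply: lerD; first exact: lip1.
have [tt'|/ltW t't] := leP t t'; first exact: lip2.
by rewrite distrC (distrC (t ^+ N)); exact: lip2.
Qed.

Variable m : R.
Hypothesis hm : 0 < m.

(** Outer radius of the annulus of mass [m] and inner radius [|a|]. The absolute
    value makes it a continuous function on the whole line, as the intermediate
    value theorem wants. *)
Definition outer a : R := (`|a| ^+ N + m / w) `^ (N%:R^-1).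

Let M0 : 0 < m / w. Proof. by rewrite divr_gt0// bvol_gt0. Qed.

Lemma base_gt0 a : 0 < `|a| ^+ N + m / w.
Proof. by rewrite ltr_wpDl// exprn_ge0. Qed.

Lemma outer_ge0 a : 0 <= outer a. Proof. exact: powR_ge0. Qed.

Lemma outerX a : outer a ^+ N = `|a| ^+ N + m / w.
Proof.
rewrite /outer -powR_mulrn ?powR_ge0// -powRrM mulVf; last by rewrite pnatr_eq0 -lt0n.
by rewrite powRr1// ltW// base_gt0.
Qed.

Lemma outer_gt a : `|a| < outer a.
Proof.
rewrite ltNge; apply/negP => h.
have : outer a ^+ N <= `|a| ^+ N by apply: lerXn2r; rewrite ?nnegrE ?outer_ge0.
rewrite outerX; have := M0; lra.
Qed.

Lemma outer_mono a (K : R) : `|a| <= K -> outer a <= outer K.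
Proof.
move=> aK; have K0 : 0 <= K by apply: le_trans aK.
have b1 := ltW (base_gt0 a); have b2 := ltW (base_gt0 K).
apply: ge0_ler_powR; rewrite ?nnegrE ?invr_ge0//.
by rewrite lerD2r (ger0_norm K0); apply: lerXn2r; rewrite ?nnegrE.
Qed.

Lemma absX_continuous n : continuous (fun a : R => `|a| ^+ n).
Proof.
move=> a; apply: (@continuous_comp _ _ _ (fun a : R => `|a|) (fun t : R => t ^+ n)).
  exact: norm_continuous.
exact: exprn_continuous.
Qed.

Lemma outer_continuous : continuous outer.
Proof.
move=> a; apply: (@continuous_comp _ _ _ (fun a : R => `|a| ^+ N + m / w) (fun t : R => t `^ N%:R^-1)).
  apply: cvgD; [exact: absX_continuous|exact: cvg_cst].
apply: differentiable_continuous; apply/derivable1_diffP.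
by apply: derivable_powR; rewrite in_itv /= base_gt0.
Qed.

Lemma ann_mass a : 0 <= a -> mu (ann a (outer a)) = m%:E.
Proof.
move=> a0; have := outer_gt a; rewrite ger0_norm// => ab.
rewrite (ann_vol N0 a0 (ltW ab)) outerX ger0_norm// addrAC subrr add0r.
by rewrite mulrC divfK// gt_eqF// bvol_gt0.
Qed.

Lemma ballpot_comp_continuous (u v : R -> R) : continuous u ->
  (forall K : R, exists K' : R, forall a, `|a| <= K -> `|u a| <= K' /\ 0 <= v a <= K') ->
  (forall a a', v a ^+ N - v a' ^+ N = `|a| ^+ N - `|a'| ^+ N) ->
  continuous (fun a => ballpot i0 p (u a) (v a)).
Proof.
move=> cu bd vN; apply: (@lip_continuous2 _ _ u (fun a => `|a| ^+ N) cu (@absX_continuous N)) => K.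
have [K' hK'] := bd K.
have [K'0|K'0] := leP 0 K'; last first.
  exists 0 => // a a' aK; have [h _] := hK' a aK.
  by have := le_lt_trans (le_trans (normr_ge0 _) h) K'0; rewrite ltxx.
have [C C0 hC] := ballpot_lip K'0; exists C => // a a' aK a'K.
have [h1 h2] := hK' a aK; have [h3 h4] := hK' a' a'K.
by rewrite -vN; apply: hC.
Qed.

(** The difference between the outer and inner boundary values of the potential
    minus [m p |x|^2]; its positive zeros are the inner radii of the equilibrium
    annuli. *)
Definition excess a : R :=
  (annpot i0 p `|a| (outer a) (outer a) - annpot i0 p `|a| (outer a) `|a|)
  - m * p * (outer a ^+ 2 - `|a| ^+ 2).

Lemma excess_continuous : continuous excess.
Proof.
rewrite (_ : excess = fun a => (ballpot i0 p (outer a) (outer a) - ballpot i0 p (outer a) `|a|)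
   - (ballpot i0 p `|a| (outer a) - ballpot i0 p `|a| `|a|)
   - m * p * (outer a ^+ 2 - `|a| ^+ 2)); last first.
  by apply/funext => a; rewrite /excess !(annpot_ball i0 p12 hNp _ (normr_ge0 a) (ltW (outer_gt a))).
have ca : continuous (fun a : R => `|a|) by move=> a; exact: norm_continuous.
have bdo (K : R) : exists K' : R, forall a, `|a| <= K -> `|outer a| <= K' /\ `|a| <= K'.
  exists (outer K) => a aK; rewrite ger0_norm ?outer_ge0//; split; first exact: outer_mono.
  by apply: (le_trans (ltW (outer_gt a))); exact: outer_mono.
have oN a a' : outer a ^+ N - outer a' ^+ N = `|a| ^+ N - `|a'| ^+ N.
  by rewrite !outerX; ring.
have c1 : continuous (fun a => ballpot i0 p (outer a) (outer a)).
  apply: ballpot_comp_continuous => //; first exact: outer_continuous.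
  move=> K; have [K' h] := bdo K; exists K' => a /h[h1 h2].
  by rewrite h1 outer_ge0; split => //=; rewrite -(ger0_norm (outer_ge0 a)).
have c2 : continuous (fun a => ballpot i0 p (outer a) `|a|).
  apply: ballpot_comp_continuous => //; first exact: outer_continuous.
  by move=> K; have [K' h] := bdo K; exists K' => a /h[h1 h2]; rewrite h1 h2 normr_ge0.
have c3 : continuous (fun a => ballpot i0 p `|a| (outer a)).
  apply: ballpot_comp_continuous => //.
  move=> K; have [K' h] := bdo K; exists K' => a /h[h1 h2].
  by rewrite normr_id h2 outer_ge0; split => //=; rewrite -(ger0_norm (outer_ge0 a)).
have c4 : continuous (fun a => ballpot i0 p `|a| `|a|).
  apply: ballpot_comp_continuous => //.
  by move=> K; have [K' h] := bdo K; exists K' => a /h[h1 h2]; rewrite normr_id h2 normr_ge0.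
have c5 : continuous (fun a => outer a ^+ 2).
  move=> a; apply: (@continuous_comp _ _ _ outer (fun t : R => t ^+ 2)).
    exact: outer_continuous.
  exact: exprn_continuous.
move=> a; apply: cvgB; last first.
  apply: cvgM; first exact: cvg_cst.
  by apply: cvgB; [exact: c5|exact: absX_continuous].
by apply: cvgB; apply: cvgB; [exact: c1|exact: c2|exact: c3|exact: c4].
Qed.

Lemma annpot_qc a b c r1 r0 r2 : 0 <= a -> 0 < fine (mu (ann a b)) -> 0 <= r1 -> r1 < r0 < r2 ->
  annpot i0 p a b r0 - c * r0 ^+ 2 <
  Num.max (annpot i0 p a b r1 - c * r1 ^+ 2) (annpot i0 p a b r2 - c * r2 ^+ 2).
Proof.
move=> a0 mS; apply: (@gpot_quasiconvex R N i0 (ann a b) (Num.max b 0) p) => //.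
- exact: measurable_ann.
- by move=> y /andP[_ h]; rewrite lt_max h.
- exact: ann_rad.
- by rewrite le_max lexx orbT.
Qed.

Lemma fine_mass a : 0 <= a -> fine (mu (ann a (outer a))) = m.
Proof. by move=> a0; rewrite ann_mass. Qed.

(** The midpoint inequality for [s^p] applied to [|a e - y|^2] and [|a e +
    y|^2], whose mean is [a^2 + |y|^2], then superadditivity. *)
Lemma inner_pair a (y : vec R N) :
  2 * ((a ^+ 2) `^ p + inner i0 p 0 y) <= inner i0 p a y + inner i0 p (- a) y.
Proof.
have /andP[/ltW p1 _] := p12.
rewrite /inner.
have E1 : (sq (vsub (ray i0 a) y) + sq (vsub (ray i0 (- a)) y)) / 2 = a ^+ 2 + sq y.
  by rewrite !sqB !sqZ !sq_base !dotZl; field.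
have E2 : sq (vsub (ray i0 0) y) = sq y by rewrite sqB sqZ dotZl; ring.
have := powR_midpoint p1 (sq_ge0 (vsub (ray i0 a) y)) (sq_ge0 (vsub (ray i0 (- a)) y)).
rewrite E1 E2; apply: le_trans.
have := powR_superadd p1 (sqr_ge0 a) (sq_ge0 y).
by move: (_ `^ p) (_ `^ p) (_ `^ p) => u v z; lra.
Qed.

(** The values at [a] and [- a] agree, so the pointwise estimate [inner_pair]
    can be integrated. *)
Lemma annpot_growth a : 0 <= a ->
  m * (a ^+ 2) `^ p <= annpot i0 p a (outer a) a - annpot i0 p a (outer a) 0.
Proof.
move=> a0; have /andP[p1 p2] := p12.
have arith (X Y Z W : R) : Z = Y -> 2 * (X + W) <= Y + Z -> X <= Y - W by lra.
pose S : set (vec R N) := ann a (outer a).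
have mS : measurable S by exact: measurable_ann.
have fS : (mu S < +oo)%E by exact: ann_fin.
have b r : bmeas S (inner i0 p r).
  apply: (@gpot_bmeas R N S (outer a) p) => //; last exact: outer_ge0.
  by move=> y; exact: ann_lt.
have even : annpot i0 p a (outer a) (- a) = annpot i0 p a (outer a) a.
  rewrite /annpot /prof; apply: gpot_radial; [exact: mS|exact: ann_rad|].
  by rewrite !enorm_ray normrN.
suff : 2 * (m * (a ^+ 2) `^ p + annpot i0 p a (outer a) 0) <=
   annpot i0 p a (outer a) a + annpot i0 p a (outer a) (- a) by exact: arith even.
have E : m * (a ^+ 2) `^ p = bint mu S (fun=> (a ^+ 2) `^ p).
  by rewrite (bint_cst _ mS) mulrC; apply: (congr1 (fun z => _ * z)); exact/esym/fine_mass.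
have bc := bmeas_cst S ((a ^+ 2) `^ p).
have H : bint mu S (fun y => 2 * ((a ^+ 2) `^ p + inner i0 p 0 y)) <=
    bint mu S (fun y => inner i0 p a y + inner i0 p (- a) y).
  apply: (bint_le mS fS (bmeasZ _ (bmeasD bc (b 0))) (bmeasD (b a) (b (- a)))).
  by move=> y _; exact: inner_pair.
rewrite (bintZ mS fS 2 (bmeasD bc (b 0))) (bintD mS fS bc (b 0)) (bintD mS fS (b a) (b (- a))) in H.
by rewrite E; exact: H.
Qed.

(** By [annpot_growth] the chord of the potential, as a function of [r^2],
    between [0] and [a] has slope at least [m p] once [a^(2p-2) >= p];
    quasiconvexity makes the potential exceed this chord at [outer a]. *)
Lemma excess_large : exists2 a, 0 < a & 0 < excess a.
Proof.
have /andP[p1 p2] := p12; have m0 := hm.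
have arith (g0 ga gb s b2 : R) : 0 < s -> m * (p * s) <= ga - g0 -> s < b2 ->
    ga - (ga - g0) / s * s < Num.max (g0 - (ga - g0) / s * 0 ^+ 2) (gb - (ga - g0) / s * b2) ->
    0 < gb - ga - m * p * (b2 - s).
  move=> s0 gr sb.
  have c1m : m * p <= (ga - g0) / s by rewrite ler_pdivlMr// -mulrA.
  rewrite divfK ?gt_eqF// expr0n /= mulr0 subr0 lt_max => /orP[|]; first by lra.
  have : (ga - g0) / s * s = ga - g0 by rewrite divfK ?gt_eqF.
  by move: ((ga - g0) / s) c1m => c1; nra.
(* a^2 = s with s^(p-1) = p *)
pose s := p `^ (p - 1)^-1.
have s0 : 0 < s by rewrite powR_gt0//; lra.
have q0 : 0 < p - 1 by lra.
pose a := Num.sqrt s.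
have a0 : 0 < a by rewrite sqrtr_gt0.
have a2 : a ^+ 2 = s by rewrite sqr_sqrtr// ltW.
have sp : s `^ p = p * s.
  rewrite -(mulr_powRB1 (ltW s0)); last by lra.
  rewrite /s -powRrM mulVf ?gt_eqF// powRr1; last by lra.
  by rewrite mulrC.
exists a => //.
have ab := outer_gt a; rewrite (ger0_norm (ltW a0)) in ab.
have gr := annpot_growth (ltW a0); rewrite a2 sp in gr.
have fm : 0 < fine (mu (ann a (outer a))) by rewrite fine_mass// ltW.
have r012 : 0 < a < outer a by rewrite a0.
(* subtracting this multiple of r^2 makes the values at 0 and a equal *)
have qc := annpot_qc ((annpot i0 p a (outer a) a - annpot i0 p a (outer a) 0) / s)
  (ltW a0) fm (lexx 0) r012.
have b2 : s < outer a ^+ 2 by rewrite -a2; apply: ltrXn2r; rewrite ?nnegrE ?outer_ge0 ?ltW.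
rewrite a2 in qc.
rewrite /excess (ger0_norm (ltW a0)) a2.
exact: arith s0 gr b2 qc.
Qed.

(** Intermediate value theorem for [excess]. Once the boundary values are equal,
    or the outer one is larger in the case [a = 0], quasiconvexity gives the
    strict sign on both sides. *)
Lemma equilibrium_annulus : exists a, [/\ 0 <= a,
  forall r, a < r < outer a ->
    annpot i0 p a (outer a) r - m * p * r ^+ 2 <
    annpot i0 p a (outer a) (outer a) - m * p * outer a ^+ 2 &
  forall r, 0 <= r -> (r < a) || (outer a < r) ->
    annpot i0 p a (outer a) (outer a) - m * p * outer a ^+ 2 <
    annpot i0 p a (outer a) r - m * p * r ^+ 2].
Proof.
have m0 := hm.
have arith1 (x y k s t : R) : 0 <= x - y - k * (s - t) -> y - k * t <= x - k * s by lra.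
have arith2 (x y k s t : R) : x - y - k * (s - t) = 0 -> y - k * t = x - k * s by lra.
have arith3 (x y : R) : x = y -> x <= y by move=> ->.
(* it suffices to compare the boundary values *)
suff [a a0 [ha1 ha2]] : exists2 a, 0 <= a &
   annpot i0 p a (outer a) a - m * p * a ^+ 2 <=
     annpot i0 p a (outer a) (outer a) - m * p * outer a ^+ 2 /\
   (0 < a -> annpot i0 p a (outer a) a - m * p * a ^+ 2 =
     annpot i0 p a (outer a) (outer a) - m * p * outer a ^+ 2).
  have fm : 0 < fine (mu (ann a (outer a))) by rewrite fine_mass.
  have ab := outer_gt a; rewrite (ger0_norm a0) in ab.
  have aux1 (x y z : R) : x < Num.max y z -> y <= z -> x < z.
    by rewrite lt_max => /orP[xy yz|//]; apply: lt_le_trans yz.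
  have aux2 (x y z : R) : x = z -> x < Num.max y z -> z < y.
    by move=> ->; rewrite lt_max ltxx orbF.
  have aux3 (x y z : R) : x < Num.max y z -> y <= x -> x < z.
    by rewrite lt_max => /orP[xy yx|//]; move: (lt_le_trans xy yx); rewrite ltxx.
  exists a; split; first exact: a0.
    by move=> r rab; exact: aux1 (annpot_qc (m * p) a0 fm a0 rab) ha1.
  move=> r r0 /orP[ra|br].
    have apos : 0 < a by exact: le_lt_trans ra.
    have rab : r < a < outer a by rewrite ra.
    exact: aux2 (ha2 apos) (annpot_qc (m * p) a0 fm r0 rab).
  have abr : a < outer a < r by rewrite ab.
  exact: aux3 (annpot_qc (m * p) a0 fm a0 abr) ha1.
(* a ball if the excess is already nonnegative at 0 *)
have [e0|e0] := leP 0 (excess 0).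
  exists 0 => //; split; last by rewrite ltxx.
  by rewrite /excess normr0 in e0; exact: arith1 e0.
have [A A0 eA] := excess_large.
have [] := @IVT R excess 0 A 0 (ltW A0) (continuous_subspaceT excess_continuous).
  by rewrite ge_min (ltW e0) le_max (ltW eA) orbT.
move=> a; rewrite in_itv /= => /andP[a0 aA] ea.
exists a; first exact: a0.
rewrite /excess (ger0_norm a0) in ea.
have E := arith2 _ _ _ _ _ ea.
by split; [exact: arith3 E|exact: (fun=> E)].
Qed.

End existence.

(** * Powers as mixtures of exponentials *)

Section power_mixture.
Context {R : realType}.
Local Notation leb := (@lebesgue_measure R).
Implicit Types (s u p : R).

(** The exponential minus its affine part at the origin. *)
Definition phi s : R := expR (- s) - 1 + s.

Lemma phi_ge0 s : 0 <= phi s.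
Proof. by rewrite /phi; have := expR_ge1Dx (- s); lra. Qed.

Lemma phi_gt0 s : s != 0 -> 0 < phi s.
Proof. by move=> s0; have := @expR_gt1Dx R (- s); rewrite oppr_eq0 => /(_ s0); rewrite /phi; lra. Qed.

Lemma phi0 : phi 0 = 0. Proof. by rewrite /phi oppr0 expR0; ring. Qed.

Lemma phi_le1 s : 0 <= s -> phi s <= s.
Proof.
move=> s0; have : expR (- s) <= 1 by rewrite expR_le1 oppr_le0.
by rewrite /phi; lra.
Qed.

Lemma phi_le2 s : 0 <= s -> phi s <= s ^+ 2.
Proof.
move=> s0; have h := expR_ge1Dx s.
have s1 : 0 < 1 + s by lra.
have : expR (- s) <= (1 + s)^-1 by rewrite expRN lef_pV2 ?posrE ?expR_gt0.
have : (1 + s)^-1 * (1 + s) = 1 by rewrite mulVf// gt_eqF.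
rewrite /phi; nra.
Qed.

Lemma measurable_phi : measurable_fun setT phi.
Proof.
apply: measurable_funD => //; apply: measurable_funB => //.
by apply: measurableT_comp => //; exact: measurable_expR.
Qed.

(** Integrand of the mixture of the [phi (t s)] against [t^(-1-p) dt], in the
    logarithmic variable [t = exp (- u)]: the scaling of [s] becomes a shift of
    [u]. *)
Definition mixw p s u : R := expR (p * u) * phi (expR (- u) * s).

Lemma mixw_ge0 p s u : 0 <= mixw p s u.
Proof. by rewrite mulr_ge0 ?expR_ge0 ?phi_ge0. Qed.

Lemma measurable_mixw d (T : measurableType d) p (f g : T -> R) :
  measurable_fun setT f -> measurable_fun setT g ->
  measurable_fun setT (fun t => mixw p (f t) (g t)).
Proof.
move=> mf mg; apply: measurable_funM.
  by apply: measurableT_comp; [exact: measurable_expR|exact: measurable_funM].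
apply: (measurableT_comp measurable_phi); apply: measurable_funM => //.
apply: measurableT_comp; first exact: measurable_expR.
by apply: measurableT_comp.
Qed.

Lemma mixw_shift p s u : 0 < s -> mixw p s (u + ln s) = s `^ p * mixw p 1 u.
Proof.
move=> s0; rewrite /mixw mulr1.
have -> : expR (p * (u + ln s)) = s `^ p * expR (p * u).
  by rewrite mulrDr expRD mulrC /powR gt_eqF.
have -> : expR (- (u + ln s)) * s = expR (- u).
  by rewrite opprD expRD expRN (expRN (ln s)) lnK ?posrE// -mulrA mulVf ?gt_eqF// mulr1.
by rewrite mulrA.
Qed.

Definition mixc p : \bar R := (\int[leb]_u (mixw p 1 u)%:E)%E.

(** Translation invariance in [u]. *)
Lemma mixw_scale p s : 0 <= s -> 0 < p ->
  (\int[leb]_u (mixw p s u)%:E = (s `^ p)%:E * mixc p)%E.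
Proof.
rewrite le_eqVlt => /orP[/eqP<-|s0] p0.
  rewrite powR0 ?gt_eqF// mul0e integral0_eq// => u _.
  by rewrite /mixw mulr0 phi0 mulr0.
have mF : measurable_fun setT (fun u : measurableTypeR R => (mixw p s u)%:E).
  by apply/measurable_EFinP; exact: measurable_mixw.
rewrite -(preserves_integral (shift_preserves1 (ln s)) mF); last first.
  by move=> u; rewrite lee_fin mixw_ge0.
rewrite /mixc -ge0_integralZl_EFin//; last 3 first.
- by move=> u _; rewrite lee_fin mixw_ge0.
- by apply/measurable_EFinP; exact: measurable_mixw.
- exact: powR_ge0.
by apply: eq_integral => u _; rewrite -EFinM -mixw_shift.
Qed.

Lemma mixc_gt0 p : (0 < mixc p)%E.
Proof.
have m1 : measurable_fun setT (fun u : measurableTypeR R => (mixw p 1 u)%:E).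
  by apply/measurable_EFinP; exact: measurable_mixw.
rewrite lt_neqAle integral_ge0 ?andbT; last by move=> u _; rewrite lee_fin mixw_ge0.
apply/eqP => /esym h.
have : (\int[leb]_u `|(mixw p 1 u)%:E| = 0)%E.
  rewrite -h; apply: eq_integral => u _.
  by rewrite gee0_abs// lee_fin mixw_ge0.
move=> /(ae_eq_integral_abs leb measurableT m1)[B [mB B0 hB]].
have sub : `[0, 1]%classic `<=` B.
  move=> u _; apply: hB => /=; rewrite not_implyE; split => //.
  move=> [] h0; have : 0 < mixw p 1 u.
    by rewrite mulr_gt0 ?expR_gt0// mulr1 phi_gt0 ?gt_eqF ?expR_gt0.
  by rewrite h0 ltxx.
have : (leb `[0%R, 1%R]%classic <= leb B)%E.
  by apply: le_measure; rewrite ?inE//; exact: measurable_itv.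
by rewrite B0 lebesgue_measure_itv /= lte_fin ltr01 oppr0 adde0 lee_fin ler10.
Qed.

(** Two-sided exponential bounds suffice, by comparison with the exponential
    distribution and its mirror image. *)
Lemma exp_tails_fin (k K : R) (F : measurableTypeR R -> R) : 0 < k -> 0 <= K -> measurable_fun setT F ->
  (forall u, 0 <= F u) -> (forall u, 0 <= u -> F u <= K * expR (- k * u)) ->
  (forall u, 0 <= u -> F (- u) <= K * expR (- k * u)) ->
  (\int[leb]_u (F u)%:E < +oo)%E.
Proof.
move=> k0 K0 mF F0 Fr Fl.
have pdf0 := @exponential_pdf_ge0 R k (ltW k0).
have mpdf := @measurable_exponential_pdf R k.
have mN : preserves leb (fun u : measurableTypeR R => - (u : R)).
  split; last exact: lebesgue_measureN.
  by apply: measurableT_comp.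
have mpdfE : measurable_fun setT (fun u : measurableTypeR R => (exponential_pdf k u)%:E).
  exact/measurable_EFinP.
have iN : (\int[leb]_u (exponential_pdf k (- u))%:E = 1)%E.
  rewrite (preserves_integral mN mpdfE); last by move=> u; rewrite lee_fin.
  exact: integral_exponential_pdf.
have i1 : (\int[leb]_u (exponential_pdf k u)%:E = 1)%E by exact: integral_exponential_pdf.
have mpdfN : measurable_fun setT (fun u : measurableTypeR R => (exponential_pdf k (- u))%:E).
  by apply/measurable_EFinP; apply: measurableT_comp => //; case: mN.
have Kk : 0 <= K / k by rewrite divr_ge0// ltW.
have pdfE v : 0 <= v -> K / k * exponential_pdf k v = K * expR (- k * v).
  by move=> v0; rewrite exponential_pdfE// mulrA divfK ?gt_eqF// mulNr.
apply: (@le_lt_trans _ _ (\int[leb]_u ((K / k)%:E * ((exponential_pdf k u)%:E + (exponential_pdf k (- u))%:E)))%E).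
  apply: ge0_le_integral => //.
  - by move=> u _; rewrite lee_fin.
  - exact/measurable_EFinP.
  - by apply: measurable_funeM; exact: emeasurable_funD.
  move=> u _; rewrite -EFinD -EFinM lee_fin.
  have [u0|u0] := leP 0 u.
    by apply: (le_trans (Fr _ u0)); rewrite -pdfE// ler_wpM2l// lerDl.
  have u1 : 0 <= - u by lra.
  by rewrite -{1}[u]opprK; apply: (le_trans (Fl _ u1)); rewrite -pdfE// ler_wpM2l// lerDr.
rewrite ge0_integralZl_EFin//; last 2 first.
- by move=> u _; rewrite adde_ge0// lee_fin.
- exact: emeasurable_funD.
rewrite ge0_integralD//; last 2 first.
- by move=> u _; rewrite lee_fin.
- by move=> u _; rewrite lee_fin.
by rewrite [X in (X + _)%E]i1 [X in (_ + X)%E]iN -EFinD -EFinM ltry.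
Qed.

(** Near [t = 0] the bound [phi t <= t^2] uses [p < 2]; at infinity [phi t <= t]
    uses [1 < p]. *)
Lemma mixc_fin p : 1 < p < 2 -> (mixc p < +oo)%E.
Proof.
move=> /andP[p1 p2].
pose k := Num.min (2 - p) (p - 1).
have k0 : 0 < k by rewrite lt_min; apply/andP; split; lra.
have k1 : k <= 2 - p by rewrite ge_min lexx.
have k2 : k <= p - 1 by rewrite ge_min lexx orbT.
apply: (exp_tails_fin k0 ler01).
- exact: measurable_mixw.
- by move=> u; exact: mixw_ge0.
- move=> u u0; rewrite mul1r /mixw mulr1.
  apply: (@le_trans _ _ (expR (p * u) * (expR (- u)) ^+ 2)).
    by rewrite ler_wpM2l ?expR_ge0// phi_le2 ?expR_ge0.
  by rewrite -expRM_natl -expRD ler_expR; nra.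
move=> u u0; rewrite mul1r /mixw mulr1.
apply: (@le_trans _ _ (expR (p * - u) * expR (- - u))).
  by rewrite ler_wpM2l ?expR_ge0// phi_le1 ?expR_ge0.
by rewrite -expRD ler_expR; nra.
Qed.

Lemma gauss1_fin (c : R) : 0 < c ->
  (\int[leb]_t (expR (- (c * t ^+ 2)))%:E < +oo)%E.
Proof.
move=> c0.
(* because v^2 >= v - 1/4 *)
have key v : 0 <= v -> expR (- (c * v ^+ 2)) <= expR (c / 4) * expR (- c * v).
  by move=> v0; rewrite -expRD ler_expR; have := sqr_ge0 (v - 2^-1); nra.
apply: (exp_tails_fin c0 (expR_ge0 (c / 4))).
- apply: (measurableT_comp (@measurable_expR R)).
  by apply: measurable_funN; apply: measurable_funM => //; exact: measurable_funX.
- by move=> u; exact: expR_ge0.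
- exact: key.
by move=> u u0; rewrite sqrrN; exact: key.
Qed.

End power_mixture.

Section gaussN.
Context {R : realType}.

Definition gaussN n (c : R) : \bar R :=
  (\int[@lebesgueN R n]_z (expR (- (c * sq z)))%:E)%E.

Lemma integral_lebesgueN_succ n (f : vec R n.+1 -> \bar R) :
  measurable_fun setT f -> (forall z, 0 <= f z)%E ->
  (\int[@lebesgueN R n.+1]_z f z =
   \int[@lebesgue_measure R]_t \int[@lebesgueN R n]_y f (cons_pair (t, y)))%E.
Proof.
move=> mf f0.
pose P : {measure set (measurableTypeR R * vec R n) -> \bar R} :=
  (@lebesgue_measure R \x @lebesgueN R n)%E.
have H := @ge0_integral_pushforward _ _ _ _ R (@cons_pair (measurableTypeR R) n)
  (@measurable_cons_pair R n) P setT f measurableT mf (fun y _ => f0 y).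
transitivity (\int[pushforward P (@cons_pair (measurableTypeR R) n)]_z f z)%E; first by [].
rewrite H preimage_setT /P fubini_tonelli1; [by []| |by move=> z; exact: f0].
by apply: (measurableT_comp mf); exact: measurable_cons_pair.
Qed.

Lemma measurable_gaussN n (c : R) :
  measurable_fun setT (fun z : vec R n => (expR (- (c * sq z)))%:E).
Proof.
apply/measurable_EFinP; apply: (measurableT_comp (@measurable_expR R)).
by apply: measurable_funN; apply: measurable_funM => //; exact: mfun_sq.
Qed.

Lemma gaussN_fin n (c : R) : 0 < c -> (gaussN n c < +oo)%E.
Proof.
move=> c0; elim: n => [|n IH].
  rewrite /gaussN integral_dirac//; last exact: (@measurable_gaussN 0 c).
  by rewrite diracE mem_set// mul1e ltry.
have g0 k (z : vec R k) : (0 <= (expR (- (c * sq z)))%:E)%E by rewrite lee_fin expR_ge0.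
rewrite /gaussN integral_lebesgueN_succ; [|exact: measurable_gaussN|by move=> z; exact: g0].
have E (t : measurableTypeR R) : (\int[@lebesgueN R n]_y (expR (- (c * sq (cons_pair (t, y)))))%:E =
    (expR (- (c * (t : R) ^+ 2)))%:E * gaussN n c)%E.
  rewrite -ge0_integralZl_EFin ?expR_ge0//; last exact: measurable_gaussN.
  by apply: eq_integral => y _; rewrite sq_cons mulrDr opprD expRD EFinM.
rewrite (eq_integral (fun t : measurableTypeR R => (expR (- (c * (t : R) ^+ 2)))%:E * gaussN n c)%E); last by move=> t _; exact: E.
have gE : gaussN n c = (fine (gaussN n c))%:E by rewrite fineK// ge0_fin_numE// integral_ge0.
rewrite gE ge0_integralZr//.
- have := gauss1_fin c0.
  have h : (0 <= \int[@lebesgue_measure R]_t (expR (- (c * t ^+ 2)))%:E)%E.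
    by apply: integral_ge0 => t _; rewrite lee_fin expR_ge0.
  by move: h; case: (\int[_]_t _)%E => // r _ _; rewrite -EFinM ltry.
- apply/measurable_EFinP; apply: (measurableT_comp (@measurable_expR R)).
  by apply: measurable_funN; apply: measurable_funM => //; exact: measurable_funX.
- by rewrite lee_fin fine_ge0// integral_ge0.
Qed.

Lemma gaussN_gt0 n (c : R) : (0 < gaussN n c)%E.
Proof.
have m1 := @measurable_gaussN n c.
have mB := @measurable_ball0 R n 1.
pose k := expR (- `|c|).
apply: (@lt_le_trans _ _ (\int[@lebesgueN R n]_(z in ball0 1) k%:E)%E).
  by rewrite integral_cst// mule_gt0 ?lte_fin ?expR_gt0// ball0_gt0.
apply: (@le_trans _ _ (\int[@lebesgueN R n]_(z in ball0 1) (expR (- (c * sq z)))%:E)%E).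
  apply: ge0_le_integral => //.
  - by move=> z _; rewrite lee_fin expR_ge0.
  - exact: measurable_funTS.
  - move=> z; rewrite /ball0 /= => z1; rewrite lee_fin ler_expR lerN2.
    have := sq_ge0 z; have : sq z <= 1.
      by rewrite -enorm_sq -[leRHS](expr1n _ 2); apply: lerXn2r; rewrite ?nnegrE ?enorm_ge0// ltW.
    move=> h1 h0; have := ler_norm c; have := normr_ge0 c; nra.
apply: ge0_subset_integral => //.
Qed.

End gaussN.

(** * Gaussian forms *)

Section tonelli.
Context d1 d2 (T1 : measurableType d1) (T2 : measurableType d2) (R : realType).
Variables (m1 : {sigma_finite_measure set T1 -> \bar R}) (m2 : {sigma_finite_measure set T2 -> \bar R}).

Lemma tonelli (f : T1 -> T2 -> \bar R) :
  measurable_fun setT (fun z : T1 * T2 => f z.1 z.2) -> (forall x y, 0 <= f x y)%E ->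
  (\int[m1]_x \int[m2]_y f x y = \int[m2]_y \int[m1]_x f x y)%E.
Proof.
move=> mf f0.
exact: (@fubini_tonelli _ _ _ _ _ m1 m2 (fun z => f z.1 z.2) mf (fun z => f0 z.1 z.2)).
Qed.

Lemma measurable_inner (f : T1 -> T2 -> \bar R) :
  measurable_fun setT (fun z : T1 * T2 => f z.1 z.2) -> (forall x y, 0 <= f x y)%E ->
  measurable_fun setT (fun x => \int[m2]_y f x y)%E.
Proof.
move=> mf f0.
exact: (@measurable_fun_fubini_tonelli_F _ _ _ _ _ m2 (fun z => f z.1 z.2) mf (fun z => f0 z.1 z.2)).
Qed.
End tonelli.

Section forms.
Context {R : realType} {N : nat}.
Local Notation mu := (@lebesgueN R N).
Implicit Types (h k f : vec R N -> R) (F G : R -> R) (t : R).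

(** Nonnegative measurable functions: for these Tonelli applies unconditionally. *)
Definition nneg_mfun h := measurable_fun setT h /\ forall x, 0 <= h x.

Definition dint F h1 h2 : \bar R :=
  (\int[mu]_x \int[mu]_y (F (sq (vsub x y)) * h1 x * h2 y)%:E)%E.

Lemma measurable_dint d (T : measurableType d) F h1 h2 (u v : T -> vec R N) :
  measurable_fun setT F -> measurable_fun setT h1 -> measurable_fun setT h2 ->
  measurable_fun setT u -> measurable_fun setT v ->
  measurable_fun setT (fun z => F (sq (vsub (u z) (v z))) * h1 (u z) * h2 (v z)).
Proof.
move=> mF m1 m2 mu mv.
apply: measurable_funM; last exact: (measurableT_comp m2 mv).
apply: measurable_funM; last exact: (measurableT_comp m1 mu).
by apply: (measurableT_comp mF); apply: mfun_sq; exact: mfun_vsub.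
Qed.

Section dint_lemmas.
Variables (h1 h2 : vec R N -> R).
Hypotheses (n1 : nneg_mfun h1) (n2 : nneg_mfun h2).

Lemma dint_integrand_ge0 F (x y : vec R N) : (forall s, 0 <= F s) ->
  (0 <= (F (sq (vsub x y)) * h1 x * h2 y)%:E)%E.
Proof. by move=> F0; rewrite lee_fin !mulr_ge0 ?(proj2 n1) ?(proj2 n2). Qed.

Lemma dint_inner_meas F (x : vec R N) : measurable_fun setT F ->
  measurable_fun setT (fun y => (F (sq (vsub x y)) * h1 x * h2 y)%:E).
Proof.
move=> mF; apply/measurable_EFinP.
apply: measurable_funM; last exact: (proj1 n2).
apply: measurable_funM => //.
by apply: (measurableT_comp mF); apply: mfun_sq; exact: mfun_vsub.
Qed.

Lemma dint_outer_meas F : measurable_fun setT F -> (forall s, 0 <= F s) ->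
  measurable_fun setT (fun x => \int[mu]_y (F (sq (vsub x y)) * h1 x * h2 y)%:E)%E.
Proof.
move=> mF F0; apply: (@measurable_inner _ _ _ _ R mu).
  by apply/measurable_EFinP; apply: measurable_dint => //; [case: n1|case: n2].
by move=> x y; exact: dint_integrand_ge0.
Qed.

Lemma dint_ge0 F : (forall s, 0 <= F s) -> (0 <= dint F h1 h2)%E.
Proof.
move=> F0; apply: integral_ge0 => x _; apply: integral_ge0 => y _.
exact: dint_integrand_ge0.
Qed.

Lemma dintD F G : measurable_fun setT F -> (forall s, 0 <= F s) ->
  measurable_fun setT G -> (forall s, 0 <= G s) ->
  dint (fun s => F s + G s) h1 h2 = (dint F h1 h2 + dint G h1 h2)%E.
Proof.
move=> mF F0 mG G0.
rewrite /dint -ge0_integralD//; last 4 first.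
- by move=> x _; apply: integral_ge0 => y _; exact: dint_integrand_ge0.
- exact: dint_outer_meas.
- by move=> x _; apply: integral_ge0 => y _; exact: dint_integrand_ge0.
- exact: dint_outer_meas.
apply: eq_integral => x _; rewrite -ge0_integralD//; last 4 first.
- by move=> y _; exact: dint_integrand_ge0.
- exact: dint_inner_meas.
- by move=> y _; exact: dint_integrand_ge0.
- exact: dint_inner_meas.
by apply: eq_integral => y _; rewrite -EFinD !mulrDl.
Qed.

Lemma dintZ (c : R) F : 0 <= c -> measurable_fun setT F -> (forall s, 0 <= F s) ->
  dint (fun s => c * F s) h1 h2 = (c%:E * dint F h1 h2)%E.
Proof.
move=> c0 mF F0.
rewrite /dint -ge0_integralZl_EFin//; last 2 first.
- by move=> x _; apply: integral_ge0 => y _; exact: dint_integrand_ge0.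
- exact: dint_outer_meas.
apply: eq_integral => x _; rewrite -ge0_integralZl_EFin//; last 2 first.
- by move=> y _; exact: dint_integrand_ge0.
- exact: dint_inner_meas.
by apply: eq_integral => y _; rewrite -EFinM !mulrA.
Qed.

Lemma dint_le F G : measurable_fun setT F -> (forall s, 0 <= F s) ->
  measurable_fun setT G -> (forall s, 0 <= s -> F s <= G s) -> (forall s, 0 <= G s) ->
  (dint F h1 h2 <= dint G h1 h2)%E.
Proof.
move=> mF F0 mG FG G0.
apply: ge0_le_integral => //.
- by move=> x _; apply: integral_ge0 => y _; exact: dint_integrand_ge0.
- exact: dint_outer_meas.
- exact: dint_outer_meas.
move=> x _; apply: ge0_le_integral => //.
- by move=> y _; exact: dint_integrand_ge0.
- exact: dint_inner_meas.
- exact: dint_inner_meas.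
move=> y _; rewrite lee_fin ler_wpM2r ?(proj2 n2)// ler_wpM2r ?(proj2 n1)//.
by apply: FG; exact: sq_ge0.
Qed.

Lemma dint_cst (c : R) : 0 <= c ->
  dint (fun=> c) h1 h2 = (c%:E * ((\int[mu]_x (h1 x)%:E) * (\int[mu]_y (h2 y)%:E)))%E.
Proof.
move=> c0.
have [m1 p1] := n1; have [m2 p2] := n2.
rewrite /dint (eq_integral (fun x => (c * h1 x)%:E * \int[mu]_y (h2 y)%:E)%E); last first.
  move=> x _; rewrite -ge0_integralZl_EFin//; last 3 first.
  - by move=> y _; rewrite lee_fin.
  - exact/measurable_EFinP.
  - exact: mulr_ge0.
rewrite ge0_integralZr//; last 3 first.
- by apply/measurable_EFinP; exact: measurable_funM.
- by move=> x _; rewrite lee_fin mulr_ge0.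
- by apply: integral_ge0 => y _; rewrite lee_fin.
rewrite muleA; congr (_ * _)%E.
rewrite -ge0_integralZl_EFin//; last 2 first.
- by move=> y _; rewrite lee_fin.
- exact/measurable_EFinP.
Qed.

End dint_lemmas.

Definition gk t s : R := expR (- (t * s)).

Lemma measurable_gk t : measurable_fun setT (gk t).
Proof.
apply: (measurableT_comp (@measurable_expR R)).
by apply: measurable_funN; exact: measurable_funM.
Qed.

Lemma gk_ge0 t s : 0 <= gk t s. Proof. exact: expR_ge0. Qed.

(** The Gaussian form is an inner product of such convolutions
    ([gauss_form_conv]). *)
Definition gconv t h (z : vec R N) : \bar R := (\int[mu]_x (gk t (sq (vsub x z)) * h x)%:E)%E.

(** The parallelogram law, with [z] measured from the midpoint of [x] and [y]. *)
Lemma median_identity (x y z : vec R N) :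
  2 * sq (vsub x (vadd z (vscale 2^-1 (vadd x y)))) +
  2 * sq (vsub y (vadd z (vscale 2^-1 (vadd x y)))) = sq (vsub x y) + 4 * sq z.
Proof.
rewrite !sqE !mulr_sumr -!big_split; apply: eq_bigr => i _.
by rewrite !cosE /=; field.
Qed.

(** Translating [z] to the midpoint of [x] and [y] separates the variables, by
    [median_identity]. *)
Lemma gauss_convolution t (x y : vec R N) :
  (\int[mu]_z (gk (2 * t) (sq (vsub x z)) * gk (2 * t) (sq (vsub y z)))%:E =
   (gk t (sq (vsub x y)))%:E * gaussN N (4 * t))%E.
Proof.
pose w := vscale 2^-1 (vadd x y).
have mf : measurable_fun setT
    (fun z => (gk (2 * t) (sq (vsub x z)) * gk (2 * t) (sq (vsub y z)))%:E).
  apply/measurable_EFinP; apply: measurable_funM;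
  by apply: (measurableT_comp (measurable_gk _)); apply: mfun_sq; exact: mfun_vsub.
rewrite -(preserves_integral (shift_preserves w) mf); last first.
  by move=> z; rewrite lee_fin mulr_ge0 ?gk_ge0.
rewrite /gaussN -ge0_integralZl_EFin; [|exact: measurableT|by move=> z _; rewrite lee_fin expR_ge0|
  exact: measurable_gaussN|exact: gk_ge0].
apply: eq_integral => z _; rewrite -EFinM; congr (_%:E).
rewrite /gk -!expRD; congr expR.
have := median_identity x y z; rewrite -/w.
set A := sq (vsub x _); set B := sq (vsub y _) => h.
rewrite (_ : - (2 * t * A) + - (2 * t * B) = - (t * (2 * A + 2 * B))); last by ring.
by rewrite h; ring.
Qed.

Section gauss_form.
Variables (t : R) (h1 h2 : vec R N -> R).
Hypotheses (n1 : nneg_mfun h1) (n2 : nneg_mfun h2).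

Lemma gconv_ge0 z : (0 <= gconv t h1 z)%E.
Proof.
by apply: integral_ge0 => x _; rewrite lee_fin mulr_ge0 ?gk_ge0 ?(proj2 n1).
Qed.

Lemma gconv_meas : measurable_fun setT (gconv t h1).
Proof.
have [m1 p1] := n1.
apply: (@measurable_inner _ _ _ _ R mu (fun z x => (gk t (sq (vsub x z)) * h1 x)%:E)).
  apply/measurable_EFinP; apply: measurable_funM; last exact: (measurableT_comp m1).
  by apply: (measurableT_comp (measurable_gk _)); apply: mfun_sq; exact: mfun_vsub.
by move=> z x; rewrite lee_fin mulr_ge0 ?gk_ge0.
Qed.

Lemma gconv_le : 0 <= t -> forall z, (gconv t h1 z <= \int[mu]_x (h1 x)%:E)%E.
Proof.
move=> t0 z; have [m1 p1] := n1.
apply: ge0_le_integral; [exact: measurableT|by move=> x _; rewrite lee_fin mulr_ge0 ?gk_ge0| |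
  exact/measurable_EFinP|].
  apply/measurable_EFinP; apply: measurable_funM => //.
  by apply: (measurableT_comp (measurable_gk _)); apply: mfun_sq; exact: mfun_vsub.
move=> x _; rewrite lee_fin -[leRHS]mul1r ler_wpM2r//.
by rewrite /gk expR_le1 oppr_le0 mulr_ge0// sq_ge0.
Qed.

End gauss_form.

(** Tonelli, after expanding the kernel by [gauss_convolution]. *)
Lemma gauss_form_conv t h1 h2 : nneg_mfun h1 -> nneg_mfun h2 ->
  (gaussN N (4 * t) * dint (gk t) h1 h2 =
   \int[mu]_z (gconv (2 * t) h1 z * gconv (2 * t) h2 z))%E.
Proof.
move=> n1 n2; have [m1 p1] := n1; have [m2 p2] := n2.
pose e (x z : vec R N) := gk (2 * t) (sq (vsub x z)).
have e0 x z : 0 <= e x z by exact: gk_ge0.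
have me d (T : measurableType d) (u v : T -> vec R N) : measurable_fun setT u ->
    measurable_fun setT v -> measurable_fun setT (fun q => e (u q) (v q)).
  move=> mu' mv; apply: (measurableT_comp (measurable_gk _)); apply: mfun_sq.
  exact: mfun_vsub.
have g0 : (0 <= gaussN N (4 * t))%E by apply: integral_ge0 => z _; rewrite lee_fin expR_ge0.
transitivity (\int[mu]_x \int[mu]_y \int[mu]_z (e x z * h1 x * (e y z * h2 y))%:E)%E.
  rewrite /dint -ge0_integralZl; [|exact: measurableT|exact: (dint_outer_meas n1 n2 (measurable_gk t) (gk_ge0 t))|
    by move=> x _; apply: integral_ge0 => y _; exact: (dint_integrand_ge0 n1 n2 _ _ (gk_ge0 t))|exact: g0].
  apply: eq_integral => x _.
  rewrite -ge0_integralZl; [|exact: measurableT|by apply: dint_inner_meas; [exact: n2|exact: measurable_gk]|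
    by move=> y _; exact: (dint_integrand_ge0 n1 n2 _ _ (gk_ge0 t))|exact: g0].
  apply: eq_integral => y _.
  rewrite (eq_integral (fun z => (h1 x * h2 y)%:E * (e x z * e y z)%:E)%E); last first.
    by move=> z _; rewrite -EFinM; congr (_%:E); ring.
  rewrite ge0_integralZl_EFin; [|exact: measurableT|by move=> z _; rewrite lee_fin mulr_ge0| |by rewrite mulr_ge0].
    by rewrite gauss_convolution muleA -EFinM muleC; congr (_%:E * _)%E; ring.
  by apply/measurable_EFinP; apply: measurable_funM; apply: me.
have mconv := gconv_meas (2 * t) n2.
transitivity (\int[mu]_x \int[mu]_z ((e x z * h1 x)%:E * gconv (2 * t) h2 z))%E.
  apply: eq_integral => x _.
  rewrite (@tonelli _ _ _ _ _ mu mu (fun y z => (e x z * h1 x * (e y z * h2 y))%:E)); last 2 first.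
  - apply/measurable_EFinP; apply: measurable_funM.
      by apply: measurable_funM => //; apply: me.
    by apply: measurable_funM; [apply: me|exact: (measurableT_comp m2)].
  - by move=> y z; rewrite lee_fin !mulr_ge0.
  apply: eq_integral => z _; rewrite /gconv.
  rewrite -ge0_integralZl_EFin; [|exact: measurableT|by move=> y _; rewrite lee_fin mulr_ge0 ?gk_ge0| |by rewrite mulr_ge0].
    by apply: eq_integral => y _; rewrite -EFinM.
  by apply/measurable_EFinP; apply: measurable_funM => //; apply: me.
have gc0 z := gconv_ge0 (2 * t) n2 z.
rewrite (@tonelli _ _ _ _ _ mu mu (fun x z => ((e x z * h1 x)%:E * gconv (2 * t) h2 z)%E)); last 2 first.
- apply: emeasurable_funM; last exact: (measurableT_comp mconv).
  apply/measurable_EFinP; apply: measurable_funM; [by apply: me|exact: (measurableT_comp m1)].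
- by move=> x z; rewrite mule_ge0// lee_fin mulr_ge0.
apply: eq_integral => z _.
rewrite ge0_integralZr; [by []|exact: measurableT| |by move=> x _; rewrite lee_fin mulr_ge0|exact: gc0].
by apply/measurable_EFinP; apply: measurable_funM => //; apply: me.
Qed.

(** The form is the [L^2] inner product of Gaussian convolutions, so this is [2
    a b <= a^2 + b^2] integrated. *)
Lemma gauss_form_psd t h1 h2 : 0 < t -> nneg_mfun h1 -> nneg_mfun h2 ->
  (\int[mu]_x (h1 x)%:E < +oo)%E -> (\int[mu]_x (h2 x)%:E < +oo)%E ->
  (2%:E * dint (gk t) h1 h2 <= dint (gk t) h1 h1 + dint (gk t) h2 h2)%E.
Proof.
move=> t0 n1 n2 f1 f2.
have t2 : 0 <= 2 * t by rewrite mulr_ge0// ltW.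
have t4 : 0 < 4 * t by rewrite mulr_gt0.
have Gfin := gaussN_fin N t4.
have fin h (z : vec R N) : nneg_mfun h -> (\int[mu]_x (h x)%:E < +oo)%E -> gconv (2 * t) h z \is a fin_num.
  move=> n f; rewrite ge0_fin_numE; last exact: gconv_ge0.
  by apply: le_lt_trans f; exact: gconv_le.
have mc h : nneg_mfun h -> measurable_fun setT (gconv (2 * t) h) by exact: gconv_meas.
have c0 h (z : vec R N) : nneg_mfun h -> (0 <= gconv (2 * t) h z)%E by move=> n; exact: gconv_ge0.
have main : (2%:E * (gaussN N (4 * t) * dint (gk t) h1 h2) <=
   gaussN N (4 * t) * dint (gk t) h1 h1 + gaussN N (4 * t) * dint (gk t) h2 h2)%E.
  rewrite !gauss_form_conv//.
  rewrite -ge0_integralZl_EFin; [|exact: measurableT|by move=> z _; rewrite mule_ge0 ?c0| |by []]; last first.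
    by apply: emeasurable_funM; exact: mc.
  rewrite -ge0_integralD; [|exact: measurableT|by move=> z _; rewrite mule_ge0 ?c0| |by move=> z _; rewrite mule_ge0 ?c0|];
    try by apply: emeasurable_funM; exact: mc.
  apply: ge0_le_integral; [exact: measurableT|by move=> z _; rewrite mule_ge0 ?mule_ge0 ?c0| | |].
  - by apply: measurable_funeM; apply: emeasurable_funM; exact: mc.
  - by apply: emeasurable_funD; apply: emeasurable_funM; exact: mc.
  move=> z _; rewrite -(fineK (fin _ z n1 f1)) -(fineK (fin _ z n2 f2)) -!EFinM -EFinD lee_fin.
  have := sqr_ge0 (fine (gconv (2 * t) h1 z) - fine (gconv (2 * t) h2 z)); nra.
have G0 := gaussN_gt0 N (4 * t).
have Gf : gaussN N (4 * t) \is a fin_num by rewrite ge0_fin_numE// ltW.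
have d0 h : nneg_mfun h -> (0 <= dint (gk t) h h)%E by move=> n; apply: dint_ge0 => //; exact: gk_ge0.
rewrite -(lee_pmul2l Gf G0) (ge0_muleDr _ (d0 _ n1) (d0 _ n2)).
by rewrite muleCA.
Qed.

End forms.

(** * Moments of densities *)

Section moments.
Context {R : realType} {N : nat}.
Local Notation mu := (@lebesgueN R N).
Implicit Types (h k f F G : vec R N -> R) (t p m : R).

(** Densities of mass [m] with a finite moment of order [2p]; then every
    integral below converges. *)
Record mdens (p m : R) h : Prop := MDens {
  md_nn : nneg_mfun h;
  md_mass : (\int[mu]_x (h x)%:E = m%:E)%E;
  md_mom : (\int[mu]_x (sq x `^ p * h x)%:E < +oo)%E }.

Definition wint h (F : vec R N -> R) : R := \int[mu]_x (F x * h x).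
Definition wintegrable h (F : vec R N -> R) := mu.-integrable setT (EFin \o (fun x => F x * h x)).

(** The center of mass is the origin. *)
Definition centered h := forall v, wint h (fun x => dot x v) = 0.
Definition second_moment h : R := wint h (fun x => sq x).

Section one_density.
Variables (p m : R) (h : vec R N -> R).
Hypotheses (hp : 1 <= p) (dh : mdens p m h).

Lemma wintegrable_bound (C : R) (F : vec R N -> R) : measurable_fun setT F -> 0 <= C ->
  (forall x, `|F x| <= C * (1 + sq x `^ p)) -> wintegrable h F.
Proof.
move=> mF C0 hF; have [[mh h0] mass mom] := dh.
have mp : measurable_fun setT (fun x : vec R N => sq x `^ p).
  by apply: (measurableT_comp (measurable_powR p)); exact: mfun_sq.
apply/integrableP; split; first by apply/measurable_EFinP; exact: measurable_funM.
apply: (@le_lt_trans _ _ (\int[mu]_x (C%:E * ((h x)%:E + (sq x `^ p * h x)%:E)))%E).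
  apply: ge0_le_integral => //.
  - apply: measurableT_comp => //; apply/measurable_EFinP; exact: measurable_funM.
  - apply: measurable_funeM; apply: emeasurable_funD; first exact/measurable_EFinP.
    by apply/measurable_EFinP; exact: measurable_funM.
  move=> x _; rewrite /= -EFinD -EFinM lee_fin normrM (ger0_norm (h0 x)).
  by have := ler_wpM2r (h0 x) (hF x); rewrite -mulrA mulrDl mul1r.
rewrite ge0_integralZl_EFin//; last 2 first.
- by move=> x _; rewrite adde_ge0// lee_fin// mulr_ge0 ?powR_ge0.
- apply: emeasurable_funD; first exact/measurable_EFinP.
  by apply/measurable_EFinP; exact: measurable_funM.
rewrite ge0_integralD//; last 4 first.
- by move=> x _; rewrite lee_fin.
- exact/measurable_EFinP.
- by move=> x _; rewrite lee_fin mulr_ge0 ?powR_ge0.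
- by apply/measurable_EFinP; exact: measurable_funM.
rewrite mass; move: mom.
have : (0 <= \int[mu]_x (sq x `^ p * h x)%:E)%E.
  by apply: integral_ge0 => x _; rewrite lee_fin mulr_ge0 ?powR_ge0.
by case: (\int[mu]_x (sq x `^ p * h x)%:E)%E => // r _ _; rewrite -EFinD -EFinM ltry.
Qed.

Lemma le_powR1 (s : R) : 0 <= s -> s <= 1 + s `^ p.
Proof.
move=> s0; have [s1|s1] := leP s 1; first by rewrite (le_trans s1)// lerDl powR_ge0.
by rewrite (@le_trans _ _ (s `^ p))// ?lerDr// le1r_powR// ltW.
Qed.

Lemma wintegrable_sq : wintegrable h (fun x => sq x).
Proof.
apply: (@wintegrable_bound 1) => //; first exact: mfun_sq.
by move=> x; rewrite mul1r ger0_norm ?sq_ge0// le_powR1// sq_ge0.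
Qed.

Lemma wintegrable_cst (c : R) : wintegrable h (fun=> c).
Proof.
apply: (@wintegrable_bound `|c|) => //.
by move=> x; rewrite ler_peMr// lerDl powR_ge0.
Qed.

Lemma wintegrable_dot v : wintegrable h (fun x => dot x v).
Proof.
apply: (@wintegrable_bound (1 + sq v)); first exact: mfun_dot.
  by rewrite addr_ge0 ?sq_ge0.
move=> x.
have h1 : `|dot x v| <= sq x + sq v.
  (* the squares of x + v and x - v bound the product on both sides *)
  have h2 := sq_ge0 (vadd x v); have h3 := sq_ge0 (vsub x v).
  rewrite sqD in h2; rewrite sqB in h3.
  have := sq_ge0 x; have := sq_ge0 v => ? ?.
  by rewrite ler_norml; apply/andP; split; lra.
apply: (le_trans h1).
have := le_powR1 (sq_ge0 x); have := sq_ge0 v; have := powR_ge0 (sq x) p.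
move: (sq x) (sq v) (sq x `^ p) => a b c; nra.
Qed.

Lemma wintegrable_pow : wintegrable h (fun x => sq x `^ p).
Proof.
apply: (@wintegrable_bound 1) => //.
  by apply: (measurableT_comp (measurable_powR p)); exact: mfun_sq.
by move=> x; rewrite mul1r ger0_norm ?powR_ge0// lerDr.
Qed.

Lemma wint_cst (c : R) : wint h (fun=> c) = c * m.
Proof.
have [[mh h0] mass mom] := dh.
rewrite /wint /Rintegral.
rewrite (eq_integral (fun x => c%:E * (h x)%:E)%E); last by move=> x _; rewrite EFinM.
rewrite integralZl//; first by rewrite mass.
have := wintegrable_cst 1; apply: eq_integrable => // x _.
by rewrite /= mul1r.
Qed.

Lemma wintD F G : wintegrable h F -> wintegrable h G ->
  wint h (fun x => F x + G x) = wint h F + wint h G.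
Proof.
move=> iF iG; rewrite /wint -RintegralD//.
by apply: eq_Rintegral => x _; rewrite mulrDl.
Qed.

Lemma wintZ (c : R) F : wintegrable h F -> wint h (fun x => c * F x) = c * wint h F.
Proof.
move=> iF; rewrite /wint -RintegralZl//.
by apply: eq_Rintegral => x _; rewrite mulrA.
Qed.

Lemma wintegrableD F G : wintegrable h F -> wintegrable h G ->
  wintegrable h (fun x => F x + G x).
Proof.
move=> iF iG; have := integrableD measurableT iF iG.
apply: eq_integrable => // x _; by rewrite /= mulrDl EFinD.
Qed.

Lemma wintegrableZ (c : R) F : wintegrable h F -> wintegrable h (fun x => c * F x).
Proof.
move=> iF; have := integrableZl measurableT c iF.
by apply: eq_integrable => // x _; rewrite /= -EFinM mulrA.
Qed.

Lemma wint_EFin F : wintegrable h F -> (\int[mu]_x (F x * h x)%:E)%E = (wint h F)%:E.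
Proof. by move=> iF; rewrite /wint /Rintegral fineK//; exact: integrable_fin_num. Qed.

End one_density.
End moments.

(** * Double integrals of powers *)

Section pair_forms.
Context {R : realType} {N : nat}.
Local Notation mu := (@lebesgueN R N).
Implicit Types (h k f : vec R N -> R) (t p m : R).

Definition powf p (s : R) : R := s `^ p.
Lemma powf_ge0 p s : 0 <= powf p s. Proof. exact: powR_ge0. Qed.

Lemma dint_ext (F G : R -> R) h1 h2 : (forall s, 0 <= s -> F s = G s) -> dint F h1 h2 = dint G h1 h2.
Proof.
move=> FG; apply: eq_integral => x _; apply: eq_integral => y _.
by rewrite FG// sq_ge0.
Qed.

(** [|x - y| <= 2 max (|x|, |y|)]. *)
Lemma sq_sub_powR p (x y : vec R N) : 0 <= p ->
  sq (vsub x y) `^ p <= 4 `^ p * (sq x `^ p + sq y `^ p).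
Proof.
move=> p0.
have h : sq (vsub x y) <= 4 * Num.max (sq x) (sq y).
  have := sq_ge0 (vadd x y); rewrite sqD sqB => h1.
  have h2 : sq x <= Num.max (sq x) (sq y) by rewrite le_max lexx.
  have h3 : sq y <= Num.max (sq x) (sq y) by rewrite le_max lexx orbT.
  lra.
have m0 : 0 <= Num.max (sq x) (sq y) by rewrite le_max sq_ge0.
apply: (@le_trans _ _ ((4 * Num.max (sq x) (sq y)) `^ p)).
  by apply: ge0_ler_powR; rewrite ?nnegrE ?sq_ge0// mulr_ge0.
rewrite powRM// ler_wpM2l ?powR_ge0//.
have [_|_] := leP (sq x) (sq y); first by rewrite lerDr powR_ge0.
by rewrite lerDl powR_ge0.
Qed.

Section two_densities.
Variables (p m : R) (h1 h2 : vec R N -> R).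
Hypotheses (hp : 1 <= p) (d1 : mdens p m h1) (d2 : mdens p m h2).

Let n1 : nneg_mfun h1 := md_nn d1.
Let n2 : nneg_mfun h2 := md_nn d2.

(** Expanding the square, the cross term vanishes because [h2] is centered. The
    absolute value only serves to make the kernel nonnegative on the whole line. *)
Lemma dint_sq : centered h2 ->
  dint (fun s => `|s|) h1 h2 = (m * (second_moment h1 + second_moment h2))%:E.
Proof.
move=> c2.
have inner x : (\int[mu]_y (`|sq (vsub x y)| * h1 x * h2 y)%:E =
    ((m * sq x + second_moment h2) * h1 x)%:E)%E.
  rewrite (eq_integral (fun y => ((h1 x * (sq x + (- 2 * dot y x + sq y))) * h2 y)%:E)); last first.
    move=> y _; rewrite (ger0_norm (sq_ge0 _)) sqB (dotC x y); congr (_%:E); ring.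
  have i1 := wintegrable_cst d2 (sq x).
  have i2 := wintegrableZ (- 2) (wintegrable_dot hp d2 x).
  have i3 := wintegrable_sq hp d2.
  have i4 := wintegrableD i2 i3.
  rewrite (wint_EFin (F := fun y => h1 x * (sq x + (- 2 * dot y x + sq y)))); last first.
    exact: wintegrableZ (wintegrableD i1 i4).
  rewrite (wintZ _ (wintegrableD i1 i4)) (wintD i1 i4) (wintD i2 i3).
  rewrite (wintZ _ (wintegrable_dot hp d2 x)) c2 (wint_cst d2) mulr0 add0r.
  by congr (_%:E); rewrite /second_moment; ring.
rewrite /dint (eq_integral _ _ (fun x _ => inner x)).
have i1 := wintegrable_cst d1 (second_moment h2).
have i2 := wintegrableZ m (wintegrable_sq hp d1).
rewrite (wint_EFin (F := fun x => m * sq x + second_moment h2)); last exact: wintegrableD.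
rewrite (wintD i2 i1) (wintZ _ (wintegrable_sq hp d1)) (wint_cst d1).
by congr (_%:E); rewrite /second_moment; ring.
Qed.

Lemma measurable_powp : measurable_fun setT (powf p).
Proof. exact: measurable_powR. Qed.

(** Separates the Gaussian from the affine part, with all terms nonnegative so
    that the integrals can be split before their finiteness is known. *)
Lemma mixw_split u s : 0 <= s ->
  mixw p s u + expR (p * u) = expR (p * u) * gk (expR (- u)) s + expR (p * u) * expR (- u) * `|s|.
Proof. by move=> s0; rewrite /mixw /phi /gk (ger0_norm s0); ring. Qed.

(** For centered densities of mass [m] the affine part of the kernel contributes
    explicit quantities. *)
Lemma dint_mixw u : centered h2 ->
  (dint (fun s => mixw p s u) h1 h2 + (expR (p * u) * m ^+ 2)%:E =
   (expR (p * u))%:E * dint (gk (expR (- u))) h1 h2 +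
   (expR (p * u) * expR (- u) * (m * (second_moment h1 + second_moment h2)))%:E)%E.
Proof.
move=> c2.
have mw : measurable_fun setT (fun s => mixw p s u) by exact: measurable_mixw.
have w0 s : 0 <= mixw p s u by exact: mixw_ge0.
have e0 : 0 <= expR (p * u) by exact: expR_ge0.
have ee0 : 0 <= expR (p * u) * expR (- u) by rewrite mulr_ge0 ?expR_ge0.
have mn : measurable_fun setT (fun s : R => `|s|) by exact: normr_measurable.
have mg := measurable_gk (expR (- u)); have g0 := gk_ge0 (expR (- u)).
have -> : (expR (p * u) * m ^+ 2)%:E = dint (fun=> expR (p * u)) h1 h2.
  rewrite (dint_cst n1 n2 e0) (md_mass d1) (md_mass d2) -!EFinM.
  by congr (_%:E); ring.
rewrite -(dintD n1 n2 mw w0 (measurable_cst _) (fun=> e0)).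
rewrite EFinM -(dint_sq c2) -(dintZ n1 n2 e0 mg g0) -(dintZ n1 n2 ee0 mn (fun s => normr_ge0 s)).
have mA : measurable_fun setT (fun s => expR (p * u) * gk (expR (- u)) s) by exact: measurable_funM.
have A0 s : 0 <= expR (p * u) * gk (expR (- u)) s by exact: mulr_ge0.
have mB : measurable_fun setT (fun s : R => expR (p * u) * expR (- u) * `|s|) by exact: measurable_funM.
have B0 (s : R) : 0 <= expR (p * u) * expR (- u) * `|s| by exact: mulr_ge0.
rewrite -(dintD n1 n2 mA A0 mB B0).
by apply: dint_ext => s s0; exact: mixw_split.
Qed.

Lemma dint_gk_fin t : 0 <= t -> (dint (gk t) h1 h2 < +oo)%E.
Proof.
move=> t0; apply: (@le_lt_trans _ _ (dint (fun=> 1%R) h1 h2)).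
  apply: (dint_le n1 n2) => //; [exact: measurable_gk|exact: gk_ge0|].
  by move=> s s0; rewrite /gk expR_le1 oppr_le0 mulr_ge0.
by rewrite (dint_cst n1 n2 ler01) (md_mass d1) (md_mass d2) -!EFinM ltry.
Qed.

(** Tonelli, with the mixture formula [mixw_scale] for the kernel. *)
Lemma dint_pow_mix : (mixc p * dint (powf p) h1 h2 =
  \int[@lebesgue_measure R]_u dint (fun s => mixw p s u) h1 h2)%E.
Proof.
have p0 : 0 < p by apply: lt_le_trans hp.
have c0 : (0 <= mixc p)%E by apply: ltW; exact: mixc_gt0.
have [[m1 p1] [m2 p2]] := (n1, n2).
have w0 (s u : R) : 0 <= mixw p s u by exact: mixw_ge0.
have mm d (T : measurableType d) (u : T -> R) (x y : T -> vec R N) :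
    measurable_fun setT u -> measurable_fun setT x -> measurable_fun setT y ->
    measurable_fun setT (fun q => (mixw p (sq (vsub (x q) (y q))) (u q) * h1 (x q) * h2 (y q))%:E).
  move=> mu' mx my; apply/measurable_EFinP; apply: measurable_funM; last exact: (measurableT_comp m2 my).
  apply: measurable_funM; last exact: (measurableT_comp m1 mx).
  by apply: measurable_mixw => //; apply: mfun_sq; exact: mfun_vsub.
have pos (u : R) x y : (0 <= (mixw p (sq (vsub x y)) u * h1 x * h2 y)%:E)%E.
  by rewrite lee_fin; apply: mulr_ge0 => //; apply: mulr_ge0.
rewrite /dint -ge0_integralZl; [|exact: measurableT|exact: (dint_outer_meas n1 n2 measurable_powp (powf_ge0 p))| |exact: c0]; last first.
  by move=> x _; apply: integral_ge0 => y _; exact: (dint_integrand_ge0 (F := powf p) n1 n2 _ _ (powf_ge0 p)).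
transitivity (\int[mu]_x \int[@lebesgue_measure R]_u \int[mu]_y (mixw p (sq (vsub x y)) u * h1 x * h2 y)%:E)%E.
  apply: eq_integral => x _.
  rewrite -(@tonelli _ _ _ _ _ mu (@lebesgue_measure R)
     (fun y u => (mixw p (sq (vsub x y)) u * h1 x * h2 y)%:E)); last 2 first.
  - by apply: (mm _ _ (fun q => q.2) (fun=> x) (fun q => q.1)); [exact: measurable_snd|exact: measurable_cst|exact: measurable_fst].
  - by move=> y u; exact: pos.
  rewrite -ge0_integralZl; [|exact: measurableT| | |exact: c0]; last 2 first.
  - by apply: (@dint_inner_meas R N _ _ _ (powf p)); [exact: n2|exact: measurable_powp].
  - move=> y _; exact: (dint_integrand_ge0 (F := powf p) n1 n2 _ _ (powf_ge0 p)).
  apply: eq_integral => y _.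
  rewrite (eq_integral (fun u : measurableTypeR R => (h1 x * h2 y)%:E * (mixw p (sq (vsub x y)) u)%:E)%E); last first.
    by move=> u _; rewrite -EFinM; congr (_%:E); ring.
  rewrite ge0_integralZl_EFin; [|exact: measurableT|by move=> u _; rewrite lee_fin| |by rewrite mulr_ge0].
    rewrite (mixw_scale (sq_ge0 _) p0) muleA -EFinM [LHS]muleC; congr (_%:E * _)%E; rewrite /powf; ring.
  by apply/measurable_EFinP; exact: measurable_mixw.
apply: (@tonelli _ _ _ _ _ mu (@lebesgue_measure R)
   (fun x u => \int[mu]_y (mixw p (sq (vsub x y)) u * h1 x * h2 y)%:E)%E).
  apply: (@measurable_inner _ _ _ _ R mu
    (fun (q : vec R N * measurableTypeR R) y => (mixw p (sq (vsub q.1 y)) q.2 * h1 q.1 * h2 y)%:E)).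
    by apply: (mm _ _ (fun q => q.1.2) (fun q => q.1.1) (fun q => q.2));
      [exact: (measurableT_comp measurable_snd)|exact: (measurableT_comp measurable_fst)|exact: measurable_snd].
  by move=> q y; exact: pos.
by move=> x u; apply: integral_ge0 => y _; exact: pos.
Qed.

Lemma dint_mixw_meas : measurable_fun setT (fun u : measurableTypeR R => dint (fun s => mixw p s u) h1 h2).
Proof.
have [[m1 p1] [m2 p2]] := (n1, n2).
have w0 (s u : R) : 0 <= mixw p s u by exact: mixw_ge0.
apply: (@measurable_inner _ _ _ _ R mu
    (fun (u : measurableTypeR R) x => \int[mu]_y (mixw p (sq (vsub x y)) u * h1 x * h2 y)%:E)%E).
  apply: (@measurable_inner _ _ _ _ R mu
    (fun (q : measurableTypeR R * vec R N) y => (mixw p (sq (vsub q.2 y)) q.1 * h1 q.2 * h2 y)%:E)).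
    apply/measurable_EFinP; apply: measurable_funM; last exact: (measurableT_comp m2).
    apply: measurable_funM; last by apply: (measurableT_comp m1); apply: measurableT_comp.
    apply: measurable_mixw; last exact: (measurableT_comp measurable_fst).
    by apply: mfun_sq; apply: mfun_vsub => //; apply: (measurableT_comp measurable_snd).
  by move=> q y; rewrite lee_fin; apply: mulr_ge0 => //; apply: mulr_ge0.
by move=> u x; apply: integral_ge0 => y _; rewrite lee_fin; apply: mulr_ge0 => //; apply: mulr_ge0.
Qed.

Lemma dint_mixw_ge0 u : (0 <= dint (fun s => mixw p s u) h1 h2)%E.
Proof. by apply: dint_ge0 => // s; exact: mixw_ge0. Qed.

End two_densities.
End pair_forms.

(** * Positivity of the power form *)

Section psd.
Context {R : realType} {N : nat}.
Local Notation mu := (@lebesgueN R N).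
Implicit Types (h k f : vec R N -> R) (t p m : R).

(** By [dint_mixw] the affine part contributes, up to positive factors, [- m^2]
    and the sum of the second moments, which cancel between the two sides; the
    Gaussian part is [gauss_form_psd]. *)
Lemma mixw_form_psd p m k f u : 1 <= p -> mdens p m k -> mdens p m f ->
  centered k -> centered f ->
  (2%:E * dint (fun s => mixw p s u) k f <=
   dint (fun s => mixw p s u) k k + dint (fun s => mixw p s u) f f)%E.
Proof.
move=> hp dk df ck cf.
have nk := md_nn dk; have nf := md_nn df.
have t0 : 0 < expR (- u) :> R by exact: expR_gt0.
have e0 : 0 < expR (p * u) by exact: expR_gt0.
have fk : (\int[mu]_x (k x)%:E < +oo)%E by rewrite (md_mass dk) ltry.
have ff : (\int[mu]_x (f x)%:E < +oo)%E by rewrite (md_mass df) ltry.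
have G := gauss_form_psd t0 nk nf fk ff.
have fin h1 h2 : mdens p m h1 -> mdens p m h2 -> centered h2 ->
   exists B C : R, [/\ dint (fun s => mixw p s u) h1 h2 = B%:E, dint (gk (expR (- u))) h1 h2 = C%:E &
     B + expR (p * u) * m ^+ 2 = expR (p * u) * C + expR (p * u) * expR (- u) * (m * (second_moment h1 + second_moment h2))].
  move=> d1 d2 c2.
  have E := dint_mixw hp d1 d2 u c2.
  have g0 : (0 <= dint (gk (expR (- u))) h1 h2)%E.
    by apply: (dint_ge0 (md_nn d1) (md_nn d2)); exact: gk_ge0.
  have b0 : (0 <= dint (fun s => mixw p s u) h1 h2)%E by exact: dint_mixw_ge0 d1 d2 u.
  have gf := dint_gk_fin d1 d2 (ltW t0).
  move: E g0 b0 gf.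
  case: (dint (gk _) h1 h2) => [C| |]//; case: (dint _ h1 h2) => [B| |]// E _ _ _.
  by exists B, C; split => //; case: E.
have [B1 [C1 [E1 F1 H1]]] := fin _ _ dk df cf.
have [B2 [C2 [E2 F2 H2]]] := fin _ _ dk dk ck.
have [B3 [C3 [E3 F3 H3]]] := fin _ _ df df cf.
rewrite E1 E2 E3 -EFinM -EFinD lee_fin.
move: G; rewrite F1 F2 F3 -EFinM -EFinD lee_fin => G.
have := ler_wpM2l (ltW e0) G; lra.
Qed.

(** Integrates [mixw_form_psd] over the mixture. *)
Lemma power_form_psd p m k f : 1 < p < 2 -> mdens p m k -> mdens p m f ->
  centered k -> centered f ->
  (2%:E * dint (powf p) k f <= dint (powf p) k k + dint (powf p) f f)%E.
Proof.
move=> p12 dk df ck cf.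
have hp : 1 <= p by move: p12 => /andP[/ltW].
have nk := md_nn dk; have nf := md_nn df.
have c0 := mixc_gt0 p; have c1 := mixc_fin p12.
have cf' : mixc p \is a fin_num by rewrite ge0_fin_numE// ltW.
have d0 h1 h2 : nneg_mfun h1 -> nneg_mfun h2 -> (0 <= dint (powf p) h1 h2)%E.
  by move=> n1 n2; apply: (dint_ge0 n1 n2); exact: powf_ge0.
rewrite -(lee_pmul2l cf' c0) (ge0_muleDr _ (d0 _ _ nk nk) (d0 _ _ nf nf)) muleCA.
rewrite (dint_pow_mix hp dk df) (dint_pow_mix hp dk dk) (dint_pow_mix hp df df).
have mkk := dint_mixw_meas dk dk; have mff := dint_mixw_meas df df; have mkf := dint_mixw_meas dk df.
have pkk := dint_mixw_ge0 dk dk; have pff := dint_mixw_ge0 df df; have pkf := dint_mixw_ge0 dk df.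
rewrite -ge0_integralZl_EFin; [|exact: measurableT|by move=> u _; exact: pkf|exact: mkf|by []].
rewrite -ge0_integralD; [|exact: measurableT|by move=> u _; exact: pkk|exact: mkk|by move=> u _; exact: pff|exact: mff].
apply: ge0_le_integral; [exact: measurableT|by move=> u _; apply: mule_ge0 => //; exact: pkf| | |].
- by apply: measurable_funeM; exact: mkf.
- by apply: emeasurable_funD; [exact: mkk|exact: mff].
- by move=> u _; exact: (mixw_form_psd u hp dk df ck cf).
Qed.

End psd.

(** * The energy of a density *)

Section potentials_of_densities.
Context {R : realType} {N : nat}.
Local Notation mu := (@lebesgueN R N).
Implicit Types (h k f : vec R N -> R) (F : R -> R) (t p m : R).

(** Growth of order at most [p] in [|x|^2], which the moments of a density
    control. *)
Definition growth p F := [/\ measurable_fun setT F, forall s, 0 <= F s &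
  exists2 C : R, 0 <= C & forall s, 0 <= s -> F s <= C * (1 + s `^ p)].

(** The potential of the density [h]. *)
Definition wpot F h x : R := wint h (fun y => F (sq (vsub x y))).

Section one.
Variables (p m : R) (F : R -> R) (h : vec R N -> R).
Hypotheses (hp : 1 <= p) (gF : growth p F) (dh : mdens p m h).

Lemma growth_shift : exists2 C : R, 0 <= C & forall x y : vec R N,
  F (sq (vsub x y)) <= C * (1 + sq x `^ p) * (1 + sq y `^ p).
Proof.
have [mF F0 [C C0 FC]] := gF.
have p0 : 0 <= p by apply: le_trans hp.
exists (C * 4 `^ p); first by rewrite mulr_ge0 ?powR_ge0.
move=> x y; apply: (le_trans (FC _ (sq_ge0 _))).
rewrite -!mulrA ler_wpM2l//.
have h1 := sq_sub_powR x y p0.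
have h4 : 1 <= 4 `^ p :> R.
  have le14 : 1 <= 4 :> R by lra.
  by have := ler_powR le14 p0; rewrite powRr0.
have := powR_ge0 (sq x) p; have := powR_ge0 (sq y) p.
move: (sq x `^ p) (sq y `^ p) (4 `^ p) (sq (vsub x y) `^ p) h1 h4 => a b c e h1 h4 b0 a0.
have ab : 0 <= a * b by exact: mulr_ge0.
have := ler_wpM2r ab h4; nra.
Qed.

Lemma measurable_growth_sub (x : vec R N) : measurable_fun setT (fun y => F (sq (vsub x y))).
Proof.
by have [mF _ _] := gF; apply: (measurableT_comp mF); apply: mfun_sq; exact: mfun_vsub.
Qed.

Lemma wintegrable_growth x : wintegrable h (fun y => F (sq (vsub x y))).
Proof.
have [C C0 hC] := growth_shift; have [mF F0 _] := gF.
apply: (wintegrable_bound dh (C := C * (1 + sq x `^ p))); first exact: measurable_growth_sub.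
  by rewrite mulr_ge0// addr_ge0// powR_ge0.
by move=> y; rewrite ger0_norm.
Qed.

Lemma wpot_ge0 x : 0 <= wpot F h x.
Proof.
have [_ F0 _] := gF; apply: Rintegral_ge0 => y _.
by rewrite mulr_ge0// (proj2 (md_nn dh)).
Qed.

Lemma wpot_meas : measurable_fun setT (wpot F h).
Proof.
have [mF F0 _] := gF; have [mh h0] := md_nn dh.
have H : measurable_fun setT (fun x : vec R N => \int[mu]_y (F (sq (vsub x y)) * h y)%:E)%E.
  apply: (@measurable_inner _ _ _ _ R mu (fun x y : vec R N => (F (sq (vsub x y)) * h y)%:E)).
    apply/measurable_EFinP; apply: measurable_funM; last exact: (measurableT_comp mh).
    by apply: (measurableT_comp mF); apply: mfun_sq; exact: mfun_vsub.
  by move=> x y; rewrite lee_fin mulr_ge0.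
by apply: (measurableT_comp (fine_measurable measurableT) H).
Qed.

Lemma wpot_growth : exists2 C : R, 0 <= C & forall x, wpot F h x <= C * (1 + sq x `^ p).
Proof.
have [C C0 hC] := growth_shift; have [mF F0 _] := gF; have [mh h0] := md_nn dh.
have j1 := wintegrable_cst dh 1; have j2 := wintegrable_pow dh.
have M0 : 0 <= m + wint h (fun y => sq y `^ p).
  rewrite addr_ge0//; last by apply: Rintegral_ge0 => y _; rewrite mulr_ge0 ?powR_ge0.
  rewrite -[m]mul1r -(wint_cst dh); apply: Rintegral_ge0 => y _; exact: mulr_ge0.
exists (C * (m + wint h (fun y => sq y `^ p))); first exact: mulr_ge0.
move=> x.
have -> : C * (m + wint h (fun y => sq y `^ p)) * (1 + sq x `^ p) =
    wint h (fun y => C * (1 + sq x `^ p) * (1 + sq y `^ p)).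
  by rewrite (wintZ _ (wintegrableD j1 j2)) (wintD j1 j2) (wint_cst dh); ring.
apply: le_Rintegral => //; [exact: wintegrable_growth|exact: (wintegrableZ _ (wintegrableD j1 j2))|].
by move=> y _; rewrite ler_wpM2r.
Qed.

End one.

Section two.
Variables (p m : R) (F : R -> R) (h1 h2 : vec R N -> R).
Hypotheses (hp : 1 <= p) (gF : growth p F) (d1 : mdens p m h1) (d2 : mdens p m h2).

Lemma wintegrable_wpot : wintegrable h1 (wpot F h2).
Proof.
have [C C0 hC] := wpot_growth hp gF d2.
apply: (wintegrable_bound d1 (C := C)); [exact: wpot_meas gF d2|exact: C0|].
by move=> x; rewrite ger0_norm ?hC// (wpot_ge0 gF d2).
Qed.

Lemma dint_wpot : dint F h1 h2 = (wint h1 (wpot F h2))%:E.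
Proof.
rewrite -(wint_EFin wintegrable_wpot); apply: eq_integral => x _.
have iF := wintegrable_growth hp gF d2 x.
rewrite mulrC /wpot -(wintZ _ iF) -(wint_EFin (wintegrableZ (h1 x) iF)).
by apply: eq_integral => y _; congr (_%:E); ring.
Qed.
End two.

Lemma growth_powf p : 1 <= p -> growth p (powf p).
Proof.
move=> p1; split; [exact: measurable_powp|exact: powf_ge0|exists 1 => // s s0].
by rewrite mul1r lerDr.
Qed.

Lemma growth_norm p : 1 <= p -> growth p (fun s => `|s|).
Proof.
move=> p1; split; [exact: normr_measurable|by move=> s; exact: normr_ge0|exists 1 => // s s0].
by rewrite mul1r ger0_norm// le_powR1.
Qed.

Lemma kernelE (p : R) (z : vec R N) :
  kernel_g (2 * p) 2 z = (2 * p)^-1 * powf p (sq z) + (- 2^-1) * `|sq z|.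
Proof.
rewrite /kernel_g enormE (ger0_norm (sq_ge0 z)) -(powR12_sqrt (sq_ge0 z)) -!powRrM.
rewrite mulrA mulVf// mul1r powRr1 ?sq_ge0//.
by rewrite /powf mulrC mulNr (mulrC _ (sq z)).
Qed.

Lemma energy_mdens p m h : 1 <= p -> mdens p m h ->
  energy (2 * p) 2 h = ((2 * p)^-1 * wint h (wpot (powf p) h) - 2^-1 * wint h (wpot (fun s => `|s|) h))%:E.
Proof.
move=> p1 dh.
have g1 := growth_powf p1; have g2 := growth_norm p1.
have i1 := wintegrable_wpot p1 g1 dh dh; have i2 := wintegrable_wpot p1 g2 dh dh.
have i := wintegrableD (wintegrableZ (2 * p)^-1 i1) (wintegrableZ (- 2^-1) i2).
have -> : (2 * p)^-1 * wint h (wpot (powf p) h) - 2^-1 * wint h (wpot (fun s => `|s|) h) =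
   wint h (fun x => (2 * p)^-1 * wpot (powf p) h x + (- 2^-1) * wpot (fun s => `|s|) h x).
  by rewrite (wintD (wintegrableZ _ i1) (wintegrableZ _ i2)) (wintZ _ i1) (wintZ _ i2) mulNr.
rewrite -(wint_EFin i); apply: eq_integral => x _.
have j1 := wintegrable_growth p1 g1 dh x; have j2 := wintegrable_growth p1 g2 dh x.
have j := wintegrableD (wintegrableZ (2 * p)^-1 j1) (wintegrableZ (- 2^-1) j2).
rewrite (eq_integral (fun y => (h x * ((2 * p)^-1 * powf p (sq (vsub x y))
    + (- 2^-1) * `|sq (vsub x y)|) * h y)%:E)); last first.
  by move=> y _; rewrite kernelE; congr (_%:E); ring.
rewrite (wint_EFin (wintegrableZ (h x) j)) (wintZ _ j) (wintD (wintegrableZ _ j1) (wintegrableZ _ j2)).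
by rewrite (wintZ _ j1) (wintZ _ j2) mulrC.
Qed.

(** [dint_sq] evaluates the quadratic part. *)
Lemma energy_centered p m h : 1 <= p -> mdens p m h -> centered h ->
  energy (2 * p) 2 h = ((2 * p)^-1 * wint h (wpot (powf p) h) - m * second_moment h)%:E.
Proof.
move=> p1 dh ch; rewrite (energy_mdens p1 dh); congr (_%:E); congr (_ - _).
have := dint_sq p1 dh dh ch; rewrite (dint_wpot p1 (growth_norm p1) dh dh) => -[->].
by field.
Qed.

End potentials_of_densities.

(** * Invariance of the energy and densities of finite energy *)

Section signed_integrals.
Local Open Scope ereal_scope.

Lemma preserves_integral_signed d (T : measurableType d) (R : realType)
  (mu : {measure set T -> \bar R}) (phi : T -> T) (f : T -> \bar R) :
  preserves mu phi -> measurable_fun setT f -> \int[mu]_x f (phi x) = \int[mu]_x f x.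
Proof.
move=> Hphi mf; rewrite integralE [RHS]integralE.
rewrite -(preserves_integral Hphi (f := f^\+)); last 2 first.
- exact: measurable_funepos.
- by move=> x; exact: funepos_ge0.
rewrite -(preserves_integral Hphi (f := f^\-)); last 2 first.
- exact: measurable_funeneg.
- by move=> x; exact: funeneg_ge0.
by congr (_ - _); apply: eq_integral => x _; rewrite ?funeposE ?funenegE.
Qed.

(** The inner integral of a function of variable sign is the difference of the
    inner integrals of its positive and negative parts, also where it is
    infinite. *)
Lemma measurable_inner_signed d1 d2 (T1 : measurableType d1) (T2 : measurableType d2) (R : realType)
  (m2 : {sigma_finite_measure set T2 -> \bar R}) (f : T1 -> T2 -> \bar R) :
  measurable_fun setT (fun z : T1 * T2 => f z.1 z.2) ->
  measurable_fun setT (fun x => \int[m2]_y f x y).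
Proof.
move=> mf.
have -> : (fun x => \int[m2]_y f x y) =
   (fun x => \int[m2]_y (f x)^\+ y - \int[m2]_y (f x)^\- y).
  by apply/funext => x; rewrite integralE.
apply: emeasurable_funB.
  apply: (@measurable_inner _ _ _ _ R m2 (fun x y => (f x)^\+ y)).
    rewrite (_ : (fun z => _) = (fun z : T1 * T2 => f z.1 z.2)^\+); first exact: measurable_funepos.
    by apply/funext => z; rewrite !funeposE.
  by move=> x y; exact: funepos_ge0.
apply: (@measurable_inner _ _ _ _ R m2 (fun x y => (f x)^\- y)).
  rewrite (_ : (fun z => _) = (fun z : T1 * T2 => f z.1 z.2)^\-); first exact: measurable_funeneg.
  by apply/funext => z; rewrite !funenegE.
by move=> x y; exact: funeneg_ge0.
Qed.

End signed_integrals.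

Section energy_invariance.
Context {R : realType} {N : nat}.
Local Notation mu := (@lebesgueN R N).
Implicit Types (h k f : vec R N -> R) (t p m : R).
Variables (al be : R).

Lemma measurable_kernel : measurable_fun setT (kernel_g al be : vec R N -> R).
Proof.
have me : measurable_fun setT (fun x : vec R N => enorm x) by exact: mfun_enorm.
apply: measurable_funB; apply: measurable_funM => //;
  by apply: (measurableT_comp (measurable_powR _)).
Qed.

Lemma measurable_energy d (T : measurableType d) h1 h2 (u v : T -> vec R N) :
  measurable_fun setT h1 -> measurable_fun setT h2 ->
  measurable_fun setT u -> measurable_fun setT v ->
  measurable_fun setT (fun z => (kernel_g al be (vsub (u z) (v z)) * h1 (u z) * h2 (v z))%:E).
Proof.
move=> m1 m2 mu' mv; apply/measurable_EFinP.
apply: measurable_funM; last exact: (measurableT_comp m2 mv).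
apply: measurable_funM; last exact: (measurableT_comp m1 mu').
by apply: (measurableT_comp measurable_kernel); exact: mfun_vsub.
Qed.

(** Changing a density on a null set changes the inner integrals nowhere and the
    outer integrand on a null set. *)
Lemma energy_ae h k : measurable_fun setT h -> measurable_fun setT k ->
  ae_eq mu setT h k -> energy al be h = energy al be k.
Proof.
move=> mh mk hk; rewrite /energy.
transitivity (\int[mu]_x \int[mu]_y ((kernel_g al be (vsub x y) * h x * k y)%:E))%E.
  apply: eq_integral => x _; apply: ae_eq_integral => //.
  - by apply: (measurable_energy (u := fun=> x) (v := id)).
  - by apply: (measurable_energy (u := fun=> x) (v := id)).
  by apply: filterS hk => y hy /hy ->.
apply: ae_eq_integral => //.
- apply: (@measurable_inner_signed _ _ _ _ R mu (fun x y => (kernel_g al be (vsub x y) * h x * k y)%:E)).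
  by apply: (measurable_energy mh mk); [exact: measurable_fst|exact: measurable_snd].
- apply: (@measurable_inner_signed _ _ _ _ R mu (fun x y => (kernel_g al be (vsub x y) * k x * k y)%:E)).
  by apply: (measurable_energy mk mk); [exact: measurable_fst|exact: measurable_snd].
by apply: filterS hk => x hx /hx ->.
Qed.

Lemma sub_shift_preserves (a : vec R N) : preserves mu (fun x => vsub x a).
Proof.
have -> : (fun x => vsub x a) = (fun x => vadd x (vscale (-1) a)).
  by apply/funext => x; apply: vecP => i; rewrite !cosE; ring.
exact: shift_preserves.
Qed.

Lemma measurable_translate a h : measurable_fun setT h -> measurable_fun setT (translate a h).
Proof. by move=> mh; apply: (measurableT_comp mh); exact: mfun_vsub. Qed.

Lemma energy_translate a h : measurable_fun setT h -> energy al be (translate a h) = energy al be h.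
Proof.
move=> mh; rewrite /energy.
have E (x y : vec R N) : vsub (vsub x a) (vsub y a) = vsub x y.
  by apply: vecP => i; rewrite !cosE; ring.
have mi : measurable_fun setT (fun x => \int[mu]_y (kernel_g al be (vsub x y) * h x * h y)%:E)%E.
  apply: (@measurable_inner_signed _ _ _ _ R mu (fun x y => (kernel_g al be (vsub x y) * h x * h y)%:E)).
  by apply: (measurable_energy mh mh); [exact: measurable_fst|exact: measurable_snd].
rewrite -[RHS](preserves_integral_signed (sub_shift_preserves a) mi).
apply: eq_integral => x _.
have mx : measurable_fun setT (fun y => (kernel_g al be (vsub (vsub x a) y) * h (vsub x a) * h y)%:E).
  by apply: (measurable_energy (u := fun=> vsub x a) (v := id)).
rewrite -[RHS](preserves_integral_signed (sub_shift_preserves a) mx).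
by apply: eq_integral => y _; rewrite E.
Qed.

End energy_invariance.

Section finite_energy.
Context {R : realType} {N : nat}.
Local Notation mu := (@lebesgueN R N).
Implicit Types (h k f : vec R N -> R) (t m : R).
Variables (p m : R) (h : vec R N -> R).
Hypotheses (hp : 1 < p) (m0 : 0 < m) (nh : nneg_mfun h) (mass : (\int[mu]_x (h x)%:E = m%:E)%E).

(** The constant of Young's inequality [s / 2 <= s^p / (4p) + young]. *)
Definition young : R := (2 * p) `^ (p - 1)^-1 / 2.

Lemma young_ge0 : 0 <= young.
Proof. by rewrite divr_ge0 ?powR_ge0. Qed.

(** If [s] exceeds the threshold then [s^(p-1) >= 2p], and the power alone
    dominates; otherwise the constant does. *)
Lemma youngP (s : R) : 0 <= s -> s / 2 <= (4 * p)^-1 * s `^ p + young.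
Proof.
move=> s0; have p1 := hp.
have q0 : 0 < p - 1 by lra.
have p2 : 0 < 2 * p by lra.
have [sl|sl] := leP s ((2 * p) `^ (p - 1)^-1).
  apply: (@le_trans _ _ young); first by rewrite /young ler_pM2r.
  by rewrite lerDr mulr_ge0 ?powR_ge0// invr_ge0; lra.
have sp : 2 * p <= s `^ (p - 1).
  have -> : 2 * p = ((2 * p) `^ (p - 1)^-1) `^ (p - 1).
    by rewrite -powRrM mulVf ?gt_eqF// powRr1// ltW.
  by apply: ge0_ler_powR; rewrite ?nnegrE ?powR_ge0// ltW.
have p0 : 0 < p by lra.
rewrite -(mulr_powRB1 s0 p0).
have : (4 * p)^-1 * (s * (2 * p)) <= (4 * p)^-1 * (s * s `^ (p - 1)).
  by rewrite ler_wpM2l ?invr_ge0 ?ler_wpM2l//; lra.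
rewrite (_ : (4 * p)^-1 * (s * (2 * p)) = s / 2); last by field; lra.
have := young_ge0; lra.
Qed.

(** By [youngP], half of the growth of the kernel absorbs its negative quadratic
    part. *)
Lemma kernel_lower (z : vec R N) : (4 * p)^-1 * sq z `^ p - young <= kernel_g (2 * p) 2 z.
Proof.
rewrite kernelE /powf (ger0_norm (sq_ge0 z)).
have := youngP (sq_ge0 z).
have -> : (2 * p)^-1 = 2 * (4 * p)^-1 by have p1 := hp; field; lra.
lra.
Qed.

(** If the inner integral were infinite wherever [h] is positive, the energy
    would exceed [n] times the mass for every [n]. *)
Lemma finite_energy_point : (energy (2 * p) 2 h < +oo)%E ->
  exists2 x, 0 < h x & (\int[mu]_y (kernel_g (2 * p) 2 (vsub x y) * h x * h y)%:E < +oo)%E.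
Proof.
have [mh h0] := nh.
move=> fin; apply: contrapT => no.
have I x : (\int[mu]_y (kernel_g (2 * p) 2 (vsub x y) * h x * h y)%:E =
   if h x == 0%R then 0 else +oo)%E.
  case: ifPn => [/eqP hx|hx].
    by rewrite integral0_eq// => y _; rewrite hx mulr0 mul0r.
  have hx0 : 0 < h x by rewrite lt_neqAle eq_sym hx h0.
  apply: contrapT => nI; apply: no; exists x => //.
  by rewrite ltey; apply/eqP.
have key (n : R) : 0 <= n -> ((n * m)%:E <= energy (2 * p) 2 h)%E.
  move=> n0; rewrite EFinM -mass -ge0_integralZl_EFin//; last 2 first.
  - by move=> x _; rewrite lee_fin.
  - exact/measurable_EFinP.
  apply: ge0_le_integral => //.
  - by move=> x _; rewrite -EFinM lee_fin mulr_ge0.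
  - by apply: measurable_funeM; exact/measurable_EFinP.
  - apply: (@measurable_inner_signed _ _ _ _ R mu (fun x y => (kernel_g (2 * p) 2 (vsub x y) * h x * h y)%:E)).
    by apply: (measurable_energy _ _ mh mh); [exact: measurable_fst|exact: measurable_snd].
  move=> x _; rewrite I; case: ifPn => [/eqP->|_]; first by rewrite mule0.
  by rewrite leey.
move: fin key; case: (energy _ _ _) => [r| |]// _ key.
  have := key ((`|r| + 1) / m); rewrite divr_ge0 ?addr_ge0 ?(ltW m0)// => /(_ erefl).
  rewrite divfK ?gt_eqF// lee_fin; have := ler_norm r; lra.
by have := key 0 (lexx _); rewrite mul0r.
Qed.

(** At the point given by [finite_energy_point] the inner integral is finite; by
    [kernel_lower] it dominates the moment of order [2p] of [h] around that
    point. *)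
Lemma finite_energy_mdens : (energy (2 * p) 2 h < +oo)%E -> mdens p m h.
Proof.
move=> /finite_energy_point[x0 hx0 fin]; have [mh h0] := nh.
have p1 := hp; have p0 : 0 < p by lra.
split => //.
(* the negative part of f is at most young * h x0 * h, so the integral of its
   positive part is finite too *)
pose f y := (kernel_g (2 * p) 2 (vsub x0 y) * h x0 * h y)%:E.
have mf : measurable_fun setT f.
  by apply: (measurable_energy _ _ (u := fun=> x0) (v := id)).
have Y0 := young_ge0.
have mhE : measurable_fun setT (fun y => (h y)%:E) by exact/measurable_EFinP.
have pw0 y : 0 <= (4 * p)^-1 * sq (vsub x0 y) `^ p.
  by rewrite mulr_ge0 ?powR_ge0// invr_ge0; lra.
have c0 : 0 <= young * h x0 by rewrite mulr_ge0 ?(ltW hx0).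
have fneg y : (f^\- y <= (young * h x0)%:E * (h y)%:E)%E.
  rewrite funenegE ge_max -EFinM !lee_fin mulr_ge0// andbT.
  have hh : 0 <= h x0 * h y by rewrite mulr_ge0// ltW.
  have kl : 0 <= kernel_g (2 * p) 2 (vsub x0 y) + young.
    by have := kernel_lower (vsub x0 y); have := pw0 y; lra.
  rewrite -subr_ge0 (_ : _ - _ = (kernel_g (2 * p) 2 (vsub x0 y) + young) * (h x0 * h y)).
    exact: mulr_ge0.
  by ring.
have intneg : (\int[mu]_y f^\- y < +oo)%E.
  apply: (@le_lt_trans _ _ (\int[mu]_y ((young * h x0)%:E * (h y)%:E))%E).
    apply: ge0_le_integral => //.
    - exact: measurable_funeneg.
    - exact: measurable_funeM.
  rewrite ge0_integralZl_EFin//; last by move=> y _; rewrite lee_fin.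
  by rewrite mass -EFinM ltry.
have intpos : (\int[mu]_y f^\+ y < +oo)%E.
  move: fin; rewrite -/f integralE.
  have : (0 <= \int[mu]_y f^\- y)%E by apply: integral_ge0 => y _; exact: funeneg_ge0.
  move: intneg; case: (\int[mu]_y f^\- y)%E => // r _ _.
  by case: (\int[mu]_y f^\+ y)%E => [s||]//; rewrite ?ltry ?ltNyr.
have bnd y : ((sq y `^ p * h y)%:E <= (4 `^ p * (4 * p) / h x0)%:E * f^\+ y +
    (4 `^ p * (4 * p * young + sq x0 `^ p))%:E * (h y)%:E)%E.
  have fp : (f y <= f^\+ y)%E by rewrite funeposE le_max lexx.
  have fp0 : (0 <= f^\+ y)%E by exact: funepos_ge0.
  have k0 : 0 <= 4 `^ p * (4 * p) / h x0.
    by rewrite divr_ge0 ?(ltW hx0)// mulr_ge0 ?powR_ge0//; lra.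
  apply: (@le_trans _ _ ((4 `^ p * (4 * p) / h x0)%:E * f y +
    (4 `^ p * (4 * p * young + sq x0 `^ p))%:E * (h y)%:E)%E); last first.
    by rewrite leeD2r// lee_wpmul2l// lee_fin.
  rewrite -!EFinM -EFinD lee_fin.
  have s1 : sq y `^ p <= 4 `^ p * (sq x0 `^ p + sq (vsub x0 y) `^ p).
    have -> : sq y = sq (vsub x0 (vsub x0 y)).
      by congr sq; apply: vecP => i; rewrite !cosE; ring.
    by apply: sq_sub_powR; exact: ltW.
  have s2 : sq (vsub x0 y) `^ p <= 4 * p * (kernel_g (2 * p) 2 (vsub x0 y) + young).
    have := kernel_lower (vsub x0 y) => hk.
    have p4 : 0 < 4 * p by lra.
    have : 4 * p * ((4 * p)^-1 * sq (vsub x0 y) `^ p) <= 4 * p * (kernel_g (2 * p) 2 (vsub x0 y) + young).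
      by rewrite ler_wpM2l ?(ltW p4)//; lra.
    by rewrite mulrA mulfV ?gt_eqF// mul1r.
  have -> : 4 `^ p * (4 * p) / h x0 * (kernel_g (2 * p) 2 (vsub x0 y) * h x0 * h y) +
     4 `^ p * (4 * p * young + sq x0 `^ p) * h y =
     4 `^ p * (sq x0 `^ p + 4 * p * (kernel_g (2 * p) 2 (vsub x0 y) + young)) * h y.
    by field; lra.
  rewrite ler_wpM2r//; apply: (le_trans s1).
  by rewrite ler_wpM2l ?powR_ge0// lerD2l.
have mp : measurable_fun setT (fun x : vec R N => sq x `^ p).
  by apply: (measurableT_comp (measurable_powR p)); exact: mfun_sq.
have k0 : 0 <= 4 `^ p * (4 * p) / h x0.
  by rewrite divr_ge0 ?(ltW hx0)// mulr_ge0 ?powR_ge0//; lra.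
have k1 : 0 <= 4 `^ p * (4 * p * young + sq x0 `^ p).
  by rewrite mulr_ge0 ?powR_ge0// addr_ge0 ?powR_ge0// mulr_ge0//; lra.
apply: (@le_lt_trans _ _ (\int[mu]_y ((4 `^ p * (4 * p) / h x0)%:E * f^\+ y +
    (4 `^ p * (4 * p * young + sq x0 `^ p))%:E * (h y)%:E))%E).
  apply: ge0_le_integral => //.
  - by move=> y _; rewrite lee_fin mulr_ge0 ?powR_ge0.
  - by apply/measurable_EFinP; exact: measurable_funM.
  - by apply: emeasurable_funD; apply: measurable_funeM => //; exact: measurable_funepos.
rewrite ge0_integralD//; last 4 first.
- by move=> y _; rewrite mule_ge0// lee_fin.
- by apply: measurable_funeM; exact: measurable_funepos.
- by move=> y _; rewrite mule_ge0// lee_fin.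
- exact: measurable_funeM.
rewrite ge0_integralZl_EFin//; last exact: measurable_funepos.
rewrite ge0_integralZl_EFin//; last by move=> y _; rewrite lee_fin.
rewrite mass.
have : (0 <= \int[mu]_y f^\+ y)%E by apply: integral_ge0 => y _; exact: funepos_ge0.
by move: intpos; case: (\int[mu]_y f^\+ y)%E => // r _ _; rewrite -!EFinM -EFinD ltry.
Qed.

End finite_energy.

(** * Admissible densities and centering *)

Section clamping.
Context {R : realType} {N : nat}.
Local Notation mu := (@lebesgueN R N).
Implicit Types (h k f : vec R N -> R) (m : R).

(** The bounds of an admissible density hold only almost everywhere; its
    truncation satisfies them everywhere and has the same energy. *)
Definition clamp h : vec R N -> R := fun x => Num.min 1 (Num.max 0 (h x)).

Lemma clamp_le1 h x : clamp h x <= 1.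
Proof. by rewrite /clamp ge_min lexx. Qed.

Lemma clamp_id h x : 0 <= h x <= 1 -> clamp h x = h x.
Proof.
by move=> /andP[h0 h1]; rewrite /clamp (max_idPr h0) (min_idPr h1).
Qed.

Lemma admissible_measurable m h : admissible m h -> measurable_fun setT h.
Proof. by case=> /sub_Lfun_mfun; rewrite inE. Qed.

Lemma admissible_clamp m h : admissible m h ->
  [/\ nneg_mfun (clamp h), ae_eq mu setT h (clamp h) & (\int[mu]_x (clamp h x)%:E = m%:E)%E].
Proof.
move=> adm; have mh := admissible_measurable adm; case: adm => _ h01 hm.
have mk : measurable_fun setT (clamp h).
  by apply: measurable_minr => //; apply: measurable_maxr.
have k0 x : 0 <= clamp h x by rewrite /clamp le_min ler01 le_max lexx.
have hk : ae_eq mu setT h (clamp h).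
  by apply: filterS h01 => x hx _; rewrite clamp_id.
split => //; rewrite -hm Lnorm1; apply: ae_eq_integral => //.
- exact/measurable_EFinP.
- by apply: measurableT_comp => //; exact/measurable_EFinP.
by apply: filterS h01 => x hx _ /=; rewrite clamp_id// ger0_norm//; case/andP: hx.
Qed.

Lemma mnn_admissible m h : nneg_mfun h -> (forall x, h x <= 1) ->
  (\int[mu]_x (h x)%:E = m%:E)%E -> admissible m h.
Proof.
move=> [mh h0] h1 hm.
have E : ('N[mu]_1[EFin \o h] = m%:E)%E.
  by rewrite Lnorm1 -hm; apply: eq_integral => x _ /=; rewrite ger0_norm.
split => //; last by apply: aeW => x; rewrite h0 h1.
by rewrite inE; apply/andP; split; rewrite inE//= /finite_norm E ltry.
Qed.

End clamping.

Section centering.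
Context {R : realType} {N : nat}.
Local Notation mu := (@lebesgueN R N).
Implicit Types (h k f F : vec R N -> R) (p m : R) (a : vec R N).

Lemma vsub_vaddK a (x : vec R N) : vadd (vsub x a) a = x.
Proof. by apply: vecP => i; rewrite !cosE; ring. Qed.

Lemma wint_translate a h F : measurable_fun setT h -> measurable_fun setT F ->
  wint (translate a h) F = wint h (fun x => F (vadd x a)).
Proof.
move=> mh mF; rewrite /wint /Rintegral; apply: (congr1 fine).
have mFh : measurable_fun setT (fun x => (F (vadd x a) * h x)%:E).
  apply/measurable_EFinP; apply: measurable_funM => //.
  by apply: (measurableT_comp mF); exact: mfun_vadd.
rewrite -[RHS](preserves_integral_signed (sub_shift_preserves a) mFh).
by apply: eq_integral => x _; rewrite /= vsub_vaddK.
Qed.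

Lemma translate_mdens p m h a : 1 <= p -> mdens p m h -> mdens p m (translate a h).
Proof.
move=> p1 dh; have [[mh h0] mass mom] := dh.
have p0 : 0 <= p by apply: le_trans p1.
have mt : measurable_fun setT (translate a h) by exact: measurable_translate.
split.
- by split => // x; exact: h0.
- rewrite -mass -[RHS](preserves_integral_signed (sub_shift_preserves a))//.
  exact/measurable_EFinP.
have mF : measurable_fun setT (fun x : vec R N => (sq (vadd x a) `^ p * h x)%:E).
  apply/measurable_EFinP; apply: measurable_funM => //.
  by apply: (measurableT_comp (measurable_powR p)); apply: mfun_sq; exact: mfun_vadd.
have := preserves_integral_signed (sub_shift_preserves a) mF.
rewrite (eq_integral (fun x => (sq x `^ p * translate a h x)%:E)); last first.
  by move=> x _; rewrite vsub_vaddK.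
move=> ->.
suff /integrableP[_] : wintegrable h (fun x => sq (vadd x a) `^ p).
  apply: le_lt_trans; apply: ge0_le_integral => //.
  - by move=> x _; rewrite lee_fin mulr_ge0 ?powR_ge0.
  - exact: measurableT_comp.
  - by move=> x _ /=; rewrite lee_fin ler_norm.
have g := @growth_powf R p p1.
have E : (fun x => sq (vadd x a) `^ p) = (fun x => powf p (sq (vsub (vscale (-1) a) x))).
  apply/funext => x; rewrite /powf; congr (_ `^ _).
  by rewrite sqD sqB sqZ dotZl (dotC a x); ring.
by rewrite E; exact: (wintegrable_growth p1 g dh).
Qed.

Lemma wint_sum p m h (n : nat) (F : 'I_n -> vec R N -> R) : 1 <= p -> mdens p m h ->
  (forall i, wintegrable h (F i)) ->
  wintegrable h (fun x => \sum_(i < n) F i x) /\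
  wint h (fun x => \sum_(i < n) F i x) = \sum_(i < n) wint h (F i).
Proof.
move=> p1 dh; elim: n F => [|n IH] F iF.
  have -> : (fun x : vec R N => \sum_(i < 0) F i x) = fun=> 0 by apply/funext => x; rewrite big_ord0.
  by split; [exact: (wintegrable_cst dh)|rewrite big_ord0 (wint_cst dh) mul0r].
have [i1 e1] := IH (fun i => F (lift ord0 i)) (fun i => iF _).
have -> : (fun x => \sum_(i < n.+1) F i x) =
    (fun x => F ord0 x + \sum_(i < n) F (lift ord0 i) x).
  by apply/funext => x; rewrite big_ord_recl.
by split; [exact: wintegrableD|rewrite wintD// big_ord_recl e1].
Qed.

(** Translate by minus the mean. *)
Lemma exists_centering p m h : 1 <= p -> 0 < m -> mdens p m h ->
  exists a, centered (translate a h).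
Proof.
move=> p1 m0 dh; have [[mh h0] _ _] := dh.
pose M : vec R N := mkv (fun i => wint h (fun x => co x i)).
have ic i : wintegrable h (fun x => co x i).
  rewrite (_ : (fun x => co x i) = (fun x => dot x (ebase i))).
    exact: (wintegrable_dot p1 dh).
  by apply/funext => x; rewrite dot_base.
have iv v i : wintegrable h (fun x => co v i * co x i) by exact: wintegrableZ.
exists (vscale (- m^-1) M) => v.
rewrite wint_translate//; last exact: mfun_dot.
have [id1 e1] := wint_sum p1 dh (iv v).
have E (x : vec R N) : dot (vadd x (vscale (- m^-1) M)) v =
    \sum_(i < N) co v i * co x i + (- m^-1 * dot M v).
  by rewrite dotDl dotZl; congr (_ + _); apply: eq_bigr => i _; rewrite mulrC.
rewrite (_ : (fun x => _) = (fun x => \sum_(i < N) co v i * co x i + (- m^-1 * dot M v))); last first.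
  by apply/funext => x.
rewrite (wintD id1 (wintegrable_cst dh _)) (wint_cst dh) e1.
rewrite (eq_bigr (fun i => co M i * co v i)); last first.
  by move=> i _; rewrite (wintZ _ (ic i)) coE mulrC.
by rewrite -/(dot M v) mulrAC mulNr mulVf ?gt_eqF// mulN1r subrr.
Qed.

End centering.

(** * Comparison with the equilibrium annulus *)

Section annulus_density.
Context {R : realType} {N : nat}.
Local Notation mu := (@lebesgueN R N).
Implicit Types (h k f F : vec R N -> R) (c : vec R N).
Variables (i0 : 'I_N) (p m a b : R).
Hypotheses (p12 : 1 < p < 2) (hNp : 4 < N%:R + 2 * p) (m0 : 0 < m)
  (a0 : 0 <= a) (ab : a < b) (hmass : mu (ann a b) = m%:E).
Local Notation A := (ann a b : set (vec R N)).
Local Notation f := (\1_A : vec R N -> R).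

Let p1 : 1 <= p. Proof. by move: p12 => /andP[/ltW]. Qed.

Lemma ind_le1 (x : vec R N) : f x <= 1.
Proof. by rewrite indicE; case: (_ \in _). Qed.

Lemma mnn_ann : nneg_mfun f.
Proof.
by split; [exact: measurable_indic (measurable_ann a b)|move=> x; rewrite indicE].
Qed.

Lemma ann_density : mdens p m f.
Proof.
have [mf f0] := mnn_ann.
have mass : (\int[mu]_x (f x)%:E = m%:E)%E.
  by rewrite integral_indic ?setIT//; exact: measurable_ann.
split => //.
apply: (@le_lt_trans _ _ (\int[mu]_x ((b ^+ 2) `^ p * f x)%:E)%E).
  apply: ge0_le_integral => //.
  - by move=> x _; rewrite lee_fin; apply: mulr_ge0 => //; exact: powR_ge0.
  - apply/measurable_EFinP; apply: measurable_funM => //.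
    by apply: (measurableT_comp (measurable_powR p)); exact: mfun_sq.
  - by apply/measurable_EFinP; apply: measurable_funM.
  move=> x _; rewrite lee_fin indicE.
  have [xA|xA] := boolP (x \in A); last by rewrite !mulr0.
  rewrite !mulr1; move: xA; rewrite inE => /andP[_ xb].
  apply: ge0_ler_powR; rewrite ?nnegrE ?sq_ge0 ?sqr_ge0//; first exact: le_trans p1.
  by rewrite -enorm_sq; apply: lerXn2r; rewrite ?nnegrE ?enorm_ge0 ?(ltW xb)// (le_trans a0 (ltW ab)).
rewrite (eq_integral (fun x => ((b ^+ 2) `^ p)%:E * (f x)%:E)%E); last by move=> x _; rewrite EFinM.
rewrite ge0_integralZl_EFin ?powR_ge0//; last exact/measurable_EFinP.
by rewrite mass -EFinM ltry.
Qed.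

(** The annulus is symmetric. *)
Lemma ann_centered : centered f.
Proof.
move=> v.
have [mf _] := mnn_ann.
have mF : measurable_fun setT (fun x : vec R N => (dot x v * f x)%:E).
  by apply/measurable_EFinP; apply: measurable_funM => //; exact: mfun_dot.
have E : wint f (fun x => dot x v) = wint f (fun x => -1 * dot x v).
  rewrite /wint /Rintegral; apply: (congr1 fine).
  rewrite -[LHS](preserves_integral_signed (isometry_preserves (neg_isometry)) mF).
  apply: eq_integral => x _; rewrite dotZl !indicE; congr ((_ * (nat_of_bool _)%:R)%:E).
  by apply/idP/idP; rewrite !inE /ann /= enorm_scale normrN1 mul1r.
move: E; rewrite (wintZ _ (wintegrable_dot p1 ann_density v)); lra.
Qed.

Lemma wpot_ann (x : vec R N) : wpot (powf p) f x = annpot i0 p a b (enorm x).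
Proof.
have -> : annpot i0 p a b (enorm x) = gpot A p x.
  have rad : radial (gpot A p) by apply: gpot_radial; [exact: measurable_ann|exact: ann_rad].
  exact: (esym (radial_prof i0 x rad)).
rewrite /wpot /wint /gpot /bint /Rintegral; apply: (congr1 fine).
rewrite [RHS]integral_mkcond; apply: eq_integral => y _.
by rewrite patchE indicE; case: (y \in A); rewrite ?mulr1 ?mulr0.
Qed.

Lemma ann_admissible : admissible m f.
Proof.
apply: mnn_admissible; [exact: mnn_ann|exact: ind_le1|exact: md_mass ann_density].
Qed.

Let lam : R := annpot i0 p a b b - m * p * b ^+ 2.
Let psi (x : vec R N) : R := wpot (powf p) f x + (- (m * p) * sq x + - lam).

Hypotheses
  (inside : forall r, a < r < b -> annpot i0 p a b r - m * p * r ^+ 2 < lam)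
  (outside : forall r, 0 <= r -> (r < a) || (b < r) -> lam < annpot i0 p a b r - m * p * r ^+ 2).

Lemma psi_annpot x : psi x = annpot i0 p a b (enorm x) - m * p * enorm x ^+ 2 - lam.
Proof. by rewrite /psi wpot_ann enorm_sq mulNr addrA. Qed.

(** In the annulus [psi < 0] and [k <= 1 = f]; outside [psi > 0] and [k >= 0 =
    f]. On the two boundary spheres [psi] may vanish. *)
Lemma gap_gt0 k (x : vec R N) : 0 <= k x <= 1 -> enorm x != a -> enorm x != b ->
  (0 <= psi x * (k x - f x)) /\ (psi x * (k x - f x) = 0 -> k x = f x).
Proof.
move=> /andP[k0 k1] xa xb.
have arith (u v : R) : u != 0 -> 0 <= u * v -> 0 <= u * v /\ (u * v = 0 -> v = 0).
  move=> u0 uv; split => // /eqP; rewrite mulf_eq0 (negbTE u0) => /eqP //.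
suff [H1 H2] : psi x != 0 /\ 0 <= psi x * (k x - f x).
  have [H3 H4] := arith _ _ H1 H2; split => // /H4 /eqP; by rewrite subr_eq0 => /eqP.
rewrite psi_annpot indicE.
have [xA|xA] := boolP (x \in A).
  move: xA; rewrite inE => /inside h; split; first by rewrite lt_eqF// subr_lt0.
  by apply: mulr_le0; rewrite ?subr_le0 ?(ltW h).
have out : (enorm x < a) || (b < enorm x).
  move: xA; rewrite notin_setE /ann /= => /negP; rewrite negb_and -!leNgt => /orP[h|h].
    by rewrite lt_neqAle xa h.
  by rewrite [b < _]lt_neqAle eq_sym xb h orbT.
have h := outside (enorm_ge0 x) out; split; first by rewrite gt_eqF// subr_gt0.
by rewrite subr0; apply: mulr_ge0; rewrite ?subr_ge0 ?(ltW h).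
Qed.

(** By convexity of the energy, the energy gap is at least [1/p] times the
    integral of [psi (k - f)], which is nonnegative by [gap_gt0]; equality makes
    this integrand vanish almost everywhere. *)
Lemma centered_comparison k : mdens p m k -> centered k -> (forall x, k x <= 1) ->
  (energy (2 * p) 2 f <= energy (2 * p) 2 k)%E /\
  ((energy (2 * p) 2 k <= energy (2 * p) 2 f)%E -> ae_eq mu setT k f).
Proof.
move=> dk ck k1.
have arith (kk ff kf sk sf Pk Pf q : R) : 0 < q -> Pk = kf - m * q * sk - lam * m ->
   Pf = ff - m * q * sf - lam * m -> 2 * kf <= kk + ff ->
   q^-1 * (Pk - Pf) <= ((2 * q)^-1 * kk - m * sk) - ((2 * q)^-1 * ff - m * sf).
  move=> q0 -> -> h.
  rewrite -subr_ge0 (_ : _ - _ = (2 * q)^-1 * (kk + ff - 2 * kf)); last by field; lra.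
  by rewrite mulr_ge0 ?invr_ge0 ?subr_ge0//; lra.
have df := ann_density; have cf := ann_centered.
have [mk k0] := md_nn dk; have [mf f0] := md_nn df.
have gp := growth_powf p1.
have p0 : 0 < p by apply: lt_le_trans p1.
have ipk := wintegrable_wpot p1 gp dk df; have ipf := wintegrable_wpot p1 gp df df.
have isk := wintegrable_sq p1 dk; have isf := wintegrable_sq p1 df.
have ick := wintegrable_cst dk (- lam); have icf := wintegrable_cst df (- lam).
have iqk := wintegrableD (wintegrableZ (- (m * p)) isk) ick.
have iqf := wintegrableD (wintegrableZ (- (m * p)) isf) icf.
have ipsik : wintegrable k psi by exact: wintegrableD.
have ipsif : wintegrable f psi by exact: wintegrableD.
have Wk : wint k psi = wint k (wpot (powf p) f) - m * p * second_moment k - lam * m.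
  rewrite (wintD ipk iqk) (wintD (wintegrableZ _ isk) ick) (wintZ _ isk) (wint_cst dk) -/(second_moment k).
  by ring.
have Wf : wint f psi = wint f (wpot (powf p) f) - m * p * second_moment f - lam * m.
  rewrite (wintD ipf iqf) (wintD (wintegrableZ _ isf) icf) (wintZ _ isf) (wint_cst df) -/(second_moment f).
  by ring.
have psd := power_form_psd p12 dk df ck cf.
rewrite (dint_wpot p1 gp dk df) (dint_wpot p1 gp dk dk) (dint_wpot p1 gp df df) -EFinM -EFinD lee_fin in psd.
have ig : mu.-integrable setT (EFin \o (fun x => psi x * (k x - f x))).
  have := integrableB measurableT ipsik ipsif.
  by apply: eq_integrable => // x _; rewrite /= mulrBr.
have WG : \int[mu]_x (psi x * (k x - f x)) = wint k psi - wint f psi.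
  rewrite /wint -RintegralB//; by apply: eq_Rintegral => x _; rewrite mulrBr.
have sph (r : R) : {ae mu, forall x : vec R N, enorm x != r}.
  have N0 : (0 < N)%N by apply: leq_ltn_trans (ltn_ord i0).
  exists [set x | enorm x = r]; split; [exact: measurable_sphere0|exact: sphere0_null|].
  by move=> x /= /negP; rewrite negbK => /eqP.
have sgn : {ae mu, forall x : vec R N, (0 <= psi x * (k x - f x)) /\
    (psi x * (k x - f x) = 0 -> k x = f x)}.
  by apply: filterS2 (sph a) (sph b) => x; apply: gap_gt0; rewrite k0 k1.
have mg : measurable_fun setT (fun x => (psi x * (k x - f x))%:E) by case/integrableP: ig.
have absE : (\int[mu]_x `|(psi x * (k x - f x))%:E| = (wint k psi - wint f psi)%:E)%E.
  rewrite -WG /Rintegral fineK; last exact: integrable_fin_num.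
  apply: ae_eq_integral => //; first exact: measurableT_comp.
  by apply: filterS sgn => x [h _] _ /=; rewrite ger0_norm.
have key := arith _ _ _ _ _ _ _ _ p0 Wk Wf psd.
have W0 : 0 <= wint k psi - wint f psi.
  by rewrite -lee_fin -absE; apply: integral_ge0 => x _; exact: abse_ge0.
have pv : 0 < p^-1 by rewrite invr_gt0.
rewrite (energy_centered p1 dk ck) (energy_centered p1 df cf) !lee_fin; split.
  by rewrite -subr_ge0; apply: le_trans key; apply: mulr_ge0 => //; exact: ltW.
move=> h.
have W1 : wint k psi - wint f psi = 0.
  apply/eqP; rewrite eq_le W0 andbT -(pmulr_rle0 _ pv); apply: (le_trans key).
  by rewrite subr_le0.
have := absE; rewrite W1 => /(ae_eq_integral_abs _ measurableT mg) ae0.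
by apply: filterS2 sgn ae0 => x [_ h1] /(_ I) [h2] _; exact: h1.
Qed.

(** Reduces a general admissible density to [centered_comparison]: a density of
    infinite energy is no competitor, any other one has moments and can be
    centered without changing its energy. *)
Lemma ann_minimal h : admissible m h ->
  (energy (2 * p) 2 f <= energy (2 * p) 2 h)%E /\
  ((energy (2 * p) 2 h <= energy (2 * p) 2 f)%E -> ae_translate h f).
Proof.
move=> adm; have mh := admissible_measurable adm.
have [nk hk mass] := admissible_clamp adm.
have [mk k0] := nk; have p11 : 1 < p by case/andP: p12.
rewrite (energy_ae _ _ mh mk hk).
have [fin|] := ltP (energy (2 * p) 2 (clamp h)) +oo%E; last first.
  rewrite leye_eq => /eqP->; rewrite leey; split => //.
  by rewrite (energy_centered p1 ann_density ann_centered).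
have dk := finite_energy_mdens p11 m0 nk mass fin.
have [c cc] := exists_centering p1 m0 dk.
have [H1 H2] := centered_comparison (translate_mdens c p1 dk) cc (fun x => clamp_le1 h _).
rewrite energy_translate// in H1 H2; split => // /H2 H.
exists (vscale (-1) c).
have shift := preserves_ae (shift_preserves c) H.
apply: filterS2 hk shift => x hx; rewrite hx// /translate => + _.
have -> : vsub (vadd x c) c = x by apply: vecP => i; rewrite !cosE; ring.
by move=> ->//; congr (f _); apply: vecP => i; rewrite !cosE; ring.
Qed.

End annulus_density.

(** * The energy of thin annuli *)

Section scaling.
Context {R : realType} {N : nat}.
Local Notation mu := (@lebesgueN R N).

Lemma scale_integral (c : R) (phi : vec R N -> \bar R) : 0 < c -> measurable_fun setT phi ->
  (forall x, 0 <= phi x)%E ->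
  (\int[mu]_x phi (vscale c x) = ((c^-1) ^+ N)%:E * \int[mu]_x phi x)%E.
Proof.
move=> c0 mphi phi0.
have mT : measurable_fun setT (fun x : vec R N => vscale c x) by exact: mfun_vscale.
have k0 : 0 <= (c^-1) ^+ N by rewrite exprn_ge0// invr_ge0 ltW.
rewrite -[LHS](@ge0_integral_pushforward _ _ _ _ R _ mT mu setT phi measurableT mphi); last first.
  by move=> y _; exact: phi0.
rewrite -(@ge0_integral_mscale _ _ R mu setT measurableT (NngNum k0) phi mphi)//.
apply: (@eq_measure_integral _ _ _ setT (mscale (NngNum k0) mu)
  (measure_function_pushforward__canonical__measure_function_Measure mu mT)).
by move=> A mA _; exact: scale_lebesgueN.
Qed.

(** Extends the integral to the whole space, where changes of variables are
    available. *)
Lemma bint_indic (S : set (vec R N)) (F : vec R N -> R) :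
  bint mu S F = fine (\int[mu]_x (\1_S x * F x)%:E)%E.
Proof.
rewrite /bint /Rintegral integral_mkcond; apply: (congr1 fine); apply: eq_integral => y _.
by rewrite patchE indicE; case: (y \in S); rewrite ?mul1r ?mul0r.
Qed.

End scaling.

(** For [s = |y|] and [u] the squared distance between the directions, [(r -
    s)^2 + r s u] is the squared distance from [y] to a point at radius [r]. As
    [r] and [s] lie within [d <= 1] of [a], replacing both by [a] costs at most
    a multiple of [d]. *)
Lemma shell_arith (R : realType) (s u a b r d : R) : 0 <= a -> a <= r <= b -> a < s -> s < b ->
  b - a <= d -> d <= 1 -> 0 <= u -> u <= 4 ->
  [/\ 0 <= a ^+ 2 * u, a ^+ 2 * u <= (r - s) ^+ 2 + r * s * u,
      (r - s) ^+ 2 + r * s * u <= 5 * (a + 1) ^+ 2 &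
      (r - s) ^+ 2 + r * s * u - a ^+ 2 * u <= (5 + 8 * a) * d].
Proof.
move=> a0 /andP[h1 h2] h3 h4 h5 d1 u0 u4.
have d0 : 0 <= d by lra.
have k1 : a ^+ 2 <= r * s by rewrite expr2 ler_pM// ltW.
have k2 : r * s <= (a + d) ^+ 2 by rewrite expr2 ler_pM//; lra.
have k3 : (r - s) ^+ 2 <= d ^+ 2 by nra.
have k4 : d ^+ 2 <= d by rewrite expr2 ler_piMl.
have k5 : (a + d) ^+ 2 <= a ^+ 2 + (1 + 2 * a) * d by rewrite sqrrD; lra.
have k6 : (a + d) ^+ 2 <= (a + 1) ^+ 2 by rewrite lerXn2r// ?nnegrE; lra.
have k7 : 0 <= r * s by rewrite mulr_ge0//; lra.
have k8 : r * s * u <= r * s * 4 by rewrite ler_wpM2l.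
have k9 : (r * s - a ^+ 2) * u <= (r * s - a ^+ 2) * 4 by rewrite ler_wpM2l// subr_ge0.
have k10 : 1 <= (a + 1) ^+ 2 by rewrite -[leLHS](expr1n _ 2) lerXn2r// ?nnegrE; lra.
have k11 : a ^+ 2 * u <= r * s * u by rewrite ler_wpM2r.
have k12 := sqr_ge0 (r - s).
split; [by rewrite mulr_ge0// sqr_ge0|lra|lra|lra].
Qed.

Section angular.
Context {R : realType} {N : nat} (i0 : 'I_N) (p : R).
Local Notation mu := (@lebesgueN R N).
Hypothesis p12 : 1 < p < 2.
Hypothesis hNp : 4 < N%:R + 2 * p.
Implicit Types (a b r t m : R) (x y : vec R N).

Let N0 : (0 < N)%N. Proof. by case: (N) i0 => [[]|]. Qed.
Local Notation w := (@bvol R N).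

Let p1 : 1 <= p. Proof. by move: p12 => /andP[/ltW]. Qed.

Definition dir y : vec R N := vscale (enorm y)^-1 y.
(** The power of the distance between the axis and the direction of [y];
    homogeneous of degree [0]. *)
Definition angular y : R := inner i0 p 1 (dir y).

Lemma dir_scale c y : 0 < c -> dir (vscale c y) = dir y.
Proof.
move=> c0; apply: vecP => i; rewrite !cosE enorm_scale gtr0_norm// invfM mulrACA mulVf ?gt_eqF//.
by rewrite mul1r.
Qed.

Lemma mfun_dir : measurable_fun setT dir.
Proof.
have -> : dir = fun y => vscale (enorm y `^ (-1)) y.
  by apply/funext => y; rewrite powR_inv1 ?enorm_ge0.
apply: mfun_vscale => //; apply: (measurableT_comp (measurable_powR _)).
exact: mfun_enorm.
Qed.

Lemma enorm_dir y : enorm (dir y) <= 1.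
Proof.
rewrite enorm_scale ger0_norm ?invr_ge0 ?enorm_ge0//.
by have [->|y0] := eqVneq (enorm y) 0; rewrite ?mulr0// mulVf.
Qed.

Lemma inner_dir_bmeas r S : bmeas S (fun y => inner i0 p r (dir y)).
Proof.
have [mi _] := @inner_bmeas R N i0 p p12 hNp r 2 (ler0n _ 2).
split; first exact: (measurableT_comp mi mfun_dir).
exists (((`|r| + 2) ^+ 2) `^ p) => y _.
rewrite ger0_norm ?powR_ge0//; apply: inner_le => //.
by apply: le_lt_trans (enorm_dir y) _; rewrite ltr1n.
Qed.

(** The mean over the unit ball, which by homogeneity is the mean over every
    annulus. *)
Definition angular_mean : R := bint mu (ball0 1) angular / w.

(** Scaling, since [angular] is homogeneous of degree [0]. *)
Lemma angular_ball t : 0 <= t -> bint mu (ball0 t) angular = t ^+ N * (w * angular_mean).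
Proof.
have -> : w * angular_mean = bint mu (ball0 1) angular.
  by rewrite mulrC divfK// gt_eqF// bvol_gt0.
rewrite le_eqVlt => /orP[/eqP<-|t0].
  rewrite expr0n eqn0Ngt N0 mul0r (_ : ball0 0 = set0) ?/bint ?Rintegral_set0//.
  by apply/seteqP; split => // x /=; rewrite /ball0/= ltNge enorm_ge0.
pose phi y := (\1_(ball0 t) y * angular y)%:E.
have [mi _] := inner_dir_bmeas 1 setT.
have mphi : measurable_fun setT phi.
  apply/measurable_EFinP; apply: measurable_funM => //.
  exact: measurable_indic (measurable_ball0 t).
have phi0 y : (0 <= phi y)%E by rewrite lee_fin; apply: mulr_ge0; [rewrite indicE|exact: powR_ge0].
have := scale_integral t0 mphi phi0.
rewrite (eq_integral (fun y => (\1_(ball0 1) y * angular y)%:E)); last first.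
  move=> y _; rewrite /phi /angular dir_scale//; congr ((_ * _)%:E); rewrite !indicE.
  congr (nat_of_bool _)%:R; apply/idP/idP; rewrite !inE /ball0 /= enorm_scale gtr0_norm//.
    by rewrite gtr_pMr.
  by rewrite gtr_pMr.
move=> /(congr1 fine); rewrite !bint_indic => ->.
rewrite fineM//; last first.
  have : mu.-integrable setT phi.
    have := bmeas_int (measurable_ball0 t) (@ball0_fin R N t) (inner_dir_bmeas 1 (ball0 t)).
    rewrite integrable_mkcond; last exact: measurable_ball0.
    apply: eq_integrable => // y _; rewrite patchE /phi indicE.
    by case: (y \in _); rewrite ?mul1r ?mul0r.
  by move/(integrable_fin_num measurableT).
by rewrite mulrA exprVn mulfV ?mul1r// expf_neq0// gt_eqF.
Qed.

Lemma angular_ann a b m : 0 <= a -> a <= b -> mu (ann a b) = m%:E ->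
  bint mu (ann a b) angular = angular_mean * m.
Proof.
move=> a0 ab; rewrite (ann_vol N0 a0 ab) => -[<-].
rewrite (bint_ann N0 ab (inner_dir_bmeas 1 _)) !angular_ball ?(le_trans a0 ab)//.
by ring.
Qed.

(** Averages [inner_pair] over [y] and [- y]. *)
Lemma angular_mean_ge1 : 1 <= angular_mean.
Proof.
have arith (u v z : R) : 2 * (1 + z) <= u + v -> 0 <= z -> 2 <= u + v by lra.
have arith2 (u v : R) : 2 * u <= v + v -> u <= v by lra.
rewrite /angular_mean ler_pdivlMr ?bvol_gt0// mul1r.
have mB := @measurable_ball0 R N 1; have fB := @ball0_fin R N 1.
have b1 := inner_dir_bmeas 1 (ball0 1); have b2 := inner_dir_bmeas (- 1) (ball0 1).
have sym : bint mu (ball0 1) (fun y => inner i0 p (- 1) (dir y)) = bint mu (ball0 1) angular.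
  rewrite !bint_indic; apply: (congr1 fine).
  have mphi : measurable_fun setT (fun y => (\1_(ball0 1) y * angular y)%:E).
    apply/measurable_EFinP; apply: measurable_funM; first exact: measurable_indic mB.
    by case: b1.
  rewrite -[RHS](preserves_integral_signed (isometry_preserves neg_isometry) mphi).
  apply: eq_integral => y _; congr ((_ * _)%:E).
    rewrite !indicE; congr (nat_of_bool _)%:R.
    by apply/idP/idP; rewrite !inE /ball0 /= enorm_scale normrN1 mul1r.
  rewrite /angular /inner; congr (_ `^ _).
  have -> : vsub (ray i0 (- 1)) (dir y) = vscale (-1) (vsub (ray i0 1) (dir (vscale (-1) y))).
    by apply: vecP => i; rewrite /ray /dir !cosE enorm_scale normrN1 !mul1r; ring.
  by rewrite sqZ sqrrN expr1n mul1r.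
have h : bint mu (ball0 1) (fun=> 2) <= bint mu (ball0 1) (fun y => angular y + inner i0 p (- 1) (dir y)).
  apply: (bint_le mB fB (bmeas_cst _ _) (bmeasD b1 b2)) => y _.
  have := inner_pair i0 p12 1 (dir y); rewrite expr1n powR1 => H.
  exact: arith H (powR_ge0 _ _).
rewrite (bint_cst _ mB) (bintD mB fB b1 b2) sym in h.
exact: arith2 h.
Qed.

(** The law of cosines, arranged so that radial and angular parts separate. *)
Lemma inner_angle r y : 0 <= r -> 0 < enorm y ->
  sq (vsub (ray i0 r) y) = (r - enorm y) ^+ 2 + r * enorm y * sq (vsub (ray i0 1) (dir y)).
Proof.
move=> r0 y0; rewrite !sqB !sqZ !sq_base !dotZl dotZr -enorm_sq.
by field; rewrite gt_eqF.
Qed.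

Lemma sq_angle y : sq (vsub (ray i0 1) (dir y)) <= 4.
Proof.
rewrite -enorm_sq; have := enorm_sub (ray i0 1) (dir y).
rewrite enorm_ray normr1; have := enorm_dir y; have := enorm_ge0 (vsub (ray i0 1) (dir y)).
move: (enorm (dir y)) (enorm (vsub _ _)) => s t; nra.
Qed.

Section bounds.
Variables (a b m : R).
Hypotheses (a0 : 0 <= a) (ab : a < b) (hmass : mu (ann a b) = m%:E).

Let b0 : 0 <= b. Proof. exact: le_trans a0 (ltW ab). Qed.
Let mA := @measurable_ann R N a b.
Let fA := @ann_fin R N a b.

Lemma inner_bmeas_ann r : bmeas (ann a b) (inner i0 p r).
Proof.
have [mi [C hC]] := @inner_bmeas R N i0 p p12 hNp r b b0.
by split => //; exists C => y /andP[_ yb]; exact: hC.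
Qed.

(** Drop the radial part in [inner_angle] and replace both radii by [a]. *)
Lemma annpot_lower r : a <= r -> (a ^+ 2) `^ p * (angular_mean * m) <= annpot i0 p a b r.
Proof.
move=> ar; have r0 := le_trans a0 ar; have bH := inner_dir_bmeas 1 (ann a b).
rewrite -(angular_ann a0 (ltW ab) hmass) annpotE -(bintZ mA fA _ bH).
apply: (bint_le mA fA (bmeasZ _ bH) (inner_bmeas_ann r)) => y /andP[ay yb].
have y0 : 0 < enorm y by apply: le_lt_trans ay.
rewrite /angular /inner -powRM ?sqr_ge0 ?sq_ge0//.
apply: ge0_ler_powR; rewrite ?nnegrE ?sq_ge0//; first exact: le_trans p1.
  by apply: mulr_ge0; rewrite ?sqr_ge0 ?sq_ge0.
rewrite (inner_angle r0 y0); set u := sq (vsub (ray i0 1) _).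
have u0 : 0 <= u by exact: sq_ge0.
have : a ^+ 2 * u <= r * enorm y * u.
  by rewrite ler_wpM2r// expr2 ler_pM// ltW.
by have := sqr_ge0 (r - enorm y); lra.
Qed.

(** All radii lie within [d] of [a], and [s^p] is Lipschitz on bounded sets. *)
Lemma annpot_upper r d : a <= r <= b -> b - a <= d -> d <= 1 ->
  annpot i0 p a b r <=
  m * ((a ^+ 2) `^ p * angular_mean + p * (5 * (a + 1) ^+ 2) `^ (p - 1) * (5 + 8 * a) * d).
Proof.
move=> /andP[ar rb] bad d1; have r0 := le_trans a0 ar; have bH := inner_dir_bmeas 1 (ann a b).
pose L : R := p * (5 * (a + 1) ^+ 2) `^ (p - 1) * (5 + 8 * a) * d.
have d0 : 0 <= d by have := ab; move: bad; lra.
have p0 : 0 <= p by apply: le_trans p1.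
have -> : m * ((a ^+ 2) `^ p * angular_mean + L) =
    bint mu (ann a b) (fun y => (a ^+ 2) `^ p * angular y + L).
  rewrite (bintD mA fA (bmeasZ _ bH) (bmeas_cst _ _)) (bintZ mA fA _ bH) (bint_cst _ mA).
  have -> : fine (mu (ann a b)) = m by exact: (congr1 fine hmass).
  by rewrite (angular_ann a0 (ltW ab) hmass); ring.
rewrite annpotE.
apply: (bint_le mA fA (inner_bmeas_ann r) (bmeasD (bmeasZ _ bH) (bmeas_cst _ _))) => y /andP[ay yb].
have y0 : 0 < enorm y by apply: le_lt_trans ay.
rewrite /angular /inner -powRM ?sqr_ge0 ?sq_ge0// (inner_angle r0 y0).
have u0 := sq_ge0 (vsub (ray i0 1) (dir y)); have u4 := sq_angle y.
have [h1 h2 h3 h4] := shell_arith a0 (introT andP (conj ar rb)) ay yb bad d1 u0 u4.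
set X := _ + _ in h2 h3 h4 *.
have h12 : 0 <= a ^+ 2 * sq (vsub (ray i0 1) (dir y)) <= X by rewrite h1 h2.
rewrite addrC -lerBlDr; apply: (le_trans (powR_lip p1 h12)).
rewrite /L -(mulrA _ (5 + 8 * a) d) -!(mulrA p) ler_wpM2l//.
have q0 : 0 <= p - 1 by have := p1; lra.
apply: ler_pM; rewrite ?powR_ge0 ?subr_ge0//.
have X0 := le_trans h1 h2.
by apply: ge0_ler_powR; rewrite ?nnegrE ?(le_trans X0 h3).
Qed.

Hypothesis m0 : 0 < m.
Local Notation A := (ann a b : set (vec R N)).
Local Notation f := (\1_A : vec R N -> R).

Lemma wint_ann_le F G : wintegrable f F -> wintegrable f G ->
  (forall x, A x -> F x <= G x) -> wint f F <= wint f G.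
Proof.
move=> iF iG FG; apply: le_Rintegral => // x _; rewrite indicE.
by have [xA|xA] := boolP (x \in A); rewrite ?mulr0// !mulr1 FG//; rewrite inE in xA.
Qed.

Let df := ann_density p12 a0 ab hmass.
Let cf := ann_centered p12 a0 ab hmass.
Let ipot := wintegrable_wpot p1 (growth_powf p1) df df.
Let isq := wintegrable_sq p1 df.
Let icst c := wintegrable_cst df c.

Lemma energy_ann_lower :
  ((m ^+ 2 * ((2 * p)^-1 * (angular_mean * (a ^+ 2) `^ p) - b ^+ 2))%:E <= energy (2 * p) 2 f)%E.
Proof.
have p0 : 0 < p by apply: lt_le_trans p1.
have arith (E g J S : R) : 0 < m -> 0 <= g -> E * m * m <= J -> S <= b ^+ 2 * m ->
    m ^+ 2 * (g * E - b ^+ 2) <= g * J - m * S.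
  move=> m00 g0 hJ hS.
  have := ler_wpM2l g0 hJ; have := ler_wpM2l (ltW m00) hS; lra.
rewrite (energy_centered p1 df cf) lee_fin; apply: arith => //.
- by rewrite invr_ge0 mulr_ge0// ltW.
- rewrite -(wint_cst df); apply: (wint_ann_le (icst _) ipot) => x /andP[ax xb].
  rewrite (wpot_ann i0); apply: le_trans (annpot_lower (ltW ax)).
  by rewrite mulrAC mulrC.
rewrite -(wint_cst df); apply: (wint_ann_le isq (icst _)) => x /andP[ax xb].
by rewrite -enorm_sq lerXn2r ?nnegrE ?enorm_ge0// ltW.
Qed.

Lemma energy_ann_upper d : b - a <= d -> d <= 1 ->
  (energy (2 * p) 2 f <= (m ^+ 2 * ((2 * p)^-1 * (angular_mean * (a ^+ 2) `^ p
     + p * (5 * (a + 1) ^+ 2) `^ (p - 1) * (5 + 8 * a) * d) - a ^+ 2))%:E)%E.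
Proof.
move=> bad d1; have p0 : 0 < p by apply: lt_le_trans p1.
have arith (E g J S : R) : 0 < m -> 0 <= g -> J <= m * E * m -> a ^+ 2 * m <= S ->
    g * J - m * S <= m ^+ 2 * (g * E - a ^+ 2).
  move=> m00 g0 hJ hS.
  have := ler_wpM2l g0 hJ; have := ler_wpM2l (ltW m00) hS; lra.
rewrite (energy_centered p1 df cf) lee_fin; apply: arith => //.
- by rewrite invr_ge0 mulr_ge0// ltW.
- rewrite -(wint_cst df); apply: (wint_ann_le ipot (icst _)) => x /andP[ax xb].
  rewrite (wpot_ann i0) (mulrC angular_mean); apply: annpot_upper => //.
  by rewrite !ltW.
rewrite -(wint_cst df); apply: (wint_ann_le (icst _) isq) => x /andP[ax xb].
by rewrite -enorm_sq lerXn2r ?nnegrE ?enorm_ge0// ltW.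
Qed.

End bounds.
End angular.

(** * Concentration of thin minimal annuli *)

(** The tangent at [w], combined with the tangent at [1] evaluated at [w]: the
    well [(s^p - 1)/p - (s - 1)] grows at least linearly on the far side of [w]
    from its minimum [s = 1]. *)
Lemma power_well (R : realType) (p s w : R) : 1 < p -> 0 <= s -> 0 < w ->
  (w `^ (p - 1) - 1) * (s - w) <= (s `^ p - 1) / p - (s - 1).
Proof.
move=> p1 s0 w0; have p0 : 0 < p by lra.
have h1 := powR_tangent (ltW p1) s0 (ltW w0).
have h2 := powR_tangent (ltW p1) (ltW w0) (@ler01 R).
rewrite !powR1 in h2.
rewrite -(ler_pM2l p0) (_ : p * ((s `^ p - 1) / p - _) = s `^ p - 1 - p * (s - 1)).
  by move: h1 h2; set q := w `^ (p - 1); lra.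
by field; rewrite gt_eqF.
Qed.

(** Here [s = a^2 / rho2]. Outside [(1 - e, 1 + e)] the well is bounded below by
    a multiple of [e] if [s <= 1] and of [e s] if [s >= 1], by [power_well] at
    [w = 1 + e/2] or [1 - e/2]; the right-hand side is at most a constant times
    [d (1 + s)]. *)
Lemma well_concentration (R : realType) (p C e rho2 : R) : 1 < p -> 0 <= C -> 0 < rho2 ->
  0 < e < 1 ->
  exists2 d0, 0 < d0 & forall d a, 0 < d <= d0 -> 0 <= a ->
    rho2 * (((a ^+ 2 / rho2) `^ p - 1) / p - (a ^+ 2 / rho2 - 1)) <= 2 * a * d + d ^+ 2 + C * d ->
    `|a ^+ 2 / rho2 - 1| < e.
Proof.
move=> p1 C0 r0 /andP[e0 e1].
have e4 : 0 <= 1 - e / 4 by lra.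
have ee : e * e <= e by rewrite ler_piMl// ltW.
pose w1 : R := 1 + e / 2; pose w2 : R := 1 - e / 2.
have q0 : 0 < p - 1 by lra.
have w10 : 0 < w1 by rewrite /w1; lra.
have w20 : 0 < w2 by rewrite /w2; lra.
have one : 1 `^ (p - 1) = 1 :> R by rewrite powR1.
pose k1 := w1 `^ (p - 1) - 1; pose k2 := 1 - w2 `^ (p - 1).
have k10 : 0 < k1.
  rewrite subr_gt0 -[X in X < _]one; apply: gt0_ltr_powR => //; rewrite ?nnegrE ?ltW//.
  by rewrite /w1; lra.
have k20 : 0 < k2.
  rewrite subr_gt0 -[X in _ < X]one; apply: gt0_ltr_powR => //; rewrite ?nnegrE ?ltW//.
  by rewrite /w2; lra.
pose k := Num.min k1 k2.
have k0 : 0 < k by rewrite lt_min k10.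
have kk1 : k <= k1 by rewrite ge_min lexx.
have kk2 : k <= k2 by rewrite ge_min lexx orbT.
pose D := 2 + C + rho2.
have D0 : 0 < D by rewrite /D; lra.
have t0 : 0 < rho2 * k * e / (8 * D) by rewrite divr_gt0 ?mulr_gt0.
exists (Num.min 1 (rho2 * k * e / (8 * D))); first by rewrite lt_min ltr01.
move=> d a /andP[d0]; rewrite le_min => /andP[d1].
rewrite ler_pdivlMr ?mulr_gt0// => dD a0.
set s := a ^+ 2 / rho2.
have s0 : 0 <= s by rewrite divr_ge0 ?sqr_ge0// ltW.
have a2 : a ^+ 2 = rho2 * s by rewrite /s mulrC divfK// gt_eqF.
set f := _ - _ => hf.
have f1 : k1 * (s - w1) <= f by exact: power_well.
have f2 : k2 * (w2 - s) <= f.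
  by have := power_well p1 s0 w20; rewrite -/f /k2; lra.
have up : rho2 * f <= (2 + C + rho2 * s) * d.
  apply: (le_trans hf); have : 2 * a <= 1 + a ^+ 2 by have := sqr_ge0 (a - 1); rewrite sqrrB1; lra.
  rewrite a2 => h; have := ler_wpM2r (ltW d0) h.
  have : d ^+ 2 <= d by rewrite expr2 ler_piMl// ltW.
  lra.
have ke : 0 < k * e by rewrite mulr_gt0.
have rke : 0 < rho2 * (k * e) by rewrite mulr_gt0.
have s1 : 1 <= s -> rho2 * f <= s * (rho2 * (k * e) / 8).
  move=> s1; apply: (le_trans up).
  have h1 : 2 + C + rho2 * s <= s * D.
    by have : (2 + C) * 1 <= (2 + C) * s; [rewrite ler_wpM2l//; lra|rewrite /D; lra].
  have := ler_wpM2r (ltW d0) h1; have := ler_wpM2l s0 dD; lra.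
have s2 : s <= 1 -> rho2 * f <= rho2 * (k * e) / 8.
  move=> s1'; apply: (le_trans up).
  have h1 : 2 + C + rho2 * s <= D by rewrite /D lerD2l ler_piMr// ltW.
  have := ler_wpM2r (ltW d0) h1; lra.
rewrite ltr_norml; apply/andP; split; rewrite ltNge; apply/negP => bad.
  have b1 : s <= 1 by lra.
  have h : k * (e / 2) <= f.
    apply: le_trans f2; apply: ler_pM; rewrite ?(ltW k0)//; first lra.
    by rewrite /w2; lra.
  have := s2 b1; have := ler_wpM2l (ltW r0) h; lra.
have b1 : 1 <= s by lra.
have sw : s * (e / 4) <= s - w1.
  have h : (1 + e) * (1 - e / 4) <= s * (1 - e / 4) by rewrite ler_wpM2r//; lra.
  by move: h ee; rewrite /w1; clear; lra.
have h : k * (s * (e / 4)) <= f.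
  apply: le_trans f1; apply: ler_pM; rewrite ?(ltW k0)//.
  by rewrite mulr_ge0//; lra.
have h1 := ler_wpM2l (ltW r0) h; have h2 := s1 b1.
have : 0 < s * (rho2 * (k * e)) by rewrite mulr_gt0//; lra.
lra.
Qed.

Lemma expr_superadd (R : realType) (N : nat) (a d : R) : (0 < N)%N -> 0 <= a -> 0 <= d ->
  a ^+ N + d ^+ N <= (a + d) ^+ N.
Proof.
move=> N0 a0 d0; rewrite -!powR_mulrn ?addr_ge0//.
by apply: powR_superadd => //; rewrite ler1n.
Qed.

Section hausdorff.
Context {R : realType} {N : nat} (i0 : 'I_N).
Implicit Types (x y : vec R N) (A B : set (vec R N)).

(** Move [x] along its own ray. *)
Lemma radial_shift x t : 0 < enorm x -> 0 <= t ->
  exists2 y, enorm y = t & enorm (vsub x y) = `|enorm x - t|.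
Proof.
move=> x0 t0; exists (vscale (t / enorm x) x).
  by rewrite enorm_scale ger0_norm ?divr_ge0 ?(ltW x0)// divfK// gt_eqF.
have -> : vsub x (vscale (t / enorm x) x) = vscale (1 - t / enorm x) x.
  by apply: vecP => i; rewrite !cosE; ring.
rewrite enorm_scale -{2}[enorm x](ger0_norm (ltW x0)) -normrM mulrBl mul1r divfK//.
by rewrite gt_eqF.
Qed.

Lemma dist_to_set_le x A y : A y -> (dist_to_set x A <= (enorm (vsub x y))%:E)%E.
Proof. by move=> Ay; apply: ereal_inf_lbound; exists y. Qed.

Lemma dist_to_set_ge0 x A : (0 <= dist_to_set x A)%E.
Proof. by apply: le_ereal_inf_tmp => _ [y _ <-]; rewrite lee_fin enorm_ge0. Qed.

(** Points move along their rays: those of the annulus to radius [r], those of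
    the sphere to the mean radius of the annulus. *)
Lemma hausdorff_ann_sphere a b r e : 0 <= a -> a < b -> 0 < r ->
  `|a - r| <= e -> `|b - r| <= e ->
  (0 <= hausdorff_dist (ann a b : set (vec R N)) (sphere r) <= e%:E)%E.
Proof.
move=> a0 ab r0 ar br; apply/andP; split.
  apply: (@le_trans _ _ (dist_to_set (ray i0 r) (ann a b : set (vec R N)))).
    exact: dist_to_set_ge0.
  rewrite /hausdorff_dist le_max; apply/orP; right; apply: ereal_sup_ubound.
  by exists (ray i0 r) => //; rewrite /sphere /= enorm_ray gtr0_norm.
have mid (t : R) : a <= t -> t <= b -> `|t - r| <= e.
  by move: ar br; rewrite !ler_norml => /andP[? ?] /andP[? ?] ? ?; apply/andP; split; lra.
rewrite /hausdorff_dist ge_max; apply/andP; split; apply: ge_ereal_sup => _ [x + <-].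
  move=> /andP[ax xb]; have x0 : 0 < enorm x by apply: le_lt_trans ax.
  have [y yr xy] := radial_shift x0 (ltW r0).
  apply: (le_trans (dist_to_set_le x (yr : sphere r y))).
  by rewrite lee_fin xy; apply: mid; exact: ltW.
rewrite /sphere /= => xr; have x0 : 0 < enorm x by rewrite xr.
have c0 : 0 <= (a + b) / 2 by lra.
have [y yc xy] := radial_shift x0 c0.
have Ay : ann a b y by rewrite /ann /= yc; apply/andP; split; lra.
apply: (le_trans (dist_to_set_le x Ay)).
by rewrite lee_fin xy xr distrC; apply: mid; lra.
Qed.

End hausdorff.

Section thin_annuli.
Context {R : realType} {N : nat} (i0 : 'I_N) (p : R).
Local Notation mu := (@lebesgueN R N).
Hypothesis p12 : 1 < p < 2.
Hypothesis hNp : 4 < N%:R + 2 * p.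
Local Notation w := (@bvol R N).
Local Notation Ind a b := (\1_(ann a b : set (vec R N)) : vec R N -> R).

Let N0 : (0 < N)%N. Proof. by case: (N) i0 => [[]|]. Qed.

(** [a^N + d^N <= (a + d)^N], so the thickness is bounded uniformly in [a]. *)
Lemma ann_thin (a b m d : R) : 0 <= a -> a < b -> 0 <= d -> mu (ann a b) = m%:E ->
  m <= w * d ^+ N -> b <= a + d.
Proof.
move=> a0 ab d0; rewrite (ann_vol N0 a0 (ltW ab)) => -[<-].
rewrite ler_pM2l ?bvol_gt0// => h.
have b0 : 0 <= b by exact: le_trans a0 (ltW ab).
rewrite -(ler_pXn2r N0) ?nnegrE ?addr_ge0//.
by apply: le_trans (expr_superadd N0 a0 d0); lra.
Qed.

(** The square of the limit radius: the minimum point of [A s^p / (2p) - s],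
    where [A] is the angular mean. *)
Definition limit_sq : R := (2 / angular_mean i0 p) `^ (p - 1)^-1.

Lemma limit_sq_gt0 : 0 < limit_sq.
Proof.
by rewrite powR_gt0// divr_gt0// (lt_le_trans ltr01)// angular_mean_ge1.
Qed.

Lemma limit_sqP (s : R) : 0 <= s ->
  angular_mean i0 p * (limit_sq * s) `^ p = 2 * (limit_sq * s `^ p).
Proof.
move=> s0; have /andP[p1 _] := p12; have p0 : 0 < p by lra.
have r0 := limit_sq_gt0; have A1 := angular_mean_ge1 i0 p12 hNp.
have A0 : 0 < angular_mean i0 p by exact: lt_le_trans A1.
rewrite powRM ?(ltW r0)// -(mulr_powRB1 (ltW r0) p0).
have -> : limit_sq `^ (p - 1) = 2 / angular_mean i0 p.
  rewrite /limit_sq -powRrM mulVf ?powRr1// ?gt_eqF ?subr_gt0//.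
  by rewrite divr_ge0// ltW.
by field; rewrite gt_eqF.
Qed.

(** Compare the energy of a minimal annulus, bounded below by
    [energy_ann_lower], with that of the annulus of the same mass whose inner
    radius is the limit radius. *)
Lemma minimal_annuli_concentrate (e : R) : 0 < e < 1 ->
  exists2 m1, 0 < m1 & forall m a b : R, 0 < m < m1 -> 0 <= a -> a < b ->
    mu (ann a b) = m%:E ->
    (forall h : vec R N -> R, admissible m h -> (energy (2 * p) 2 (Ind a b) <= energy (2 * p) 2 h)%E) ->
    `|a ^+ 2 / limit_sq - 1| < e /\ b <= a + e.
Proof.
move=> e01; have /andP[e0 e1] := e01; have /andP[p1 _] := p12; have p0 : 0 < p by lra.
have arith (L S K t a b d : R) : (2 * p)^-1 * (2 * (L * S)) - b ^+ 2 <=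
      (2 * p)^-1 * (2 * L + K * d) - L -> b ^+ 2 <= (a + d) ^+ 2 -> a ^+ 2 = L * t ->
    L * ((S - 1) / p - (t - 1)) <= 2 * a * d + d ^+ 2 + (2 * p)^-1 * K * d.
  have -> : (2 * p)^-1 = p^-1 / 2 by field; lra.
  by rewrite sqrrD; move: p^-1 => q; lra.
have r0 := limit_sq_gt0.
pose rho := Num.sqrt limit_sq.
have rho0 : 0 <= rho by exact: sqrtr_ge0.
have rho2 : rho ^+ 2 = limit_sq by rewrite sqr_sqrtr// ltW.
pose C := (2 * p)^-1 * (p * (5 * (rho + 1) ^+ 2) `^ (p - 1) * (5 + 8 * rho)).
have C0 : 0 <= C.
  rewrite /C mulr_ge0 ?invr_ge0 ?mulr_ge0 ?powR_ge0//; lra.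
have [d0 d00 conc] := well_concentration p1 C0 r0 e01.
pose d := Num.min e d0.
have dpos : 0 < d by rewrite lt_min e0.
have de : d <= e by rewrite ge_min lexx.
have dd0 : d <= d0 by rewrite ge_min lexx orbT.
have w0 := @bvol_gt0 R N.
exists (w * d ^+ N); first by rewrite mulr_gt0// exprn_gt0.
move=> m a b /andP[m0 md] a0 ab mab hmin.
have bd : b <= a + d := ann_thin a0 ab (ltW dpos) mab (ltW md).
split; last by lra.
have mrho := ann_mass i0 m0 rho0.
have out := outer_gt i0 m0 rho; rewrite (ger0_norm rho0) in out.
have thin : @outer R N m rho - rho <= d.
  by rewrite lerBlDl; exact: ann_thin rho0 out (ltW dpos) mrho (ltW md).
have d1 : d <= 1 by lra.
have lo := energy_ann_lower i0 p12 hNp a0 ab mab m0.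
have hi := energy_ann_upper i0 p12 hNp rho0 out mrho m0 thin d1.
have adm := ann_admissible p12 rho0 out mrho.
have := le_trans lo (le_trans (hmin _ adm) hi).
rewrite lee_fin ler_pM2l ?exprn_gt0//.
have s0 : 0 <= a ^+ 2 / limit_sq by rewrite divr_ge0 ?sqr_ge0// ltW.
(* both sides in terms of s = a^2 / limit_sq, where the well of power_well
   appears *)
have a2 : a ^+ 2 = limit_sq * (a ^+ 2 / limit_sq) by rewrite mulrC divfK// gt_eqF.
have E1 : angular_mean i0 p * (a ^+ 2) `^ p = 2 * (limit_sq * (a ^+ 2 / limit_sq) `^ p).
  by rewrite {1}a2 limit_sqP.
have E2 : angular_mean i0 p * (rho ^+ 2) `^ p = 2 * limit_sq.
  by have := limit_sqP ler01; rewrite !mulr1 powR1 mulr1 rho2.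
rewrite E1 E2 rho2 => ineq; apply: (conc d a) => //; first by rewrite dpos.
apply: arith ineq _ a2 => //.
by rewrite lerXn2r// ?nnegrE ?(le_trans a0 (ltW ab))// addr_ge0// ltW.
Qed.

End thin_annuli.

(** * Minimizers and their small mass limit *)

Section minimizers.
Context {R : realType} {N : nat} (i0 : 'I_N) (p : R).
Local Notation mu := (@lebesgueN R N).
Hypothesis p12 : 1 < p < 2.
Hypothesis hNp : 4 < N%:R + 2 * p.
Implicit Types (h k f : vec R N -> R) (m : R) (E : set (vec R N)).
Local Notation Ind a b := (\1_(ann a b : set (vec R N)) : vec R N -> R).

Let N0 : (0 < N)%N. Proof. by case: (N) i0 => [[]|]. Qed.

(** The equilibrium annulus, with [ann_minimal]. *)
Lemma annulus_minimizer m : 0 < m -> exists a b : R, [/\ 0 <= a, a < b, mu (ann a b) = m%:E,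
  is_minimizer (2 * p) 2 m (Ind a b) &
  forall h, is_minimizer (2 * p) 2 m h -> ae_translate h (Ind a b)].
Proof.
move=> m0; have [a [a0 ins outs]] := equilibrium_annulus i0 p12 hNp m0.
have ab := outer_gt i0 m0 a; rewrite (ger0_norm a0) in ab.
have mass := ann_mass i0 m0 a0.
have adm := ann_admissible p12 a0 ab mass.
have key h := ann_minimal p12 m0 a0 ab mass ins outs (h := h).
exists a, (@outer R N m a); split; [exact: a0|exact: ab|exact: mass| |].
  by split; [exact: adm|move=> k ak; have [] := key k ak].
by move=> h [ah hmin]; have [_ H] := key h ah; apply: H; exact: hmin.
Qed.

Lemma ae_translate_sym_trans f1 f2 f : ae_translate f1 f -> ae_translate f2 f -> ae_translate f2 f1.
Proof.
move=> [a1 h1] [a2 h2]; exists (vsub a2 a1).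
have h1' := preserves_ae (sub_shift_preserves (vsub a2 a1)) h1.
apply: filterS2 h1' h2 => x H1 H2 _; rewrite (H2 I) [RHS](H1 I) /translate.
by congr f; apply: vecP => i; rewrite !cosE; ring.
Qed.

(** The equilibrium annulus is a translate of [E] up to a null set, so [E]
    inherits its mass and its energy. *)
Lemma shape_minimal m E : 0 < m -> measurable E -> minimizer_shape (2 * p) 2 m E ->
  mu E = m%:E /\ forall h, admissible m h -> (energy (2 * p) 2 (\1_E : vec R N -> R) <= energy (2 * p) 2 h)%E.
Proof.
move=> m0 mE [_ shape].
have [a [b [a0 ab mass [adm hmin] _]]] := annulus_minimizer m0.
have [c hc] := shape _ (conj adm hmin).
have mA : measurable_fun setT (Ind a b) by exact: measurable_indic (measurable_ann a b).
have mI : measurable_fun setT (\1_E : vec R N -> R) by exact: measurable_indic.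
have mT := measurable_translate c mI.
split; last first.
  by move=> h /hmin; rewrite (energy_ae _ _ mA mT hc) energy_translate.
transitivity (\int[mu]_x (\1_E x)%:E)%E; first by rewrite integral_indic ?setIT.
have mIE : measurable_fun setT (fun x : vec R N => (\1_E x)%:E : \bar R) by exact/measurable_EFinP.
rewrite -(preserves_integral_signed (sub_shift_preserves c) mIE).
transitivity (\int[mu]_x (Ind a b x)%:E)%E.
  apply: ae_eq_integral => //; try exact/measurable_EFinP.
  by apply: filterS hc => x H _; rewrite (H I).
by rewrite integral_indic ?setIT//; exact: measurable_ann.
Qed.

Lemma ball0_ann_ae (b : R) : ae_eq mu setT (\1_(ball0 b) : vec R N -> R) (Ind 0 b).
Proof.
exists [set x | enorm x = 0]; split; [exact: measurable_sphere0|exact: sphere0_null|].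
move=> x /= /not_implyP[_]; apply: contra_notP => /eqP x0.
rewrite !indicE; congr (nat_of_bool _)%:R; apply/idP/idP; rewrite !inE /ball0 /ann /=.
  by move=> ->; rewrite andbT lt_neqAle eq_sym x0 enorm_ge0.
by case/andP.
Qed.

(** A disk is an annulus with [a = 0] up to the origin, so both cases are
    treated alike; only [a > 0] recovers the set itself. *)
Lemma shape_annulus m E : 0 < m -> minimizer_shape (2 * p) 2 m E ->
  exists a b : R, [/\ 0 <= a, a < b, mu (ann a b) = m%:E,
    forall h, admissible m h -> (energy (2 * p) 2 (Ind a b) <= energy (2 * p) 2 h)%E &
    0 < a -> E = ann a b].
Proof.
move=> m0 shape; have [[[a [b [a0 ab EE]]]|[b [b0 EE]]] _] := shape.
  have mE : measurable E by rewrite EE; exact: measurable_ann.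
  have [muE hmin] := shape_minimal m0 mE shape.
  have {}EE : E = ann a b := EE.
  by exists a, b; rewrite -EE.
have {}EE : E = ball0 b := EE.
have mE : measurable E by rewrite EE; exact: measurable_ball0.
have [muE hmin] := shape_minimal m0 mE shape.
exists 0, b; split; [exact: lexx|exact: b0| | |by rewrite ltxx].
  rewrite (ann_vol N0 (lexx 0) (ltW b0)) expr0n eqn0Ngt N0 subr0.
  by rewrite -muE EE -(ball0_volN N0 (ltW b0)).
move=> h /hmin; rewrite EE.
by rewrite (energy_ae _ _ (measurable_indic (measurable_ball0 b)) (measurable_indic (measurable_ann 0 b)) (ball0_ann_ae b)).
Qed.

(** [minimal_annuli_concentrate] controls [a^2 / r^2 - 1]; since [a + r >= r]
    this controls [a - r]. In particular [a > 0]. *)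
Lemma small_mass (E : R -> set (vec R N)) :
  (forall m, 0 < m -> minimizer_shape (2 * p) 2 m (E m)) ->
  exists2 r : R, 0 < r & forall e, 0 < e -> exists2 m1, 0 < m1 & forall m, 0 < m < m1 ->
    exists a b : R, [/\ 0 < a, a < b, E m = ann a b, `|a - r| <= e & `|b - r| <= e].
Proof.
move=> shape; have L0 := limit_sq_gt0 i0 p12 hNp.
pose r := Num.sqrt (limit_sq i0 p).
have r0 : 0 < r by rewrite sqrtr_gt0.
have r2 : r ^+ 2 = limit_sq i0 p by rewrite sqr_sqrtr// ltW.
exists r => // e e0.
(* e1 satisfies e1 < 1 and e1 (r + 1) <= e *)
have re0 : 0 < 2 * (r + 1) + e by lra.
pose e1 := e / (2 * (r + 1) + e).
have e10 : 0 < e1 by rewrite divr_gt0.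
have e11 : e1 < 1 by rewrite ltr_pdivrMr// mul1r; lra.
have ee1 : e1 * (2 * (r + 1) + e) = e by rewrite divfK// gt_eqF.
have [m1 m10 H] := minimal_annuli_concentrate i0 p12 hNp (introT andP (conj e10 e11)).
exists m1 => // m /andP[m0 mm1].
have [a [b [a0 ab mass hmin EE]]] := shape_annulus m0 (shape m m0).
have [conc thin] := H m a b (introT andP (conj m0 mm1)) a0 ab mass hmin.
have dist : `|a - r| <= e1 * r.
  have h1 : `|a ^+ 2 - r ^+ 2| <= e1 * r ^+ 2.
    have -> : a ^+ 2 - r ^+ 2 = (a ^+ 2 / limit_sq i0 p - 1) * r ^+ 2.
      by rewrite r2 mulrBl mul1r divfK// gt_eqF.
    by rewrite normrM (ger0_norm (sqr_ge0 r)) ler_wpM2r ?sqr_ge0// ltW.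
  rewrite subr_sqr normrM in h1.
  have ar0 : r <= `|a + r| by rewrite ger0_norm; lra.
  rewrite -(ler_pM2r r0) -mulrA -expr2; apply: le_trans h1.
  by rewrite ler_wpM2l.
have ap : 0 < a.
  rewrite lt_neqAle a0 andbT; apply/eqP => a00.
  move: conc; rewrite -a00 expr0n /= mul0r sub0r normrN1; lra.
exists a, b; split => //; first exact: EE.
  by apply: (le_trans dist); move: ee1 (mulr_gt0 e10 r0) (mulr_gt0 e10 e0); lra.
have : `|b - r| <= `|b - a| + `|a - r|.
  by rewrite (_ : b - r = (b - a) + (a - r)) ?ler_normD//; ring.
have : `|b - a| <= e1 by rewrite ger0_norm; lra.
move: ee1 (mulr_gt0 e10 r0) (mulr_gt0 e10 e0) dist; move: `|a - r| `|b - a| => X Y; lra.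
Qed.

End minimizers.

Theorem theorem3p8 (R : realType) (N : nat) (alpha beta : R)
  (Hparam : [/\ beta = 2, (2 <= N)%N & 2 < alpha < 4] \/
            [/\ beta = 2, N = 1%N & 3 < alpha < 4]) :
  (forall m : R, 0 < m ->
    [/\ exists f : vec R N -> R, is_minimizer alpha beta m f,
        forall f1 f2 : vec R N -> R, is_minimizer alpha beta m f1 ->
          is_minimizer alpha beta m f2 -> ae_translate f2 f1
      & exists E : set (vec R N), minimizer_shape alpha beta m E]) /\
  (forall E : R -> set (vec R N),
    (forall m : R, 0 < m -> minimizer_shape alpha beta m (E m)) ->
    (\forall m \near 0^'+, is_annulus (E m)) /\
    exists2 r : R, 0 < r &
      hausdorff_dist (E m) (sphere r) @[m --> 0^'+] --> (0%E : \bar R)).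
Proof.
pose p := alpha / 2.
have [-> N0 p12 hNp] : [/\ beta = 2, (0 < N)%N, 1 < p < 2 & 4 < N%:R + 2 * p].
  rewrite /p; case: Hparam => -[-> hN /andP[h1 h2]]; split => //.
  - by case: (N) hN.
  - by apply/andP; split; lra.
  - have : 2 <= N%:R :> R by rewrite ler_nat.
    lra.
  - by rewrite hN.
  - by apply/andP; split; lra.
  - by rewrite hN; lra.
have -> : alpha = 2 * p by rewrite /p mulrC divfK.
have i0 := Ordinal N0; split.
  move=> m m0; have [a [b [a0 ab mass fmin tr]]] := annulus_minimizer i0 p12 hNp m0.
  split; first by exists \1_(ann a b).
    by move=> f1 f2 /tr h1 /tr h2; exact: ae_translate_sym_trans h1 h2.
  by exists (ann a b); split => //; left; exists a, b.
move=> E /(small_mass i0 p12 hNp)[r r0 conc]; split.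
  have [m1 m10 H] := conc 1 ltr01.
  near=> m; have [|a [b [a0 ab -> _ _]]] := H m.
    by apply/andP; split; near: m; [exact: nbhs_right_gt|exact: nbhs_right_lt].
  by exists a, b; split => //; exact: ltW.
exists r => //.
have bound e : 0 < e -> \forall m \near 0^'+, (0 <= hausdorff_dist (E m) (sphere r) <= e%:E)%E.
  move=> e0; have [m1 m10 H] := conc e e0.
  near=> m; have [|a [b [a0 ab -> ar br]]] := H m.
    by apply/andP; split; near: m; [exact: nbhs_right_gt|exact: nbhs_right_lt].
  exact (hausdorff_ann_sphere i0 (ltW a0) ab r0 ar br).
apply/fine_cvgP; split.
  apply: filterS (bound 1 ltr01) => m /andP[h0 h1].
  by rewrite ge0_fin_numE// (le_lt_trans h1) ?ltry.
apply/cvgrPdist_le => e e0; apply: filterS (bound e e0) => m /= /andP[h0 h1].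
rewrite sub0r normrN; move: h0 h1; case: (hausdorff_dist _ _) => [x| |]//=.
by rewrite !lee_fin => x0 xe; rewrite ger0_norm.
Unshelve. all: by end_near. Qed.
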